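(* Let $(\Omega,\mathcal{A})$ be a measurable space, $\mathcal{P}$ a set of probability measures on $(\Omega,\mathcal{A})$, $P_0\in\mathcal{P}$, $\alpha\in(0,1)$, and suppose that the tangent space $T(P_0,\mathcal{P})$ is a (closed) linear subspace of $L_2(P_0)$. Let $k:\mathcal{P}\to\mathbb{R}$ be differentiable at $P_0$ with canonical gradient $\widetilde{k}\in T(P_0,\mathcal{P})$ and $\int\widetilde{k}^2\,dP_0\neq 0$. Put $N(\widetilde k,P_0,\mathcal{P}):=\{h\in T(P_0,\mathcal{P}):\int h\widetilde k\,dP_0=0\}$. Suppose that the set $K(P_0,\mathcal{P})\cap N(\widetilde k,P_0,\mathcal{P})$ is dense in $N(\widetilde k,P_0,\mathcal{P})$ and that $K(P_0,\mathcal{P})$ is dense in $T(P_0,\mathcal{P})$, both with respect to the $L_2(P_0)$-norm. Then the sequence of tests $$\varphi_{2n}=\mathbf{1}_{(u_{1-\alpha/2}\|\widetilde k\|,+\infty)}\Big(\Big|\tfrac{1}{\sqrt n}\sum_{i=1}^n\widetilde k(X_i)\Big|\Big)$$ is asymptotically most powerful in the set of all asymptotically unbiased sequences of tests for $\mathcal{H}_2$ against $\mathcal{K}_2$. That is: $(\varphi_{2n})$ is asymptotically unbiased, and for every asymptotically unbiased sequence of tests $(\psi_n)$ and every $(P_{t_n})_{n\in\mathbb{N}}\in\mathcal{K}_2$, $$\limsup_{n\to\infty}\int\psi_n\,dP_{t_n}^n\le\lim_{n\to\infty}\int\varphi_{2n}\,dP_{t_n}^n .$$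
   Context: Likelihood ratios: for probability measures $P,P_0$, $\frac{dP}{dP_0}$ denotes the $[0,\infty]$-valued likelihood ratio, i.e. the density of the $P_0$-absolutely continuous part of $P$, set equal to $\infty$ on a $P_0$-null set carrying the $P_0$-singular part of $P$. Differentiable curves: a map $(-\varepsilon,\varepsilon)\to\mathcal{P}$, $t\mapsto P_t$ (for some $\varepsilon>0$, taking the value $P_0$ at $t=0$) is an $L_2(P_0)$-differentiable curve in $\mathcal{P}$ with tangent $g\in L_2(P_0)$ if $\lim_{t\to0}\big\|\frac2t\big(\big(\frac{dP_t}{dP_0}\big)^{1/2}-1\big)-g\big\|_{L_2(P_0)}=0$ and $\lim_{t\to0}\frac1{t^2}P_t\big(\big\{\frac{dP_t}{dP_0}=\infty\big\}\big)=0$. Tangents: $K(P_0,\mathcal{P})$ is the set of tangents of all $L_2(P_0)$-differentiable curves in $\mathcal{P}$; $T(P_0,\mathcal{P})$ is the $L_2(P_0)$-closure of $K(P_0,\mathcal{P})$. $L_2^{(0)}(P_0)=\{h\in L_2(P_0):\int h\,dP_0=0\}$. Differentiable functionals: $k$ is differentiable at $P_0$ with gradient $\dot k\in L_2^{(0)}(P_0)$ if $\lim_{t\downarrow0}\frac1t(k(P_t)-k(P_0))=\int\dot k g\,dP_0$ for all $L_2(P_0)$-differentiable curves $t\mapsto P_t$ in $\mathcal{P}$ with tangent $g$. The canonical gradient $\widetilde k$ is the gradient belonging to $T(P_0,\mathcal{P})$ that has the smallest $L_2(P_0)$-norm among all gradients (it is the orthogonal projection of any gradient on $T(P_0,\mathcal{P})$).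 The set $\mathcal{F}$: all sequences $(P_{t_n})_{n\in\mathbb{N}}$ such that $t_n\in[0,\infty)$, the limit $\lim_{n\to\infty}t_n\sqrt n$ exists in $(0,\infty)$, and there are $\varepsilon>0$ and an $L_2(P_0)$-differentiable curve $f:(-\varepsilon,\varepsilon)\to\mathcal{P}$ with $f(t_n)=P_{t_n}$ for all $n$. Implicit alternatives and hypotheses: $\mathcal{K}_2=\{(P_{t_n})\in\mathcal{F}:\lim_n\sqrt n(k(P_{t_n})-k(P_0))\ne0\}$, $\mathcal{H}_2=\{(P_{t_n})\in\mathcal{F}:\lim_n\sqrt n(k(P_{t_n})-k(P_0))=0\}$. Tests: a sequence of tests is a sequence of measurable functions $\psi_n:\Omega^n\to[0,1]$. It is asymptotically unbiased (for $\mathcal{H}_2$ against $\mathcal{K}_2$) if $\lim_{n\to\infty}\int\psi_n\,dP_{t_n}^n\ge\alpha$ for all $(P_{t_n})\in\mathcal{K}_2$ and $\lim_{n\to\infty}\int\psi_n\,dP_{t_n}^n\le\alpha$ for all $(P_{t_n})\in\mathcal{H}_2$ (the limits being required to exist). $X_1,\dots,X_n$ are the canonical projections on $\Omega^n$; $P^n$ is the $n$-fold product measure; $\|\widetilde k\|=(\int\widetilde k^2\,dP_0)^{1/2}$; $u_\beta$ is the $\beta$-quantile of the standard normal distribution. *)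

(* Defs.v *)
From HB Require Import structures.
From mathcomp Require Import all_boot all_order all_algebra.
From mathcomp Require Import all_classical all_reals all_analysis.
From mathcomp Require Import measurable_realfun.
Set Implicit Arguments.
Unset Strict Implicit.
Unset Printing Implicit Defensive.
Import Order.TTheory GRing.Theory Num.Theory.
Import numFieldNormedType.Exports.
Local Open Scope classical_set_scope.
Local Open Scope ring_scope.

Section product_power.
Context d (T : measurableType d) (R : realType).

Definition tuple_cons n (xs : T * n.-tuple T) : n.+1.-tuple T :=
  [tuple of xs.1 :: xs.2].

Lemma measurable_tuple_cons n : measurable_fun setT (@tuple_cons n).
Proof. exact: measurable_cons. Qed.

HB.instance Definition _ n :=
  isMeasurableFun.Build _ _ _ _ (@tuple_cons n) (@measurable_tuple_cons n).

(* The n-fold product measure P^n, on the sigma-algebra of n.-tuple T generated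
   by the coordinate projections tnth ^~ i. *)
Fixpoint power_probability (P : probability T R) n :
    probability (n.-tuple T) R :=
  if n is m.+1 then
    distribution (P \x power_probability P m)%E (@tuple_cons m)
  else \d_([tuple] : 0.-tuple T).

Lemma power_probabilityE (P : probability T R) n (A : 'I_n -> set T) :
  (forall i, measurable (A i)) ->
  power_probability P n [set x | forall i, A i (tnth x i)] =
  (\prod_(i < n) P (A i))%E.
Proof.
elim: n A => [|n IH] A mA.
  rewrite big_ord0 /= diracE mem_set//; by case.
rewrite big_ord_recl -IH//.
rewrite -product_measure1E//; last first.
  rewrite (_ : [set _ | _] = \bigcap_(i in [set: 'I_n])
    ((fun x : n.-tuple T => tnth x i) @^-1` A (lift ord0 i))); last first.
    by apply/seteqP; split => x /= h i; [move=> _; exact: h|exact: h].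
  apply: fin_bigcap_measurable => // i _.
  by rewrite -[X in measurable X]setTI; exact: measurable_tnth.
rewrite /= /distribution /pushforward; congr (_ _).
apply/seteqP; split => [[x t] /= h|[x t] /= [h0 h] i].
  split; first exact: (h ord0).
  by move=> i; have := h (lift ord0 i); rewrite tnthS.
case: (unliftP ord0 i) => [j ->|->]; last exact: h0.
by rewrite tnthS; exact: h.
Qed.

End product_power.

Section curves.
Context d (Omega : measurableType d) (R : realType).
Implicit Types (P : probability Omega R) (PP : set (probability Omega R)).
Implicit Types (g h : Omega -> R) (A B : set (Omega -> R)).

Local Notation L2 P := (Lfun P 2%:E).

(* L is a version of dP/dP0: the P0-null set [L = +oo] carries the P0-singular
   part of P, and L is the P0-density of the remaining part.  Versions are
   unique up to (P + P0)-null sets. *)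
Definition is_likelihood_ratio P P0 (L : Omega -> \bar R) : Prop :=
  [/\ measurable_fun setT L,
      (forall x, 0 <= L x)%E,
      P0 [set x | L x = +oo%E] = 0%E &
      forall E : set Omega, measurable E ->
        P E = (\int[P0]_(x in E) L x + P (E `&` [set x | L x = +oo]))%E].

(* Only the restriction of the curve c to ]-eps, eps[ is relevant.  Elements of
   L_2(P0) are represented by functions, not by classes modulo P0-a.e.
   equality. *)
Definition differentiable_curve PP P0 (eps : R) (c : R -> probability Omega R)
    g : Prop :=
  [/\ 0 < eps,
      (forall t, `|t| < eps -> PP (c t)),
      c 0 = P0,
      g \in L2 P0 &
      exists L : R -> Omega -> \bar R,
        [/\ (forall t, `|t| < eps -> is_likelihood_ratio (c t) P0 (L t)),
            'N[P0]_(2%:E)[(fun x =>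
                (2 / t)%:E * (sqrte (L t x) - 1) - (g x)%:E)]%E
              @[t --> 0^'] --> 0%E &
            ((t ^- 2)%:E * c t [set x | L t x = +oo])%E
              @[t --> 0^'] --> 0%E]].

Definition tangents PP P0 : set (Omega -> R) :=
  [set g | exists eps c, differentiable_curve PP P0 eps c g].

Definition L2_closure P0 A : set (Omega -> R) :=
  [set h | h \in L2 P0 /\ forall e : R, 0 < e ->
     exists2 g, A g & ('N[P0]_(2%:E)[(fun x => (g x - h x)%:E)] < e%:E)%E].

Definition tangent_space PP P0 := L2_closure P0 (tangents PP P0).

Definition L2_dense_in P0 A B : Prop := A `<=` B /\ B `<=` L2_closure P0 A.

(* k is a functional on PP: its values outside PP are never used. *)
Definition is_gradient PP P0 (k : probability Omega R -> R) (dk : Omega -> R)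
    : Prop :=
  [/\ dk \in L2 P0,
      \int[P0]_x dk x = 0 &
      forall eps c g, differentiable_curve PP P0 eps c g ->
        t^-1 * (k (c t) - k P0) @[t --> 0^'+] --> \int[P0]_x (dk x * g x)].

Definition differentiable_functional PP P0 k : Prop :=
  exists dk, is_gradient PP P0 k dk.

Definition is_canonical_gradient PP P0 k (dk : Omega -> R) : Prop :=
  [/\ is_gradient PP P0 k dk,
      tangent_space PP P0 dk &
      forall dk', is_gradient PP P0 k dk' ->
        ('N[P0]_(2%:E)[EFin \o dk] <= 'N[P0]_(2%:E)[EFin \o dk'])%E].

Definition orthogonal_tangents PP P0 (dk : Omega -> R) : set (Omega -> R) :=
  [set h | tangent_space PP P0 h /\ \int[P0]_x (h x * dk x) = 0].

(* The index 0 is harmless: any sequence indexed by n > 0 extends to it through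
   t 0 = 0, and all the statements below are asymptotic. *)
Definition curve_sequences PP P0 : set (nat -> probability Omega R) :=
  [set Q | exists t : nat -> R,
    [/\ (forall n, 0 <= t n),
        (exists2 c : R, 0 < c & t n * Num.sqrt n%:R @[n --> \oo] --> c) &
        exists eps f g, differentiable_curve PP P0 eps f g /\
          forall n, t n < eps /\ f (t n) = Q n]].

Definition implicit_alternatives PP P0 k : set (nat -> probability Omega R) :=
  [set Q | curve_sequences PP P0 Q /\ exists2 l : R, l != 0 &
    Num.sqrt n%:R * (k (Q n) - k P0) @[n --> \oo] --> l].

Definition implicit_hypotheses PP P0 k : set (nat -> probability Omega R) :=
  [set Q | curve_sequences PP P0 Q /\
    Num.sqrt n%:R * (k (Q n) - k P0) @[n --> \oo] --> (0 : R)].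

End curves.

Section tests.
Context d (Omega : measurableType d) (R : realType).
Implicit Types (psi phi : forall n, n.-tuple Omega -> R).
Implicit Types (Q : nat -> probability Omega R).
Implicit Types (HH KK : set (nat -> probability Omega R)).

Definition is_test_sequence psi : Prop :=
  forall n, measurable_fun setT (psi n) /\ forall x, 0 <= psi n x <= 1.

Definition expectation_seq psi Q (n : nat) : \bar R :=
  (\int[power_probability (Q n) n]_x (psi n x)%:E)%E.

Definition asymptotically_unbiased (alpha : R) HH KK psi : Prop :=
  [/\ is_test_sequence psi,
      (forall Q, KK Q -> cvgn (expectation_seq psi Q) /\
        (alpha%:E <= limn (expectation_seq psi Q))%E) &
      (forall Q, HH Q -> cvgn (expectation_seq psi Q) /\
        (limn (expectation_seq psi Q) <= alpha%:E)%E)].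

Definition asymptotically_most_powerful_unbiased (alpha : R) HH KK phi
    : Prop :=
  asymptotically_unbiased alpha HH KK phi /\
  forall psi, asymptotically_unbiased alpha HH KK psi ->
    forall Q, KK Q ->
      (limn_esup (expectation_seq psi Q) <= limn (expectation_seq phi Q))%E.

(* The second argument of normal_prob is the standard deviation. *)
Definition std_normal_quantile (b : R) : R :=
  inf [set x : R | (b%:E <= normal_prob 0 1 `]-oo, x])%E].

Definition two_sided_test (P0 : probability Omega R) (dk : Omega -> R)
    (alpha : R) n : n.-tuple Omega -> R :=
  let norm := Num.sqrt (\int[P0]_x (dk x ^+ 2)) in
  \1_[set x | std_normal_quantile (1 - alpha / 2) * norm <
        `|(Num.sqrt n%:R)^-1 * \sum_(i < n) dk (tnth x i)| ].

End tests.

(* Main.v *)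
(* Asymptotically, a curve sequence with tangent h is as good as its exponential
   tilt: after approximating h in L_2 by a bounded centered function, the Hellinger
   distance between P_{t_n}^n and the measure with P0^n-density
   exp(n^(-1/2) sum_i h(x_i) - ||h||^2 / 2) becomes small, so that the expectations
   of all tests agree up to a small error.  Under these tilts a central limit theorem
   gives the power of the two-sided test as a function of <dk, h> alone.

   Optimality is a generalized Neyman-Pearson argument at finite n.  Write
   h = hp + a dk with hp orthogonal to dk, and let kap > 0.  The density at h, plus a
   positive multiple of the density at the alternative hp - kap a dk, minus a positive
   multiple of the density at the hypothesis hp, is proportional to a function of
   n^(-1/2) sum_i dk(x_i) which is positive exactly outside [-c, c] for suitable
   multiples.  Unbiasedness controls the last two terms, and the excess of the power
   at hp - kap a dk over the level is O(kap^2) whereas its multiple is O(1/kap), so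
   that this term disappears as kap tends to 0. *)
Require Import Defs.
From HB Require Import structures.
From mathcomp Require Import all_boot all_order all_algebra.
From mathcomp Require Import all_classical all_reals all_analysis.
From mathcomp Require Import measurable_realfun.
From mathcomp Require Import ring lra.
Set Implicit Arguments.
Unset Strict Implicit.
Unset Printing Implicit Defensive.
Import Order.TTheory GRing.Theory Num.Theory.
Import numFieldNormedType.Exports.
Local Open Scope classical_set_scope.
Local Open Scope ring_scope.

(** * The standard normal distribution *)

(** Classically, two-sided optimality rests on the derivative of the power function of an unbiased
    test vanishing at the hypothesis. Here unbiasedness only concerns limits along single curve
    sequences, so no such derivative is at hand. The alternative [hp - kap a dk], on the other side
    of the hypothesis, serves as a difference quotient: exp(-kap a z) is 1 - kap a z up to second
    order, so a large multiple of it supplies the linear term of the chord of exp(a z) through -c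
    and c. The excess of power there has no first-order term in kap because the limiting power is
    even in <dk, h>.

    Neither [hp] nor [hp - kap a dk] need be a tangent. The first is approximated by tangents
    orthogonal to dk, the second by tangents not orthogonal to dk, and a further approximation by
    bounded centered functions makes the tilts available. All these errors are multiplied by
    coefficients that may explode as kap tends to 0. This dictates the order of the limits: n tends
    to infinity, then the approximations are refined at fixed kap, and kap tends to 0 last. *)

Lemma is_derive_continuous (R : realType) (f df : R -> R) :
  (forall x : R, is_derive x (1 : R) f (df x)) -> continuous f.
Proof.
move=> fdf x; apply: differentiable_continuous.
by apply/derivable1_diffP; have [] := fdf x.
Qed.

(** Iterated below on Taylor remainders, each of which has the preceding one as derivative. The
    condition on a ball around [y] treats both positions of [x] at once. *)
Lemma mean_value_bound (R : realType) (f df : R -> R) (M x y : R) :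
  (forall z : R, is_derive z (1 : R) f (df z)) ->
  (forall z, `|z - y| <= `|x - y| -> `|df z| <= M) ->
  `|f x - f y| <= M * `|x - y|.
Proof.
move=> fdf dfM.
have cf := is_derive_continuous fdf.
have [xy|yx|->] := ltgtP x y; last by rewrite !subrr normr0 mulr0.
- have [c cab E] := MVT xy (fun z _ => fdf z) (@continuous_subspaceT _ _ _ _ cf).
  rewrite distrC E normrM [`|y - x|]distrC ler_wpM2r// dfM//.
  move: cab; rewrite in_itv/= => /andP[h1 h2].
  by rewrite !ltr0_norm ?subr_lt0//; lra.
- have [c cab E] := MVT yx (fun z _ => fdf z) (@continuous_subspaceT _ _ _ _ cf).
  rewrite E normrM ler_wpM2r// dfM//.
  move: cab; rewrite in_itv/= => /andP[h1 h2].
  by rewrite !gtr0_norm ?subr_gt0//; lra.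
Qed.

Section standard_normal.
Context {R : realType}.
Implicit Types x y q : R.

Definition phi x : R := normal_pdf 0 1 x.
Definition Phi x : R := fine (normal_prob 0 1 `]-oo, x]).

Lemma phiE x : phi x = normal_peak 1 * expR (- (x ^+ 2 / 2)).
Proof.
rewrite /phi normal_pdfE ?oner_eq0// /normal_fun.
by rewrite subr0 mulNr expr1n.
Qed.

Lemma phi_gt0 x : 0 < phi x.
Proof. by rewrite phiE mulr_gt0 ?expR_gt0// normal_peak_gt0// oner_eq0. Qed.

Lemma phi_ge0 x : 0 <= phi x. Proof. exact/ltW/phi_gt0. Qed.

Lemma phiN x : phi (- x) = phi x.
Proof. by rewrite !phiE sqrrN. Qed.

Lemma is_derive_phi x : is_derive x (1 : R) phi (- (x * phi x)).
Proof.
have -> : phi = fun x => normal_peak 1 * expR (- (x ^+ 2 / 2)).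
  by apply/funext => z; rewrite phiE.
apply: is_derive_eq.
by rewrite /GRing.scale/=; field.
Qed.

Lemma normal_peak1_le1 : normal_peak (1 : R) <= 1.
Proof.
rewrite /normal_peak invf_le1 ?sqrtr_gt0; last first.
  by rewrite expr1n mul1r mulr2n addr_gt0// pi_gt0.
rewrite -[leLHS]sqrtr1 ler_wsqrtr// expr1n mul1r.
by have := pi_ge2 R; lra.
Qed.

(** With t = q^2 / 2, the bound exp t >= 1 + t^2 / 2 gives quartic growth in q, which beats the
    cube. This is the uniform source of the constant 24 in all derivative bounds below. *)
Lemma poly_mul_phi_le (q : R) : (1 + `|q|) ^+ 3 * phi q <= 24.
Proof.
rewrite phiE.
have e0 : 0 <= expR (- (q ^+ 2 / 2)) by exact: expR_ge0.
apply: (@le_trans _ _ ((1 + `|q|) ^+ 3 * expR (- (q ^+ 2 / 2)))).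
  rewrite ler_wpM2l ?exprn_ge0 ?addr_ge0// ler_piMl//.
  exact: normal_peak1_le1.
rewrite expRN ler_pdivrMr ?expR_gt0//.
have t0 : 0 <= q ^+ 2 / 2 by rewrite divr_ge0 ?sqr_ge0.
have := expR_ge1Dxn 1 t0.
have h : (1 + `|q|) ^+ 3 <= 24 * (1 + (q^+2/2)^+2 / 2%N`!%:R).
  rewrite -(real_normK (num_real q)); set a := `|q|.
  have a0 : 0 <= a by exact: normr_ge0.
  rewrite (_ : 2%N`!%:R = 2)//.
  rewrite -subr_ge0.
  (* A decomposition into squares plus a positive constant certifies the quartic inequality. *)
  rewrite (_ : _ - _ = a ^+ 2 * (a - 1) ^+ 2 / 2 + 3 / 2 * (a - 1) ^+ 2
    + 5 / 2 * (a ^+ 2 - 1) ^+ 2 + 19); last by field.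
  have := sqr_ge0 (a * (a - 1)); have := sqr_ge0 (a - 1).
  by have := sqr_ge0 (a ^+ 2 - 1); rewrite exprMn; lra.
by move=> h2; apply: (le_trans h); rewrite ler_wpM2l.
Qed.

Lemma integrable_phi (A : set R) : measurable A ->
  lebesgue_measure.-integrable A (EFin \o phi).
Proof.
move=> mA; apply: (@integrableS _ _ _ _ setT) => //.
exact: integrable_normal_pdf.
Qed.

Lemma is_derive_Phi x : is_derive x (1 : R) Phi (phi x).
Proof.
have [dF F'] : derivable Phi x 1 /\ derive1 Phi x = phi x.
  apply: (@continuous_FTC1 R phi -oo%O x (x + 1)).
  - by rewrite ltrDl.
  - exact: integrable_phi.
  - by rewrite ltNyr.
  - by apply: continuous_normal_pdf; rewrite oner_eq0.
by apply: (DeriveDef dF); rewrite -derive1E.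
Qed.

Lemma Phi_ge0 x : 0 <= Phi x.
Proof. by rewrite /Phi fine_ge0. Qed.

Lemma EFin_Phi x : (Phi x)%:E = normal_prob 0 1 `]-oo, x].
Proof. by rewrite /Phi fineK// fin_num_measure. Qed.

Lemma Phi_le1 x : Phi x <= 1.
Proof. by rewrite -lee_fin EFin_Phi probability_le1. Qed.

Lemma continuous_Phi : continuous Phi.
Proof. exact: is_derive_continuous is_derive_Phi. Qed.

Lemma Phi_lt x y : x < y -> Phi x < Phi y.
Proof.
move=> xy.
have [c _ E] := MVT xy (fun z _ => is_derive_Phi z)
  (@continuous_subspaceT _ _ _ _ continuous_Phi).
by rewrite -subr_gt0 E mulr_gt0 ?phi_gt0// subr_gt0.
Qed.

Lemma Phi_le : {mono Phi : x y / x <= y}.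
Proof. exact/le_mono/Phi_lt. Qed.

Lemma cvg_Phi_nat : Phi n%:R @[n --> \oo] --> (1 : R).
Proof.
have : (normal_prob 0 1 `]-oo, n%:R] @[n --> \oo] --> (1 : \bar R))%E.
  rewrite -(@probability_setT _ _ _ (normal_prob (0 : R) 1)).
  have -> : [set: R] = \bigcup_n `]-oo, (n%:R : R)]%classic.
    apply/esym; rewrite -subTset => x _; exists (Num.truncn `|x|).+1 => //=.
    rewrite in_itv/=; apply: (le_trans (ler_norm x)).
    exact/ltW/truncnS_gt.
  apply: nondecreasing_cvg_mu => //.
  - by apply: bigcup_measurable.
  - move=> m n mn; apply/subsetPset => x/=; rewrite !in_itv/= => /le_trans; apply.
    by rewrite ler_nat.
rewrite (_ : (fun n => _) = (fun n => (Phi n%:R)%:E)).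
  by move/fine_cvgP => [].
by apply/funext => n; rewrite EFin_Phi.
Qed.

Lemma Phi0 : Phi 0 = 1 / 2.
Proof.
have phiTE := integral_normal_pdf 0 (1 : R).
have := @ge0_symfun_integralT R phi phi_ge0
  (@continuous_normal_pdf R 0 1 (oner_neq0 R)) (fun x => esym (phiN x)).
rewrite [X in X = _]phiTE.
have -> : (\int[lebesgue_measure]_(x in [set x : R | (0 <= x)%R]) (phi x)%:E)%E =
    (1 - Phi 0)%:E.
  rewrite -set_itvcy EFinB EFin_Phi -probability_setC// setCitvl.
  rewrite -[RHS]/(\int[lebesgue_measure]_(x in _) (phi x)%:E)%E.
  rewrite integral_itv_obnd_cbnd//.
  apply/measurable_EFinP; apply: measurable_funTS.
  exact: measurable_normal_pdf.
by rewrite -EFinM => -[]; lra.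
Qed.

(** The derivative of [Phi x + Phi (- x)] vanishes because [phi] is even, and the constant is read
    off at 0. *)
Lemma PhiN x : Phi (- x) = 1 - Phi x.
Proof.
pose F := Phi + (Phi \o -%R).
have dF z : is_derive z (1 : R) F 0.
  have h1 := is_derive_Phi z; have h2 := is_derive_Phi (- z).
  apply: is_derive_eq.
  by rewrite phiN mulrN1 subrr.
have /(_ 0) := is_derive_0_is_cst x _ dF.
by rewrite /F !fctE /= oppr0 Phi0; lra.
Qed.

Lemma ex_Phi b : 0 < b < 1 -> exists x, Phi x = b.
Proof.
move=> /andP[b0 b1].
have /cvgrPdist_lt/(_ (Num.min b (1 - b))) := cvg_Phi_nat.
rewrite lt_min b0 subr_gt0 b1 => /(_ isT)[n _ /(_ n (leqnn n))].
rewrite lt_min => /andP[h1 h2].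
have {}h1 : 1 - Phi n%:R < b := le_lt_trans (ler_norm _) h1.
have {}h2 : b < Phi n%:R.
  by have := le_lt_trans (ler_norm _) h2; lra.
have [|||x _ <-] := @IVT R Phi (- n%:R) n%:R b.
- by rewrite -subr_ge0 opprK addr_ge0.
- exact: continuous_subspaceT continuous_Phi.
- rewrite PhiN ge_min (ltW h1) le_max (ltW h2)/= ?orbT//.
- by exists x.
Qed.

(** [Phi] is continuous and strictly increasing, so the set in the infimum is a closed half-line
    starting at the preimage of [b]. *)
Lemma Phi_quantile b : 0 < b < 1 -> Phi (std_normal_quantile b) = b.
Proof.
move=> /ex_Phi[x <-]; congr Phi.
rewrite /std_normal_quantile (_ : [set _ | _] = `[x, +oo[%classic) ?inf_itv//.
by apply/seteqP; split => y /=; rewrite -EFin_Phi lee_fin Phi_le in_itv/= andbT.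
Qed.

Lemma quantile_gt0 (b : R) : 1 / 2 < b < 1 -> 0 < std_normal_quantile (b : R).
Proof.
move=> /andP[b2 b1]; rewrite ltNge; apply/negP => h.
have := h; rewrite -Phi_le Phi0 Phi_quantile; last by rewrite b1 andbT; lra.
by lra.
Qed.

End standard_normal.

(** * Product measures and square-integrable functions *)

Section power_integral.
Context d (T : measurableType d) (R : realType).
Implicit Types (P Q : probability T R) (u l : T -> R).

Lemma ge0_integral_powerS P n (F : n.+1.-tuple T -> \bar R) :
  measurable_fun setT F -> (forall x, 0 <= F x)%E ->
  (\int[power_probability P n.+1]_x F x =
   \int[P]_x \int[power_probability P n]_xs F (tuple_cons (x, xs)))%E.
Proof.
move=> mF F0 /=; rewrite ge0_integral_distribution// fubini_tonelli1//=.
by apply: measurableT_comp => //; exact: measurable_tuple_cons.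
Qed.

Lemma ge0_measurable_power_section P n (F : n.+1.-tuple T -> \bar R) :
  measurable_fun setT F -> (forall x, 0 <= F x)%E ->
  measurable_fun setT
    (fun x => \int[power_probability P n]_xs F (tuple_cons (x, xs)))%E.
Proof.
move=> mF F0.
apply: (@measurable_fun_fubini_tonelli_F _ _ _ _ _ (power_probability P n)
  (F \o @tuple_cons _ T n)) => //=.
by apply: measurableT_comp => //; exact: measurable_tuple_cons.
Qed.

Lemma integral_power0 P (F : 0.-tuple T -> \bar R) :
  measurable_fun setT F ->
  (\int[power_probability P 0]_x F x = F [tuple])%E.
Proof. by move=> mF; rewrite /= integral_dirac// diracT mul1e. Qed.

Lemma measurable_tuple_cons_section n (x : T) :
  measurable_fun setT (fun xs : n.-tuple T => tuple_cons (x, xs)).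
Proof.
by apply: measurableT_comp => //; exact: measurable_tuple_cons.
Qed.

Definition tuple_prod n u (x : n.-tuple T) : R := \prod_(i < n) u (tnth x i).
Definition tuple_sum n u (x : n.-tuple T) : R := \sum_(i < n) u (tnth x i).

Lemma tuple_prod_cons n u x (xs : n.-tuple T) :
  tuple_prod u (tuple_cons (x, xs)) = u x * tuple_prod u xs.
Proof.
rewrite /tuple_prod big_ord_recl; congr (_ * _).
by apply: eq_bigr => i _; rewrite tnthS.
Qed.

Lemma tuple_sum_cons n u x (xs : n.-tuple T) :
  tuple_sum u (tuple_cons (x, xs)) = u x + tuple_sum u xs.
Proof.
rewrite /tuple_sum big_ord_recl; congr (_ + _).
by apply: eq_bigr => i _; rewrite tnthS.
Qed.

Lemma measurable_tuple_prod n u : measurable_fun setT u ->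
  measurable_fun setT (@tuple_prod n u).
Proof.
move=> mu; apply: measurable_prod => i _.
by apply: measurableT_comp => //; exact: measurable_tnth.
Qed.

Lemma measurable_tuple_sum n u : measurable_fun setT u ->
  measurable_fun setT (@tuple_sum n u).
Proof.
move=> mu; apply: measurable_sum => i.
by apply: measurableT_comp => //; exact: measurable_tnth.
Qed.

Lemma tuple_prod_ge0 n u (x : n.-tuple T) : (forall y, 0 <= u y) ->
  0 <= tuple_prod u x.
Proof. by move=> u0; apply: prodr_ge0. Qed.

Lemma integral_tuple_prod P u (m : R) n : measurable_fun setT u ->
  (forall y, 0 <= u y) -> (\int[P]_x (u x)%:E = m%:E)%E ->
  (\int[power_probability P n]_x (tuple_prod u x)%:E = (m ^+ n)%:E)%E.
Proof.
move=> mu u0 um; elim: n => [|n IH].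
  rewrite integral_power0; first by rewrite /tuple_prod big_ord0.
  by apply/measurable_EFinP; apply: measurable_tuple_prod.
rewrite ge0_integral_powerS; last 2 first.
- by apply/measurable_EFinP; apply: measurable_tuple_prod.
- by move=> x; rewrite lee_fin tuple_prod_ge0.
under eq_integral.
  move=> x _; under eq_integral do rewrite tuple_prod_cons EFinM.
  rewrite ge0_integralZl//; last 3 first.
  - by apply/measurable_EFinP; apply: measurable_tuple_prod.
  - by move=> y _; rewrite lee_fin tuple_prod_ge0.
  - by rewrite lee_fin.
  rewrite IH; over.
rewrite ge0_integralZr//; last 3 first.
- exact/measurable_EFinP.
- by move=> y _; rewrite lee_fin.
- rewrite lee_fin exprn_ge0// -lee_fin -um integral_ge0// => y _.
  by rewrite lee_fin.
by rewrite um -EFinM exprS.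
Qed.

(** Induction on the number of coordinates by Tonelli: the hypothesis on one coordinate is applied
    to the integral over the others. Working with an inequality avoids describing the singular part
    of the product measure. *)
Lemma tensorized_domination P Q l n (F : n.-tuple T -> \bar R) :
  measurable_fun setT l -> (forall y, 0 <= l y) ->
  (forall f : T -> \bar R, measurable_fun setT f -> (forall x, 0 <= f x) ->
     \int[P]_x (f x * (l x)%:E) <= \int[Q]_x f x)%E ->
  measurable_fun setT F -> (forall x, 0 <= F x)%E ->
  (\int[power_probability P n]_x (F x * (tuple_prod l x)%:E) <=
   \int[power_probability Q n]_x F x)%E.
Proof.
move=> ml l0 lPQ; elim: n F => [|n IH] F mF F0.
  rewrite !integral_power0//; last first.
    by apply: emeasurable_funM => //; apply/measurable_EFinP; apply: measurable_tuple_prod.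
  by rewrite /tuple_prod big_ord0 mule1.
rewrite !ge0_integral_powerS//; last 2 first.
- by apply: emeasurable_funM => //; apply/measurable_EFinP; apply: measurable_tuple_prod.
- by move=> x; rewrite mule_ge0// lee_fin tuple_prod_ge0.
have mFx x : measurable_fun setT (fun xs : n.-tuple T => F (tuple_cons (x, xs))).
  by apply: measurableT_comp => //; exact: measurable_tuple_cons_section.
have mI := @ge0_measurable_power_section Q n F mF F0.
apply: le_trans; last first.
  apply: lPQ => //.
  by move=> x; apply: integral_ge0.
apply: ge0_le_integral => //.
- move=> x _; apply: integral_ge0 => y _.
  by rewrite mule_ge0// lee_fin tuple_prod_ge0.
- apply: (@ge0_measurable_power_section P _ (fun x => (F x * (tuple_prod l x)%:E)%E)).
    by apply: emeasurable_funM => //; apply/measurable_EFinP; apply: measurable_tuple_prod.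
  by move=> x; rewrite mule_ge0// lee_fin tuple_prod_ge0.
- by apply: emeasurable_funM => //; exact/measurable_EFinP.
move=> x _.
rewrite [leLHS](_ : _ = ((l x)%:E * \int[power_probability P n]_xs
    (F (tuple_cons (x, xs)) * (tuple_prod l xs)%:E))%E); last first.
  rewrite -ge0_integralZl//; last 3 first.
  - by apply: emeasurable_funM => //; apply/measurable_EFinP; apply: measurable_tuple_prod.
  - by move=> y _; rewrite mule_ge0// lee_fin tuple_prod_ge0.
  - by rewrite lee_fin.
  apply: eq_integral => xs _.
  by rewrite tuple_prod_cons EFinM muleCA.
by rewrite muleC lee_wpmul2r// ?lee_fin// IH.
Qed.

End power_integral.

(** * Hilbert space calculus in L_2(P), on representatives *)

Section square_integrable.
Context d (T : measurableType d) (R : realType) (P : probability T R).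
Implicit Types (f g h : T -> R).

Lemma bounded_integrable f M : measurable_fun setT f ->
  (forall x, `|f x| <= M) -> P.-integrable setT (EFin \o f).
Proof.
move=> mf fM; apply: measurable_bounded_integrable => //.
  by rewrite -ge0_fin_numE// fin_num_measure.
exists M; split; first exact: num_real.
by move=> y My x _ /=; rewrite (le_trans (fM x))// ltW.
Qed.

(** Membership in L_2(P), as [sqintP] shows, in a form suited to real-valued integrals. *)
Definition sqint f :=
  measurable_fun setT f /\ P.-integrable setT (fun x => (f x ^+ 2)%:E).

Definition inner f g := \int[P]_x (f x * g x).
Definition norm2 f := Num.sqrt (\int[P]_x (f x ^+ 2)).

Lemma sqintP f : f \in Lfun P 2%:E <-> sqint f.
Proof.
split=> [f2|[mf if2]].
  split; first by move: f2; rewrite inE => /andP[/[!inE]/=].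
  exact: Lfun2_integrable_sqr f2.
rewrite inE; apply/andP; split; first by rewrite inE.
rewrite inE /finite_norm unlock /=.
rewrite poweR_lty// (_ : (\int[P]_x _)%E = (\int[P]_x (f x ^+ 2)%:E)%E).
  by rewrite ltey_eq integrable_fin_num.
apply: eq_integral => x _.
by rewrite /= powR_mulrn// real_normK// num_real.
Qed.

Lemma Lnorm_norm2 f : sqint f -> 'N[P]_2%:E[EFin \o f]%E = (norm2 f)%:E.
Proof.
move=> [mf if2]; rewrite unlock /=.
rewrite (_ : (\int[P]_x _)%E = (\int[P]_x f x ^+ 2)%:E).
  rewrite poweR_EFin powR12_sqrt//.
  by apply: Rintegral_ge0 => x _; exact: sqr_ge0.
rewrite /Rintegral fineK; last by apply: integrable_fin_num.
apply: eq_integral => x _.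
by rewrite /= powR_mulrn// real_normK// num_real.
Qed.

Lemma sqint_bounded f M : measurable_fun setT f -> (forall x, `|f x| <= M) ->
  sqint f.
Proof.
move=> mf fM; split=> //.
apply: (@bounded_integrable _ (M ^+ 2)); first exact: measurable_funX.
move=> x; rewrite normrX lerXn2r ?nnegrE//.
exact: le_trans (fM x).
Qed.

Lemma sqint_mul f g : sqint f -> sqint g ->
  P.-integrable setT (fun x => (f x * g x)%:E).
Proof.
move=> [mf if2] [mg ig2].
apply: (le_integrable _ _ _ (integrableD _ if2 ig2)) => //.
  by apply/measurable_EFinP; exact: measurable_funM.
move=> x _ /=; rewrite lee_fin normrM.
rewrite [leRHS]ger0_norm ?addr_ge0 ?sqr_ge0//.
rewrite -(real_normK (num_real (f x))) -(real_normK (num_real (g x))).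
have := sqr_ge0 (`|f x| - `|g x|).
by have := sqr_ge0 `|f x|; have := sqr_ge0 `|g x|; nra.
Qed.

Lemma sqint_cst c : sqint (fun=> c).
Proof. exact: (@sqint_bounded _ `|c|). Qed.

Lemma sqint_integrable f : sqint f -> P.-integrable setT (EFin \o f).
Proof.
move=> sf; have := sqint_mul sf (sqint_cst 1).
by under eq_fun do rewrite mulr1.
Qed.

Lemma sqintZ a f : sqint f -> sqint (fun x => a * f x).
Proof.
move=> [mf if2]; split; first exact: measurable_funM.
rewrite (_ : (fun x => _) = (fun x => (a ^+ 2)%:E * (f x ^+ 2)%:E)%E); last first.
  by apply/funext => x; rewrite exprMn EFinM.
exact: integrableZl.
Qed.

Lemma sqintD f g : sqint f -> sqint g -> sqint (fun x => f x + g x).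
Proof.
move=> sf sg; split; first exact: measurable_funD sf.1 sg.1.
rewrite (_ : (fun x => _) = ((fun x => (f x ^+ 2)%:E) \+ (fun x => (g x ^+ 2)%:E) \+
   (fun x => 2%:E * (f x * g x)%:E))%E); last first.
  by apply/funext => x; rewrite /= -EFinM -!EFinD; congr EFin; ring.
apply: integrableD => //; first by apply: integrableD => //; [case: sf|case: sg].
by apply: integrableZl => //; exact: sqint_mul.
Qed.

Lemma sqintB f g : sqint f -> sqint g -> sqint (fun x => f x - g x).
Proof.
move=> sf /(sqintZ (-1)) sg; have := sqintD sf sg.
by under [X in _ -> sqint X]eq_fun do rewrite -mulN1r.
Qed.

Lemma innerC f g : inner f g = inner g f.
Proof. by apply: eq_Rintegral => x _; rewrite mulrC. Qed.

Lemma innerDl f g h : sqint f -> sqint g -> sqint h ->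
  inner (fun x => f x + g x) h = inner f h + inner g h.
Proof.
move=> sf sg sh; rewrite /inner -RintegralD//; try exact: sqint_mul.
by apply: eq_Rintegral => x _; rewrite mulrDl.
Qed.

Lemma innerZl a f g : sqint f -> sqint g ->
  inner (fun x => a * f x) g = a * inner f g.
Proof.
move=> sf sg; rewrite /inner -RintegralZl//; try exact: sqint_mul.
by apply: eq_Rintegral => x _; rewrite mulrA.
Qed.

Lemma innerBl f g h : sqint f -> sqint g -> sqint h ->
  inner (fun x => f x - g x) h = inner f h - inner g h.
Proof.
move=> sf sg sh; rewrite /inner -RintegralB//; try exact: sqint_mul.
by apply: eq_Rintegral => x _; rewrite mulrBl.
Qed.

Lemma innerDr f g h : sqint f -> sqint g -> sqint h ->
  inner h (fun x => f x + g x) = inner h f + inner h g.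
Proof. by move=> *; rewrite innerC innerDl// !(innerC h). Qed.

Lemma innerZr a f g : sqint f -> sqint g ->
  inner g (fun x => a * f x) = a * inner g f.
Proof. by move=> *; rewrite innerC innerZl// (innerC g). Qed.

Lemma innerBr f g h : sqint f -> sqint g -> sqint h ->
  inner h (fun x => f x - g x) = inner h f - inner h g.
Proof. by move=> *; rewrite innerC innerBl// !(innerC h). Qed.

Lemma norm2_ge0 f : 0 <= norm2 f. Proof. exact: sqrtr_ge0. Qed.

Lemma inner_ge0 f : 0 <= inner f f.
Proof. by apply: Rintegral_ge0 => x _; rewrite -expr2 sqr_ge0. Qed.

Lemma norm2_sqr f : norm2 f ^+ 2 = inner f f.
Proof.
rewrite sqr_sqrtr; first by apply: eq_Rintegral.
by apply: Rintegral_ge0 => x _; exact: sqr_ge0.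
Qed.

Lemma norm2E f : norm2 f = Num.sqrt (inner f f).
Proof. by rewrite -norm2_sqr sqrtr_sqr ger0_norm// norm2_ge0. Qed.

Lemma eq_norm2 f g : f =1 g -> norm2 f = norm2 g.
Proof. by move=> fg; congr Num.sqrt; apply: eq_Rintegral => x _; rewrite fg. Qed.

Lemma cauchy_schwarz f g : sqint f -> sqint g ->
  `|inner f g| <= norm2 f * norm2 g.
Proof.
move=> sf sg; rewrite -[leLHS]ger0_norm//.
rewrite -ler_sqr ?nnegrE ?mulr_ge0 ?norm2_ge0// ger0_norm//.
rewrite exprMn !norm2_sqr (real_normK (num_real _)).
have H t : 0 <= inner f f - 2 * t * inner f g + t ^+ 2 * inner g g.
  have := inner_ge0 (fun x => f x - t * g x).
  have stg := sqintZ t sg.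
  rewrite (innerBl sf stg (sqintB sf stg)) (innerBr sf stg sf).
  rewrite (innerBr sf stg stg) (innerZr t sg sf) (innerZl t sg sf).
  rewrite (innerZr t sg stg) (innerZl t sg sg) (innerC g f).
  by move=> h; apply: le_trans h _; lra.
have [g0|g0] := eqVneq (inner g g) 0.
  have [->|B0] := eqVneq (inner f g) 0; first by rewrite expr0n/= g0 mulr0.
  (* When [g] has norm zero the quadratic [H] is affine in [t]; this choice of [t] gives it the
     value -1. *)
  have := H ((inner f f + 1) / (2 * inner f g)).
  rewrite g0 mulr0 addr0 (_ : 2 * _ * _ = inner f f + 1); last by field.
  by lra.
have gp : 0 < inner g g by rewrite lt_neqAle eq_sym g0 inner_ge0.
have := H (inner f g / inner g g).
rewrite (_ : _ + _ = (inner f f * inner g g - inner f g ^+ 2) / inner g g); last by field.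
by rewrite pmulr_lge0 ?invr_gt0// subr_ge0.
Qed.

Lemma norm2D f g : sqint f -> sqint g ->
  norm2 (fun x => f x + g x) <= norm2 f + norm2 g.
Proof.
move=> sf sg.
rewrite -ler_sqr ?nnegrE ?addr_ge0 ?norm2_ge0// norm2_sqr sqrrD !norm2_sqr.
have sfg := sqintD sf sg.
rewrite (innerDl sf sg sfg) (innerDr sf sg sf) (innerDr sf sg sg) (innerC g f).
have := le_trans (ler_norm _) (cauchy_schwarz sf sg).
by lra.
Qed.

Lemma norm2Z a f : sqint f -> norm2 (fun x => a * f x) = `|a| * norm2 f.
Proof.
move=> sf; rewrite norm2E (innerZl a sf (sqintZ a sf)) (innerZr a sf sf).
by rewrite mulrA -expr2 sqrtrM ?sqr_ge0// sqrtr_sqr -norm2E.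
Qed.

Lemma norm2_triangle h f g : sqint f -> sqint g -> sqint h ->
  norm2 (fun x => f x - g x) <=
  norm2 (fun x => f x - h x) + norm2 (fun x => h x - g x).
Proof.
move=> sf sg sh; apply: le_trans (norm2D (sqintB sf sh) (sqintB sh sg)).
by rewrite (@eq_norm2 _ (fun x => f x - g x))// => x; ring.
Qed.

Lemma norm2_cst c : norm2 (fun=> c) = `|c|.
Proof.
rewrite /norm2 Rintegral_cst//.
rewrite [X in fine X](_ : _ = 1%E); last exact: probability_setT.
by rewrite mulr1 sqrtr_sqr. Qed.

Lemma mean_le_norm2 f : sqint f -> `|\int[P]_x f x| <= norm2 f.
Proof.
move=> sf; have := cauchy_schwarz sf (sqint_cst 1).
rewrite norm2_cst normr1 mulr1 /inner.
by under eq_Rintegral do rewrite mulr1.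
Qed.

End square_integrable.

(** * Truncation and bounded centered approximation *)

Section approximation.
Context d (T : measurableType d) (R : realType) (P : probability T R).
Implicit Types (f g h : T -> R).

Lemma Rdominated_cvg (F : nat -> T -> R) f g :
  (forall n, measurable_fun setT (F n)) -> measurable_fun setT f ->
  (forall x, F n x @[n --> \oo] --> f x) ->
  P.-integrable setT (EFin \o g) -> (forall n x, `|F n x| <= g x) ->
  \int[P]_x F n x @[n --> \oo] --> \int[P]_x f x.
Proof.
move=> mF mf Ff ig Fg.
have [|||||if_ _ C] := @dominated_convergence _ T R P setT measurableT
  (fun n => EFin \o F n) (EFin \o f) (EFin \o g).
- by move=> n; exact/measurable_EFinP.
- exact/measurable_EFinP.
- by apply: aeW => x _; apply: cvg_EFin (Ff x); exact: nearW.
- exact: ig.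
- by apply: aeW => x n _; exact: Fg.
have := C; rewrite -[X in _ --> X](@fineK _ (\int[P]_x (f x)%:E)%E).
  by move/fine_cvgP => [].
exact: integrable_fin_num.
Qed.

Definition truncate f (n : nat) x := Num.max (- n%:R) (Num.min n%:R (f x)).

Lemma measurable_truncate f n : measurable_fun setT f ->
  measurable_fun setT (truncate f n).
Proof. by move=> mf; apply: measurable_maxr => //; exact: measurable_minr. Qed.

Lemma truncate_le f n x : `|truncate f n x| <= n%:R.
Proof.
have n0 : 0 <= n%:R :> R by [].
by rewrite ler_norml /truncate le_max lexx ge_max ge_min lexx !andbT ge0_cp.
Qed.

Lemma truncate_dist f n x : `|f x - truncate f n x| <= `|f x|.
Proof.
have n0 : 0 <= n%:R :> R by [].
rewrite /truncate; case: (leP n%:R (f x)) => h.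
  rewrite max_r; last by lra.
  by rewrite !ger0_norm; lra.
case: (leP (- n%:R) (f x)) => h'; first by rewrite subrr normr0.
by rewrite !ler0_norm; lra.
Qed.

Lemma truncate_id f n x : `|f x| <= n%:R -> truncate f n x = f x.
Proof.
rewrite ler_norml => /andP[h1 h2].
by rewrite /truncate min_r// max_r.
Qed.

Lemma cvg_truncate f : sqint P f ->
  norm2 P (fun x => f x - truncate f n x) @[n --> \oo] --> 0.
Proof.
move=> [mf if2].
rewrite -[X in _ --> X]sqrtr0.
apply: continuous_cvg; first exact: sqrt_continuous.
rewrite [X in _ --> X](_ : 0 = \int[P]_x 0); last by rewrite Rintegral_cst// mul0r.
apply: (@Rdominated_cvg _ _ (fun x => f x ^+ 2)) => //.
- move=> n; apply: measurable_funX; apply: measurable_funB => //.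
  exact: measurable_truncate.
- move=> x; apply/cvgrPdist_le => e e0.
  exists (Num.truncn `|f x|).+1 => // n /= nx.
  rewrite truncate_id ?subrr ?expr0n/= ?subrr ?normr0 ?(ltW e0)//.
  rewrite ltW// (lt_le_trans (truncnS_gt _))// ler_nat//.
- move=> n x; rewrite normrX -(real_normK (num_real (f x))).
  by rewrite lerXn2r ?nnegrE// truncate_dist.
Qed.

(** Truncation makes the function bounded, and subtracting the mean restores centering. Since [f]
    has mean zero, the mean subtracted is at most the truncation error, so each of the two steps
    costs at most e / 2. *)
Lemma bounded_centered_approx f (e : R) : sqint P f -> \int[P]_x f x = 0 ->
  0 < e -> exists (b : T -> R) (M : R), [/\ measurable_fun setT b, forall x, `|b x| <= M,
    \int[P]_x b x = 0 & norm2 P (fun x => f x - b x) < e].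
Proof.
move=> sf f0 e0.
have /cvgrPdist_lt/(_ (e / 2)) := cvg_truncate sf.
rewrite divr_gt0// => /(_ isT)[n _ /(_ n (leqnn n))].
rewrite sub0r normrN ger0_norm ?norm2_ge0//.
set g := truncate f n; set m := \int[P]_x g x => ge.
have mg : measurable_fun setT g by apply: measurable_truncate; case: sf.
have sg : sqint P g by apply: (@sqint_bounded _ _ _ _ _ n%:R) => // x; exact: truncate_le.
have me : `|m| <= norm2 P (fun x => f x - g x).
  rewrite -normrN -[- m]add0r -f0 -RintegralB//; try exact: sqint_integrable.
  by apply: mean_le_norm2; exact: sqintB.
exists (fun x => g x - m), (n%:R + `|m|); split.
- exact: measurable_funB.
- by move=> x; rewrite (le_trans (ler_normB _ _))// lerD2r truncate_le.
- rewrite RintegralB//; try exact: sqint_integrable; last exact: (sqint_integrable (sqint_cst P m)).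
  rewrite Rintegral_cst//.
  rewrite [X in fine X](_ : _ = 1%E); last exact: probability_setT.
  by rewrite mulr1 subrr.
- apply: (@le_lt_trans _ _ (norm2 P (fun x => f x - g x) + norm2 P (fun=> m))).
    apply: le_trans (norm2D (sqintB sf sg) (sqint_cst P m)).
    by rewrite (@eq_norm2 _ _ _ _ _ (fun x => f x - g x + m))// => x; ring.
  by rewrite norm2_cst; lra.
Qed.

End approximation.

(** * Product densities and a Hellinger bound for tests *)

Section power_Rintegral.
Context d (T : measurableType d) (R : realType).
Implicit Types (P Q : probability T R) (u l r s : T -> R).

Lemma measurable_power_section P n (F : n.+1.-tuple T -> R) M :
  measurable_fun setT F -> (forall x, `|F x| <= M) ->
  measurable_fun setT
    (fun x => \int[power_probability P n]_xs F (tuple_cons (x, xs))).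
Proof.
move=> mF FM.
have mG : measurable_fun setT (F \o @tuple_cons _ T n).
  by apply: measurableT_comp => //; exact: measurable_tuple_cons.
apply: (measurableT_comp (@fine_measurable R setT measurableT)).
have iG : (P \x power_probability P n)%E.-integrable setT
    (EFin \o (F \o @tuple_cons _ T n)).
  by apply: (@bounded_integrable _ _ _ _ _ M) => // x; exact: FM.
exact: (measurable_fubini_F iG).
Qed.

Lemma Rintegral_powerS P n (F : n.+1.-tuple T -> R) M :
  measurable_fun setT F -> (forall x, `|F x| <= M) ->
  \int[power_probability P n.+1]_x F x =
  \int[P]_x \int[power_probability P n]_xs F (tuple_cons (x, xs)).
Proof.
move=> mF FM.
have mG : measurable_fun setT (F \o @tuple_cons _ T n).
  by apply: measurableT_comp => //; exact: measurable_tuple_cons.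
have iG : (P \x power_probability P n)%E.-integrable setT
    (EFin \o (F \o @tuple_cons _ T n)).
  by apply: (@bounded_integrable _ _ _ _ _ M) => // x; exact: FM.
rewrite /Rintegral /= integral_distribution//; last exact/measurable_EFinP.
rewrite -(integral12_prod_meas1 iG); congr fine.
apply: eq_integral => x _; rewrite /fubini_F/= fineK//.
apply: integrable_fin_num => //.
apply: (@bounded_integrable _ _ _ _ _ M) => //.
by apply: measurableT_comp => //; exact: measurable_tuple_cons_section.
Qed.

Lemma Rintegral_power0 P (F : 0.-tuple T -> R) : measurable_fun setT F ->
  \int[power_probability P 0]_x F x = F [tuple].
Proof.
by move=> mF; rewrite /Rintegral integral_power0//; exact/measurable_EFinP.
Qed.

Section product.
Variables (P : probability T R) (u : T -> R) (n : nat).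
Hypotheses (mu : measurable_fun setT u) (u0 : forall y, 0 <= u y)
  (iu : P.-integrable setT (EFin \o u)).

Let iuE : (\int[P]_x (u x)%:E = (\int[P]_x u x)%:E)%E.
Proof. by rewrite /Rintegral fineK//; exact: integrable_fin_num. Qed.

Lemma integrable_tuple_prod :
  (power_probability P n).-integrable setT (EFin \o @tuple_prod _ _ _ n u).
Proof.
apply/integrableP; split.
  by apply/measurable_EFinP; exact: measurable_tuple_prod.
under eq_integral do rewrite /= ger0_norm ?tuple_prod_ge0//.
by rewrite (integral_tuple_prod n mu u0 iuE) ltry.
Qed.

Lemma Rintegral_tuple_prod :
  \int[power_probability P n]_x tuple_prod u x = (\int[P]_x u x) ^+ n.
Proof. by rewrite {1}/Rintegral (integral_tuple_prod n mu u0 iuE). Qed.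

End product.

Lemma tuple_prodM n u l (x : n.-tuple T) :
  tuple_prod (fun y => u y * l y) x = tuple_prod u x * tuple_prod l x.
Proof. exact: big_split. Qed.

(* The integrand is bounded through
   |A^2 - B^2| <= (lam (A - B)^2 + (A + B)^2 / lam) / 2, where A and B are the
   square roots of the two product densities. *)
Lemma test_hellinger_bound P r s n (psi : n.-tuple T -> R) lam :
  sqint P r -> sqint P s -> (forall y, 0 <= r y) -> (forall y, 0 <= s y) ->
  measurable_fun setT psi -> (forall x, 0 <= psi x <= 1) -> 0 < lam ->
  \int[power_probability P n]_x
    (psi x * tuple_prod (fun y => r y * r y) x) <=
  \int[power_probability P n]_x
    (psi x * tuple_prod (fun y => s y * s y) x) +
  (lam * (inner P r r ^+ n + inner P s s ^+ n - 2 * inner P r s ^+ n) +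
   lam^-1 * (inner P r r ^+ n + inner P s s ^+ n + 2 * inner P r s ^+ n)) / 2.
Proof.
move=> sr ss r0 s0 mpsi psi01 lam0.
have [mr ms] := (sr.1, ss.1).
set PP := power_probability P n.
have H u v : sqint P u -> sqint P v -> (forall y, 0 <= u y) ->
    (forall y, 0 <= v y) ->
    [/\ measurable_fun setT (@tuple_prod _ _ _ n (fun y => u y * v y)),
        PP.-integrable setT (EFin \o @tuple_prod _ _ _ n (fun y => u y * v y)) &
      \int[PP]_x tuple_prod (fun y => u y * v y) x = inner P u v ^+ n].
  move=> su sv u0 v0.
  have muv : measurable_fun setT (fun y => u y * v y).
    exact: measurable_funM su.1 sv.1.
  have uv0 y : 0 <= u y * v y by rewrite mulr_ge0.
  split; first exact: measurable_tuple_prod.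
  - by apply: integrable_tuple_prod => //; exact: sqint_mul.
  - by rewrite Rintegral_tuple_prod//; exact: sqint_mul.
have [mrr irr <-] := H _ _ sr sr r0 r0.
have [mss iss <-] := H _ _ ss ss s0 s0.
have [mrs irs <-] := H _ _ sr ss r0 s0.
have ipsi (u : n.-tuple T -> R) : measurable_fun setT u -> (forall x, 0 <= u x) ->
    PP.-integrable setT (EFin \o u) ->
    PP.-integrable setT (EFin \o (fun x => psi x * u x)).
  move=> mu u0 iu; apply: (le_integrable _ _ _ iu) => //.
    by apply/measurable_EFinP; exact: measurable_funM.
  move=> x _ /=; rewrite lee_fin normrM ler_piMl//.
  by have /andP[p0 p1] := psi01 x; rewrite ger0_norm.
have rr0 (x : n.-tuple T) : 0 <= tuple_prod (fun y => r y * r y) x.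
  by apply: tuple_prod_ge0 => y; rewrite mulr_ge0.
have ss0 (x : n.-tuple T) : 0 <= tuple_prod (fun y => s y * s y) x.
  by apply: tuple_prod_ge0 => y; rewrite mulr_ge0.
have iprr := ipsi _ mrr rr0 irr.
have ipss := ipsi _ mss ss0 iss.
have iZ (c : R) (u : n.-tuple T -> R) : PP.-integrable setT (EFin \o u) ->
    PP.-integrable setT (EFin \o (fun x => c * u x)).
  by move=> iu; exact: (integrableZl measurableT c iu).
have iD (u v : n.-tuple T -> R) : PP.-integrable setT (EFin \o u) ->
    PP.-integrable setT (EFin \o v) ->
    PP.-integrable setT (EFin \o (fun x => u x + v x)).
  by move=> iu iv; exact: (integrableD measurableT iu iv).
pose A := fun x : n.-tuple T => tuple_prod (fun y => r y * r y) x.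
pose B := fun x : n.-tuple T => tuple_prod (fun y => s y * s y) x.
pose C := fun x : n.-tuple T => tuple_prod (fun y => r y * s y) x.
rewrite -/(A) -/B.
rewrite [leRHS](_ : _ = \int[PP]_x (psi x * B x + ((lam + lam^-1) / 2 * A x +
   ((lam + lam^-1) / 2 * B x + (lam^-1 - lam) * C x)))); last first.
  rewrite RintegralD//; [|exact: iD (iZ _ _ irr) (iD _ _ (iZ _ _ iss) (iZ _ _ irs))].
  rewrite RintegralD//; [|exact: iZ|exact: iD (iZ _ _ iss) (iZ _ _ irs)].
  rewrite RintegralD//; [|exact: iZ|exact: iZ].
  by rewrite !RintegralZl// /A /B /C; field; rewrite gt_eqF.
apply: le_Rintegral => //.
  exact: iD ipss (iD _ _ (iZ _ _ irr) (iD _ _ (iZ _ _ iss) (iZ _ _ irs))).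
move=> x _; rewrite /A /B /C !tuple_prodM.
have /andP[] := psi01 x.
set p := psi x; set U := tuple_prod r x; set V := tuple_prod s x => p0 p1.
have [U0 V0] : 0 <= U /\ 0 <= V by split; exact: tuple_prod_ge0.
have K : `|U ^+ 2 - V ^+ 2| <= (lam * (U - V) ^+ 2 + lam^-1 * (U + V) ^+ 2) / 2.
  rewrite subr_sqr normrM (ger0_norm (addr_ge0 U0 V0)).
  rewrite -[(U - V) ^+ 2]real_normK ?num_real//.
  move: `|U - V| (U + V) => a b.
  have : 0 <= lam * (a - lam^-1 * b) ^+ 2 by rewrite mulr_ge0 ?sqr_ge0// ltW.
  rewrite (_ : lam * _ = lam * a ^+ 2 + lam^-1 * b ^+ 2 - 2 * (a * b)).
    by move=> ab; rewrite ler_pdivlMr//; lra.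
  by field; rewrite gt_eqF.
have K2 : p * (U ^+ 2 - V ^+ 2) <= `|U ^+ 2 - V ^+ 2|.
  apply: le_trans (ler_norm _) _; by rewrite normrM ger0_norm// ler_piMl.
have := le_trans K2 K.
by lra.
Qed.

End power_Rintegral.

(** * A central limit theorem under exponential tilts *)

(** One-sided, because the time derivatives of [flow] below are available at nonnegative times
    only. *)
Lemma mean_value_bound_seg (R : realType) (f df : R -> R) (M y x : R) :
  y <= x -> (forall z, y <= z <= x -> is_derive z (1 : R) f (df z)) ->
  (forall z, y <= z <= x -> `|df z| <= M) ->
  `|f x - f y| <= M * (x - y).
Proof.
move=> yx fdf dfM.
have [||c cyx ->] := @MVT_segment _ f df y x yx.
- by move=> z zyx; apply: fdf; rewrite !ltW ?(itvP zyx).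
- apply: derivable_within_continuous => z zyx.
  by have [] := fdf z; rewrite ?(itvP zyx).
- by rewrite normrM (ger0_norm (_ : 0 <= x - y)) ?subr_ge0// ler_wpM2r
    ?subr_ge0// dfM// !(itvP cyx).
Qed.

(** * Gaussian heat flow and its Taylor bounds *)

Section flow.
Context {R : realType}.
Implicit Types q x y : R.

(** Derivatives of [Phi] are [phi] times a polynomial; up to cubic growth of the polynomial they are
    therefore bounded uniformly. *)
Lemma poly_phi_le (q a K : R) : `|a| <= K * (1 + `|q|) ^+ 3 ->
  `|phi q * a| <= 24 * K.
Proof.
move=> aK; rewrite normrM (ger0_norm (phi_ge0 q)).
have K0 : 0 <= K.
  rewrite -(@pmulr_lge0 _ ((1 + `|q|) ^+ 3)) ?exprn_gt0 ?ltr_pwDl//.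
  exact: le_trans aK.
rewrite (le_trans (ler_wpM2l (phi_ge0 q) aK))// mulrCA mulrC ler_wpM2r//.
by rewrite mulrC poly_mul_phi_le.
Qed.

Lemma Phi_taylor1 q x : `|Phi (q + x) - Phi q - phi q * x| <= 24 * x ^+ 2.
Proof.
pose f z := Phi (q + z) - phi q * z.
have df z : is_derive z (1 : R) f (phi (q + z) - phi q).
  have h := is_derive_Phi (q + z).
  by apply: is_derive_eq; rewrite ?mulr0 ?scaler0 ?add0r ?addr0 ?mulr1 -?[_ *: _]/(_ * _) ?mulr1 ?add0r.
have := @mean_value_bound _ f _ (24 * `|x|) x 0 df.
rewrite /f !subr0 addr0 mulr0 subr0 => H.
rewrite addrAC (le_trans (H _))//; last first.
  by rewrite -mulrA -expr2 real_normK ?num_real.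
move=> z; rewrite subr0 => zx.
have := @mean_value_bound _ phi (fun y => - (y * phi y)) 24 (q + z) q is_derive_phi.
rewrite addrAC subrr add0r => H2; apply: (le_trans (H2 _)).
  move=> y _; rewrite normrN mulrC; apply: le_trans (poly_phi_le (K := 1) _) _.
    rewrite mul1r; apply: (@le_trans _ _ (1 + `|y|)); first by rewrite lerDr.
    by rewrite ler_eXnr// lerDl.
  by rewrite mulr1.
by rewrite ler_wpM2l.
Qed.

(** The remainder and its first two derivatives vanish at [x = 0], and its third derivative, of the
    form phi(w) (w^2 - 1), is bounded by 24. Three uses of the mean value bound keep the constant
    24. *)
Lemma Phi_taylor2 q x :
  `|Phi (q + x) - Phi q - phi q * x + q * phi q * x ^+ 2 / 2| <= 24 * `|x| ^+ 3.
Proof.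
pose f z := Phi (q + z) - phi q * z + q * phi q * z ^+ 2 / 2.
pose f1 z := phi (q + z) - phi q + q * phi q * z.
have df z : is_derive z (1 : R) f (f1 z).
  have h := is_derive_Phi (q + z).
  apply: is_derive_eq; rewrite /f1.
  by rewrite ?scaler0 ?scaler1 ?addr0 ?add0r /GRing.scale/=; field.
pose f2 z := - ((q + z) * phi (q + z)) + q * phi q.
have df1 z : is_derive z (1 : R) f1 (f2 z).
  have h := is_derive_phi (q + z).
  apply: is_derive_eq; rewrite /f2.
  by rewrite ?scaler0 ?scaler1 ?addr0 ?add0r /GRing.scale/=; field.
have df2 z : is_derive z (1 : R) f2 (phi (q + z) * ((q + z) ^+ 2 - 1)).
  have h := is_derive_phi (q + z).
  apply: is_derive_eq.
  by rewrite ?scaler0 ?scaler1 ?addr0 ?add0r /GRing.scale/=; field.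
have B2 z : `|f2 z| <= 24 * `|z|.
  have := @mean_value_bound _ f2 _ 24 z 0 df2.
  rewrite subr0 {2}/f2 addr0 addNr subr0; apply => y _.
  rewrite -[24]mulr1; apply: poly_phi_le; rewrite mul1r.
  set w := q + y; have w0 := normr_ge0 w.
  rewrite (le_trans (ler_normB _ _))// normr1 normrX.
  rewrite -subr_ge0 (_ : _ - _ = `|w| * (`|w| ^+ 2 + 2 * `|w| + 3)); last by ring.
  by rewrite mulr_ge0// !addr_ge0// ?mulr_ge0// sqr_ge0.
have B1 z : `|f1 z| <= 24 * `|z| ^+ 2.
  have := @mean_value_bound _ f1 _ (24 * `|z|) z 0 df1.
  rewrite subr0 {2}/f1 addr0 mulr0 subrr addr0 subr0 expr2 mulrA; apply => y.
  by rewrite subr0 => yz; rewrite (le_trans (B2 y))// ler_wpM2l.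
have := @mean_value_bound _ f _ (24 * `|x| ^+ 2) x 0 df.
rewrite subr0 {1 2}/f addr0 mulr0 subr0 expr0n/= mulr0 mul0r addr0.
move=> H.
rewrite (_ : _ + _ = Phi (q + x) - phi q * x + q * phi q * x ^+ 2 / 2 - Phi q);
  last by ring.
rewrite (le_trans (H _))//; last by rewrite -mulrA -exprSr.
move=> y; rewrite subr0 => yx; rewrite (le_trans (B1 y))// ler_wpM2l//.
by rewrite lerXn2r// nnegrE.
Qed.

(* [flow tau y] is the probability that [y + m tau - c + N(0, s0 + s2 tau)]
   is positive; it solves the heat equation with drift. *)
Section heat_flow.
Variables (s0 s2 m c : R).
Hypotheses (s0_gt0 : 0 < s0) (s2_ge0 : 0 <= s2).
Implicit Types tau : R.

Definition flow_scale (tau : R) : R := (Num.sqrt (s0 + s2 * tau))^-1.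
Definition flow_arg tau y : R := (y + m * tau - c) * flow_scale tau.
Definition flow tau y : R := Phi (flow_arg tau y).

Local Notation rho := flow_scale.
Local Notation q := flow_arg.
Let r0 : R := (Num.sqrt s0)^-1.
Let drift tau y : R := m * rho tau - s2 / 2 * q tau y * rho tau ^+ 2.

Let S_gt0 tau : 0 <= tau -> 0 < s0 + s2 * tau.
Proof. by move=> t0; rewrite ltr_pwDl// mulr_ge0. Qed.

Let rho_ge0 tau : 0 <= rho tau.
Proof. by rewrite invr_ge0 sqrtr_ge0. Qed.

(** The scale is largest at time 0, so powers of [r0] bound all coefficients uniformly in time. *)
Let rho_le tau : 0 <= tau -> rho tau <= r0.
Proof.
move=> t0; rewrite lef_pV2 ?posrE ?sqrtr_gt0 ?S_gt0//.
by rewrite ler_wsqrtr// lerDl mulr_ge0.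
Qed.

Let is_derive_rho tau : 0 <= tau ->
  is_derive tau (1 : R) rho (- (s2 / 2 * rho tau ^+ 3)).
Proof.
move=> t0; have S0 := S_gt0 t0.
have dS : is_derive tau (1 : R) (fun z : R => s0 + s2 * z) s2.
  apply: is_derive_eq.
  by rewrite /GRing.scale/=; ring.
have dsq := @is_derive1_comp _ Num.sqrt (fun z : R => s0 + s2 * z) tau _ _
  (is_derive1_sqrt S0) dS.
have n0 : Num.sqrt (s0 + s2 * tau) != 0 by rewrite gt_eqF// sqrtr_gt0.
have dV := @is_deriveV _ (Num.sqrt \o (fun z : R => s0 + s2 * z)) tau _ 1 n0 dsq.
apply: (@is_derive_eq _ _ _ _ _ _ _ _ dV) => /=.
by rewrite /rho /GRing.scale/=; field.
Qed.

Let is_derive_q tau y : 0 <= tau ->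
  is_derive tau (1 : R) (q^~ y) (drift tau y).
Proof.
move=> t0; have dr := is_derive_rho t0.
apply: is_derive_eq; rewrite /drift /flow_arg.
by rewrite ?scaler0 ?scaler1 ?addr0 ?add0r ?subr0 /GRing.scale/=; field.
Qed.

Let flow_dtau tau y := phi (q tau y) * drift tau y.

Let is_derive_flow tau y : 0 <= tau ->
  is_derive tau (1 : R) (flow^~ y) (flow_dtau tau y).
Proof.
move=> t0; have dq := is_derive_q y t0.
exact: (@is_derive1_comp _ Phi (q^~ y) tau _ _ (is_derive_Phi _) dq).
Qed.

Let drift_dtau tau y := - (m * s2 / 2 * rho tau ^+ 3) -
  s2 / 2 * (drift tau y * rho tau ^+ 2 - s2 * q tau y * rho tau ^+ 4).

Let flow_dtau2 tau y := phi (q tau y) *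
  (drift_dtau tau y - q tau y * drift tau y ^+ 2).

Let is_derive_flow_dtau tau y : 0 <= tau ->
  is_derive tau (1 : R) (flow_dtau^~ y) (flow_dtau2 tau y).
Proof.
move=> t0; have dq := is_derive_q y t0; have dr := is_derive_rho t0.
have dphi : is_derive tau (1 : R) (fun z => phi (q z y))
    (- (q tau y * phi (q tau y)) * drift tau y).
  exact: (@is_derive1_comp _ phi (q^~ y) tau _ _ (is_derive_phi _) dq).
apply: is_derive_eq; rewrite /flow_dtau2 /drift_dtau.
by rewrite /drift /GRing.scale/=; field.
Qed.

Let B1 := `|m| * r0 + s2 / 2 * r0 ^+ 2.
Let B2 := `|m| * s2 / 2 * r0 ^+ 3 + s2 / 2 * (B1 * r0 ^+ 2 + s2 * r0 ^+ 4).

Let r0_ge0 : 0 <= r0. Proof. by rewrite invr_ge0 sqrtr_ge0. Qed.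
Let B1_ge0 : 0 <= B1.
Proof. by rewrite addr_ge0// ?mulr_ge0// ?divr_ge0// sqr_ge0. Qed.

Let rhoX_le n tau : 0 <= tau -> `|rho tau ^+ n| <= r0 ^+ n.
Proof.
move=> t0; rewrite ger0_norm ?exprn_ge0//.
by rewrite lerXn2r ?nnegrE// rho_le.
Qed.

Let drift_le tau y : 0 <= tau -> `|drift tau y| <= B1 * (1 + `|q tau y|).
Proof.
move=> t0; rewrite (le_trans (ler_normB _ _))// mulrDl mulrDr mulr1.
have s2h : `|s2 / 2| = s2 / 2 by rewrite ger0_norm// divr_ge0.
rewrite mulrDr mulr1 (normrM m) (normrM (s2 / 2 * _)) (normrM (s2 / 2)) s2h.
rewrite (ger0_norm (rho_ge0 _)).
apply: (@le_trans _ _ (`|m| * r0 + s2 / 2 * `|q tau y| * r0 ^+ 2)).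
  by rewrite lerD// ler_wpM2l// ?rho_le// ?rhoX_le// mulr_ge0// divr_ge0.
have : 0 <= `|m| * r0 * `|q tau y| by rewrite !mulr_ge0.
have : 0 <= s2 / 2 * r0 ^+ 2 by rewrite mulr_ge0 ?sqr_ge0// divr_ge0.
by lra.
Qed.

Let drift_dtau_le tau y : 0 <= tau ->
  `|drift_dtau tau y| <= B2 * (1 + `|q tau y|).
Proof.
move=> t0; have s20 : 0 <= s2 / 2 by rewrite divr_ge0.
rewrite (le_trans (ler_normB _ _))// normrN [leRHS]mulrDl; apply: lerD.
  rewrite normrM -[leLHS]mulr1 ler_pM ?mulr_ge0// ?lerDl//.
  rewrite ler_pM// ?rhoX_le//.
  by rewrite -mulrA normrM (ger0_norm s20) mulrA.
rewrite normrM (ger0_norm s20) -[leRHS]mulrA ler_wpM2l//.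
rewrite (le_trans (ler_normB _ _))// [leRHS]mulrDl; apply: lerD.
  by rewrite normrM mulrAC ler_pM// ?drift_le ?rhoX_le.
rewrite (normrM (s2 * _)) (normrM s2) (ger0_norm s2_ge0).
rewrite mulrAC ler_pM ?mulr_ge0//; last by rewrite lerDr.
by rewrite ler_wpM2l// rhoX_le.
Qed.

(** The drift and its time derivative grow at most linearly in the argument of [Phi], so the factor
    of [phi] here grows at most like a cube and is absorbed by the Gaussian decay. *)
Let flow_dtau2_le tau y : 0 <= tau ->
  `|flow_dtau2 tau y| <= 24 * (B2 + B1 ^+ 2).
Proof.
move=> t0; apply: poly_phi_le.
have := drift_le y t0; have := drift_dtau_le y t0.
set a := `|q tau y|; have a0 : 0 <= a by exact: normr_ge0.
move=> h2 h1; rewrite (le_trans (ler_normB _ _))// mulrDl; apply: lerD.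
  apply: (le_trans h2); rewrite ler_wpM2l//; last by rewrite ler_eXnr// lerDl.
  by have := le_trans (normr_ge0 _) h2; rewrite pmulr_lge0// ltr_pwDl.
rewrite normrM normrX -/a.
apply: (@le_trans _ _ ((1 + a) * (B1 * (1 + a)) ^+ 2)); last first.
  by rewrite exprMn mulrCA -exprS.
by rewrite ler_pM// ?sqr_ge0// ?lerDr// lerXn2r// nnegrE// mulr_ge0// addr_ge0.
Qed.

Definition flow_dy tau y := rho tau * phi (q tau y).
Definition flow_dyy tau y := - (rho tau ^+ 2 * (q tau y * phi (q tau y))).

Lemma flow_time_step : exists D, forall tau delta y, 0 <= tau -> 0 <= delta ->
  `|flow (tau + delta) y - flow tau y -
    delta * (m * flow_dy tau y + s2 / 2 * flow_dyy tau y)| <= D * delta ^+ 2.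
Proof.
exists (24 * (B2 + B1 ^+ 2)) => tau delta y t0 d0.
have td : tau <= tau + delta by rewrite lerDl.
pose k := flow_dtau tau y.
(* The heat equation with drift: the generator applied to the flow is its time derivative. *)
have kE : m * flow_dy tau y + s2 / 2 * flow_dyy tau y = k.
  by rewrite /k /flow_dtau /drift /flow_dy /flow_dyy; ring.
rewrite kE.
pose g z := flow z y - z * k.
have dg z : tau <= z <= tau + delta ->
    is_derive z (1 : R) g (flow_dtau z y - k).
  move=> /andP[tz _]; have df := is_derive_flow y (le_trans t0 tz).
  by apply: is_derive_eq; rewrite /GRing.scale/=; ring.
have := @mean_value_bound_seg R g _ (24 * (B2 + B1 ^+ 2) * delta) _ _ td dg.
have -> : tau + delta - tau = delta by ring.
rewrite /g => H.
rewrite (_ : _ - _ - _ = flow (tau + delta) y - (tau + delta) * k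
  - (flow tau y - tau * k)); last by ring.
rewrite [delta ^+ 2]expr2 [leRHS]mulrA; apply: H => z /andP[tz zt].
have dk w : tau <= w <= z -> is_derive w (1 : R) (flow_dtau^~ y) (flow_dtau2 w y).
  by move=> /andP[tw _]; apply: is_derive_flow_dtau; exact: le_trans tw.
apply: le_trans (mean_value_bound_seg (M := 24 * (B2 + B1 ^+ 2)) tz dk _) _.
  by move=> w /andP[tw _]; apply: flow_dtau2_le; exact: le_trans tw.
have D0 := le_trans (normr_ge0 _) (flow_dtau2_le y t0).
by rewrite ler_wpM2l//; lra.
Qed.

(** For |x| <= 1 the third-order remainder is used, for |x| > 1 only the quadratic one. The
    resulting minimum is integrable against any law with a finite second moment, so that no third
    moment is needed. *)
Lemma flow_space_step : exists D, [/\
  (forall tau y, 0 <= tau -> `|flow_dy tau y| <= D),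
  (forall tau y, 0 <= tau -> `|flow_dyy tau y| <= D) &
  (forall tau y x, 0 <= tau ->
     `|flow tau (y + x) - flow tau y - flow_dy tau y * x
       - flow_dyy tau y * x ^+ 2 / 2| <= D * (x ^+ 2 * Num.min `|x| 1))].
Proof.
(* The summands serve, in this order, the first derivative, the second derivative, the case |x| > 1
   and the case |x| <= 1. For |x| > 1, 36 is 24 from [Phi_taylor1] plus 12 from the second-order
   term that it does not contain. *)
pose D := 24 * r0 + 24 * r0 ^+ 2 + 36 * r0 ^+ 2 + 24 * r0 ^+ 3.
have r01 : 0 <= r0 by exact: r0_ge0.
have r02 : 0 <= r0 ^+ 2 by exact: sqr_ge0.
have r03 : 0 <= r0 ^+ 3 by exact: exprn_ge0.
have bphi w : phi w <= 24.
  apply: le_trans (poly_mul_phi_le w).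
  by rewrite ler_peMl ?phi_ge0// exprn_ege1// lerDl.
have bwphi w : `|w * phi w| <= 24.
  rewrite normrM (ger0_norm (phi_ge0 w)); apply: le_trans (poly_mul_phi_le w).
  rewrite ler_wpM2r ?phi_ge0//.
  by apply: (@le_trans _ _ (1 + `|w|)); rewrite ?lerDr// ler_eXnr// lerDl.
exists D; split.
- move=> tau y t0; rewrite ger0_norm ?mulr_ge0 ?phi_ge0//.
  apply: (@le_trans _ _ (r0 * 24)); first by rewrite ler_pM ?phi_ge0 ?rho_le ?bphi.
  by rewrite /D; lra.
- move=> tau y t0; rewrite normrN normrM.
  apply: (@le_trans _ _ (r0 ^+ 2 * 24)); first by rewrite ler_pM ?rhoX_le ?bwphi.
  by rewrite /D; lra.
- move=> tau y x t0; set w := q tau y; set r := rho tau.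
  have r_ge0 : 0 <= r := rho_ge0 tau.
  have -> : flow tau (y + x) = Phi (w + r * x).
    by rewrite /flow /w /flow_arg -/r; congr Phi; ring.
  rewrite -[flow tau y]/(Phi w) /flow_dy /flow_dyy -/w -/r.
  case: (leP `|x| 1) => x1.
  + have -> : x ^+ 2 * `|x| = `|x| ^+ 3 by rewrite (exprSr `|x| 2) (real_normK (num_real x)).
    have := Phi_taylor2 w (r * x).
    rewrite (_ : _ + _ = Phi (w + r * x) - Phi w - r * phi w * x -
      - (r ^+ 2 * (w * phi w)) * x ^+ 2 / 2); last by field.
    move=> /le_trans; apply.
    rewrite normrM exprMn mulrA (ger0_norm r_ge0) ler_wpM2r ?exprn_ge0//.
    apply: (@le_trans _ _ (24 * r0 ^+ 3)).
      by rewrite ler_wpM2l// lerXn2r ?nnegrE// rho_le.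
    by rewrite /D; lra.
  + have := Phi_taylor1 w (r * x) => h1; rewrite mulr1.
    have x20 : 0 <= x ^+ 2 by exact: sqr_ge0.
    have rr : r ^+ 2 <= r0 ^+ 2 by rewrite lerXn2r ?nnegrE// rho_le.
    apply: (@le_trans _ _ (24 * (r * x) ^+ 2 + 24 * (r ^+ 2 * x ^+ 2) / 2)).
      rewrite (_ : _ - _ - _ - _ = (Phi (w + r * x) - Phi w - phi w * (r * x)) +
        (w * phi w) * (r ^+ 2 * x ^+ 2 / 2)); last by field.
      rewrite (le_trans (ler_normD _ _))// lerD// normrM.
      rewrite (ger0_norm (_ : 0 <= r ^+ 2 * x ^+ 2 / 2)); last first.
        by rewrite divr_ge0// mulr_ge0// sqr_ge0.
      rewrite -[leRHS]mulrA ler_wpM2r ?bwphi//.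
      by rewrite divr_ge0// mulr_ge0// sqr_ge0.
    rewrite exprMn (_ : _ + _ = 36 * r ^+ 2 * x ^+ 2); last by field.
    by rewrite ler_wpM2r// /D; lra.
Qed.

Lemma flow_ge0 tau y : 0 <= flow tau y. Proof. exact: Phi_ge0. Qed.
Lemma flow_le1 tau y : flow tau y <= 1. Proof. exact: Phi_le1. Qed.

Lemma continuous_flow tau : continuous (flow tau).
Proof.
move=> y.
have dq : is_derive y (1 : R) (q tau) (rho tau).
  by apply: is_derive_eq; rewrite /GRing.scale/=; ring.
have cq : {for y, continuous (q tau)}.
  by apply/differentiable_continuous/derivable1_diffP; have [] := dq.
exact: (continuous_comp cq (@continuous_Phi R _)).
Qed.

End heat_flow.
End flow.

Section exp_taylor.
Context {R : realType}.
Implicit Types u x : R.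

Lemma expR_taylor0 u : `|expR u - 1| <= `|u| * expR `|u|.
Proof.
have := @mean_value_bound _ expR expR (expR `|u|) u 0 (fun z => is_derive_expR z).
rewrite expR0 subr0 mulrC; apply => z; rewrite subr0 => zu.
by rewrite ger0_norm ?expR_ge0// ler_expR (le_trans (ler_norm _)).
Qed.

Lemma expR_taylor1 u : `|expR u - 1 - u| <= `|u| ^+ 2 * expR `|u|.
Proof.
have df z : is_derive z (1 : R) (fun z => expR z - z) (expR z - 1).
  by apply: is_derive_eq; rewrite /GRing.scale/=; ring.
have := @mean_value_bound _ _ _ (`|u| * expR `|u|) u 0 df.
rewrite expR0 !subr0 addrAC => K.
rewrite (le_trans (K _))//; last by rewrite mulrAC -expr2.
move=> z; rewrite subr0 => zu.
by rewrite (le_trans (expR_taylor0 z))// ler_pM ?expR_ge0// ler_expR.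
Qed.

Lemma expR_taylor2 u :
  `|expR u - 1 - u - u ^+ 2 / 2| <= `|u| ^+ 3 * expR `|u|.
Proof.
have df z : is_derive z (1 : R) (fun z => expR z - z - z ^+ 2 / 2)
    (expR z - 1 - z).
  by apply: is_derive_eq; rewrite /GRing.scale/=; field.
have := @mean_value_bound _ _ _ (`|u| ^+ 2 * expR `|u|) u 0 df.
rewrite expR0 !subr0 expr0n/= mul0r subr0 => K.
rewrite (_ : _ - _ - _ - _ = expR u - u - u ^+ 2 / 2 - 1); last by ring.
rewrite (le_trans (K _))//; last by rewrite mulrAC -exprSr.
move=> z; rewrite subr0 => zu.
rewrite (le_trans (expR_taylor1 z))// ler_pM ?exprn_ge0 ?expR_ge0 ?ler_expR//.
by rewrite lerXn2r// nnegrE.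
Qed.

End exp_taylor.

(** * Exponential tilts by bounded centered functions *)

Section tilt.
Context d (T : measurableType d) (R : realType) (P : probability T R).
Implicit Types (h : T -> R) (t : R).

(* The product of n copies of [tilt h n^(-1/2)] is
   exp(n^(-1/2) sum_i h(x_i) - ||h||^2 / 2). *)
Definition tilt h t x : R := expR (t * h x - t ^+ 2 * (inner P h h / 2)).

Lemma measurable_tilt h t : measurable_fun setT h ->
  measurable_fun setT (tilt h t).
Proof.
move=> mh; apply: measurableT_comp => //.
by apply: measurable_funB => //; exact: measurable_funM.
Qed.

Lemma tilt_ge0 h t x : 0 <= tilt h t x. Proof. exact: expR_ge0. Qed.

Variables (h : T -> R) (H : R).
Hypotheses (mh : measurable_fun setT h) (hH : forall x, `|h x| <= H)
  (h0 : \int[P]_x h x = 0).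

Let kap := inner P h h / 2.
Let kap_ge0 : 0 <= kap. Proof. by rewrite divr_ge0// inner_ge0. Qed.
Let H_ge0 : 0 <= H.
Proof. by rewrite (le_trans _ (hH point)). Qed.

Let sqint_h : sqint P h. Proof. exact: (@sqint_bounded _ _ _ _ _ H). Qed.

(** The second-order Taylor polynomial of the tilt is 1 + t h + t^2 (h^2 - ||h||^2) / 2. Its mean is
    exactly 1 because [h] is centered and the exponent subtracts t^2 ||h||^2 / 2. The mass of the
    tilt is therefore off by t^3 only, which survives the n-th power when t = n^(-1/2). *)
Lemma tilt_bounds : exists C, [/\ 0 <= C,
  (forall t x, 0 <= t <= 1 -> `|tilt h t x - 1| <= C * t),
  (forall t x, 0 <= t <= 1 -> `|tilt h t x - 1 - t * h x| <= C * t ^+ 2) &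
  (forall t, 0 <= t <= 1 -> `|\int[P]_x tilt h t x - 1| <= C * t ^+ 3)].
Proof.
pose B := H + kap; pose E := expR B.
have B0 : 0 <= B by rewrite addr_ge0.
have E0 : 0 <= E by exact: expR_ge0.
have uB t x : 0 <= t <= 1 -> `|t * h x - t ^+ 2 * kap| <= t * B.
  move=> /andP[t0 t1]; rewrite (le_trans (ler_normB _ _))// mulrDr lerD//.
    by rewrite normrM (ger0_norm t0) ler_wpM2l.
  rewrite normrM !ger0_norm ?sqr_ge0// ler_wpM2r//.
  by rewrite expr2 ler_piMl.
have uE t x : 0 <= t <= 1 -> expR `|t * h x - t ^+ 2 * kap| <= E.
  move=> t01; rewrite ler_expR (le_trans (uB _ _ t01))//.
  by case/andP: t01 => t0 t1; rewrite ler_piMl.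
pose C1 := B * E; pose C2 := B ^+ 2 * E + kap.
pose C3 := B ^+ 3 * E + H * kap + kap ^+ 2 / 2.
have C1_ge0 : 0 <= C1 by rewrite mulr_ge0.
have C2_ge0 : 0 <= C2 by rewrite addr_ge0// mulr_ge0// sqr_ge0.
have C3_ge0 : 0 <= C3.
  by rewrite !addr_ge0// mulr_ge0// ?exprn_ge0// invr_ge0.
have b3 t x : 0 <= t <= 1 ->
    `|tilt h t x - (1 + t * h x + t ^+ 2 * (h x ^+ 2 / 2 - kap))| <= C3 * t ^+ 3.
  move=> t01; have /andP[t0 t1] := t01.
  set u := t * h x - t ^+ 2 * kap.
  rewrite (_ : _ - _ = (expR u - 1 - u - u ^+ 2 / 2) +
     (- (t ^+ 3 * (h x * kap)) + t ^+ 3 * (t * (kap ^+ 2 / 2)))); last first.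
    by rewrite /tilt -/kap -/u {3 4}/u; field.
  have -> : C3 = B ^+ 3 * E + (H * kap + kap ^+ 2 / 2) by rewrite /C3 addrA.
  rewrite (le_trans (ler_normD _ _))// [leRHS]mulrDl lerD//.
    rewrite (le_trans (expR_taylor2 _))//.
    rewrite [leRHS]mulrAC -exprMn ler_pM ?exprn_ge0 ?expR_ge0 ?uE//.
    by rewrite lerXn2r ?nnegrE ?mulr_ge0// [B * t]mulrC uB.
  have t30 : 0 <= t ^+ 3 by rewrite exprn_ge0.
  rewrite (le_trans (ler_normD _ _))// [leRHS]mulrDl lerD//.
    rewrite normrN normrM (ger0_norm t30) mulrC ler_wpM2r//.
    by rewrite normrM (ger0_norm kap_ge0) ler_wpM2r.
  rewrite ger0_norm; last by rewrite mulr_ge0// mulr_ge0// divr_ge0// sqr_ge0.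
  by rewrite mulrC ler_wpM2r// ler_piMl// divr_ge0// sqr_ge0.
exists (C1 + C2 + C3); split.
- by apply: addr_ge0 => //; exact: addr_ge0.
- move=> t x t01; have /andP[t0 t1] := t01.
  rewrite (le_trans (expR_taylor0 _))//.
  apply: (@le_trans _ _ (C1 * t)); last first.
    by rewrite ler_wpM2r// -addrA lerDl addr_ge0.
  by rewrite /C1 [leRHS]mulrAC ler_pM ?expR_ge0 ?uE// [B * t]mulrC uB.
- move=> t x t01; have /andP[t0 t1] := t01.
  have t20 : 0 <= t ^+ 2 by rewrite exprn_ge0.
  apply: (@le_trans _ _ (C2 * t ^+ 2)); last first.
    by rewrite ler_wpM2r// addrAC lerDr addr_ge0.
  set u := t * h x - t ^+ 2 * kap.
  rewrite (_ : _ - _ = (expR u - 1 - u) - t ^+ 2 * kap); last first.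
    by rewrite /tilt -/kap -/u {3}/u; ring.
  rewrite (le_trans (ler_normB _ _))// /C2 mulrDl lerD//; last first.
    by rewrite ger0_norm 1?mulrC// mulr_ge0.
  rewrite (le_trans (expR_taylor1 _))// [leRHS]mulrAC -exprMn.
  rewrite ler_pM ?exprn_ge0 ?expR_ge0 ?uE//.
  by rewrite lerXn2r ?nnegrE ?mulr_ge0// [B * t]mulrC uB.
- move=> t t01; have /andP[t0 t1] := t01.
  have t30 : 0 <= t ^+ 3 by rewrite exprn_ge0.
  apply: (@le_trans _ _ (C3 * t ^+ 3)); last first.
    by rewrite ler_wpM2r// lerDr addr_ge0.
  pose g x := 1 + t * h x + t ^+ 2 * (h x ^+ 2 / 2 - kap).
  have mg : measurable_fun setT g.
    apply: measurable_funD; first by apply: measurable_funD => //; exact: measurable_funM.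
    apply: measurable_funM => //; apply: measurable_funB => //.
    by apply: measurable_funM => //; exact: measurable_funX.
  have sg : sqint P g.
    apply: (@sqint_bounded _ _ _ _ _ (1 + t * H + t ^+ 2 * (H ^+ 2 / 2 + kap))) => // x.
    rewrite (le_trans (ler_normD _ _))// lerD//.
      by rewrite (le_trans (ler_normD _ _))// normr1 lerD2l normrM ger0_norm// ler_wpM2l.
    rewrite normrM ger0_norm ?exprn_ge0// ler_wpM2l ?exprn_ge0//.
    rewrite (le_trans (ler_normB _ _))// (ger0_norm kap_ge0) lerD2r.
    rewrite ger0_norm ?divr_ge0 ?sqr_ge0// ler_wpM2r//.
    by rewrite -real_normK ?num_real// lerXn2r// nnegrE.
  have g1 : \int[P]_x g x = 1.
    have ih := sqint_integrable sqint_h.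
    have ihh := sqint_mul sqint_h sqint_h.
    transitivity (\int[P]_x ((1 - t ^+ 2 * kap) + (t * h x + t ^+ 2 / 2 * (h x * h x)))).
      by apply: eq_Rintegral => x _; rewrite /g; field.
    have iZ := integrableZl measurableT t ih.
    have iZ2 := integrableZl measurableT (t ^+ 2 / 2) ihh.
    rewrite RintegralD//; last 2 first.
    + exact: (sqint_integrable (sqint_cst P _)).
    + exact: (integrableD measurableT iZ iZ2).
    rewrite Rintegral_cst// RintegralD// !RintegralZl// h0 -/(inner P h h).
    rewrite [X in fine X](_ : _ = 1%E); last exact: probability_setT.
    by rewrite /kap /=; field.
  rewrite -g1 -RintegralB//; last 2 first.
  + apply: sqint_integrable; apply: (@sqint_bounded _ _ _ _ _ E).
      exact: measurable_tilt.
    move=> x; rewrite ger0_norm ?tilt_ge0//; apply: le_trans (uE t x t01).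
    by rewrite ler_expR ler_norm.
  + exact: sqint_integrable.
  have sd : sqint P (fun x => tilt h t x - g x).
    apply: sqintB => //; apply: (@sqint_bounded _ _ _ _ _ E).
      exact: measurable_tilt.
    move=> x; rewrite ger0_norm ?tilt_ge0//; apply: le_trans (uE t x t01).
    by rewrite ler_expR ler_norm.
  rewrite (le_trans (le_normr_Rintegral _ (sqint_integrable sd)))//.
  apply: (@le_trans _ _ (\int[P]_x (C3 * t ^+ 3))).
    apply: le_Rintegral => //.
    + exact: (integrable_norm (sqint_integrable sd)).
    + exact: (sqint_integrable (sqint_cst P _)).
    by move=> x _; exact: b3.
  rewrite Rintegral_cst//.
  rewrite [X in fine X](_ : _ = 1%E); last exact: probability_setT.
  by rewrite mulr1.
Qed.

End tilt.

Section one_step.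
Context d (T : measurableType d) (R : realType) (P : probability T R).
Variables (f h : T -> R) (H : R).
Hypotheses (sf : sqint P f) (f0 : \int[P]_x f x = 0)
  (mh : measurable_fun setT h) (hH : forall x, `|h x| <= H)
  (h0 : \int[P]_x h x = 0).
Variables (s0 c : R).
Hypothesis s0_gt0 : 0 < s0.

Let s2 := inner P f f.
Let m := inner P f h.
Local Notation V := (flow s0 s2 m c).
Local Notation l := (tilt P h).

(** A smooth form of the quantity in Lindeberg's condition, with the same minimum as in the
    remainder of [flow_space_step]. *)
Definition lindeberg t := \int[P]_x (f x ^+ 2 * Num.min (t * `|f x|) 1).

Let mf : measurable_fun setT f. Proof. by case: sf. Qed.
Let sh : sqint P h. Proof. exact: (@sqint_bounded _ _ _ _ _ H). Qed.

Let lind_le t x : 0 <= t ->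
  0 <= f x ^+ 2 * Num.min (t * `|f x|) 1 <= f x ^+ 2.
Proof.
move=> t0; rewrite mulr_ge0 ?sqr_ge0 ?le_min ?mulr_ge0//=.
by rewrite ler_piMr ?sqr_ge0// ge_min lexx orbT.
Qed.

Let measurable_lind t :
  measurable_fun setT (fun x => f x ^+ 2 * Num.min (t * `|f x|) 1).
Proof.
apply: measurable_funM; first exact: measurable_funX.
apply: measurable_minr => //; apply: measurable_funM => //.
exact: measurableT_comp.
Qed.

Let integrable_lind t : 0 <= t ->
  P.-integrable setT (EFin \o (fun x => f x ^+ 2 * Num.min (t * `|f x|) 1)).
Proof.
move=> t0; apply: (le_integrable _ _ _ sf.2) => //.
  exact/measurable_EFinP.
move=> x _ /=; rewrite lee_fin; have /andP[a b] := lind_le x t0.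
by rewrite (ger0_norm a) (ger0_norm (sqr_ge0 _)).
Qed.

Lemma lindeberg_ge0 t : 0 <= t -> 0 <= lindeberg t.
Proof.
by move=> t0; apply: Rintegral_ge0 => x _; have /andP[] := lind_le x t0.
Qed.

Lemma cvg_lindeberg (t : nat -> R) : (forall n, 0 <= t n) ->
  t n @[n --> \oo] --> 0 -> lindeberg (t n) @[n --> \oo] --> 0.
Proof.
move=> t_ge0 t0.
rewrite [X in _ --> X](_ : 0 = \int[P]_x 0); last by rewrite Rintegral_cst// mul0r.
apply: (@Rdominated_cvg _ _ _ _ _ _ (fun x => f x ^+ 2)) => //.
- move=> x; pose b := f x ^+ 2 * `|f x|.
  apply: (@squeeze_cvgr _ _ _ _ (fun=> 0) (fun n => t n * b)).
  + apply: nearW => n; have /andP[-> _] /= := lind_le x (t_ge0 n).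
    by rewrite mulrCA ler_wpM2l ?sqr_ge0// ge_min lexx.
  + exact: cvg_cst.
  + by rewrite -[X in _ --> X](mul0r b); apply: cvgM => //; exact: cvg_cst.
- exact: sf.2.
- move=> n x; have /andP[a b] := lind_le x (t_ge0 n).
  by rewrite ger0_norm.
Qed.

(** Under the tilt, t f has first moment t^2 m and second moment t^2 s2 up to smaller terms. The
    expansion in space thus yields t^2 times the generator of the flow, which is what the flow gains
    in time t^2. *)
Lemma tilted_one_step : exists K, [/\ 0 <= K & forall t tau y,
  0 <= t <= 1 -> 0 <= tau ->
  `|\int[P]_x (l t x * V tau (y + t * f x)) - V (tau + t ^+ 2) y| <=
  K * (t ^+ 3 + t ^+ 2 * lindeberg t)].
Proof.
have [C [C0 b1 b2 b3]] := tilt_bounds mh hH h0.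
have s2_ge0 : 0 <= s2 by exact: inner_ge0.
have [D1 [dyD dyyD taylorD]] := flow_space_step m c s0_gt0 s2_ge0.
have [D2 timeD] := flow_time_step m c s0_gt0 s2_ge0.
have D1_ge0 : 0 <= D1 := le_trans (normr_ge0 _) (dyD 0 0 (lexx 0)).
have D2_ge0 : 0 <= D2.
  have := le_trans (normr_ge0 _) (timeD 0 1 0 (lexx 0) ler01).
  by rewrite expr1n mulr1.
pose K0 := D1 * (1 + C) + D1 * C + D1 * C.
have K0_ge0 : 0 <= K0 by rewrite !addr_ge0// mulr_ge0// addr_ge0.
pose F1 := \int[P]_x `|f x|.
have F1_ge0 : 0 <= F1 by exact: Rintegral_ge0.
exists (K0 * (F1 + s2 + 1) + C + D2); split.
  by rewrite !addr_ge0// mulr_ge0// !addr_ge0.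
move=> t tau y t01 tau0; have /andP[t0 t1] := t01.
set v := V tau y; set a := flow_dy s0 s2 m c tau y.
set b := flow_dyy s0 s2 m c tau y.
have t20 : 0 <= t ^+ 2 by exact: exprn_ge0.
have t30 : 0 <= t ^+ 3 by exact: exprn_ge0.
have t43 : t ^+ 4 <= t ^+ 3 by rewrite [leLHS]exprS ler_piMl.
have l_ge0 x : 0 <= l t x by exact: tilt_ge0.
have l_le x : l t x <= 1 + C.
  have := b1 t x t01; rewrite ler_norml => /andP[_].
  have : C * t <= C by rewrite ler_piMr.
  by move=> h1 h2; lra.
have ml : measurable_fun setT (l t) by exact: measurable_tilt.
have mV : measurable_fun setT (fun x => V tau (y + t * f x)).
  apply: measurableT_comp.
    by apply: continuous_measurable_fun; exact: continuous_flow.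
  by apply: measurable_funD => //; exact: measurable_funM.
have sl : sqint P (l t).
  by apply: (@sqint_bounded _ _ _ _ _ (1 + C)) => // x; rewrite ger0_norm.
have slV : sqint P (fun x => l t x * V tau (y + t * f x)).
  apply: (@sqint_bounded _ _ _ _ _ (1 + C)); first exact: measurable_funM.
  move=> x; rewrite ger0_norm ?mulr_ge0 ?flow_ge0//.
  by rewrite -[leRHS]mulr1 ler_pM ?flow_ge0 ?flow_le1.
have iZ k (g : T -> R) : P.-integrable setT (EFin \o g) ->
    P.-integrable setT (EFin \o (fun x => k * g x)).
  by move=> ig; exact: (integrableZl measurableT k ig).
have iD (g1 g2 : T -> R) : P.-integrable setT (EFin \o g1) ->
    P.-integrable setT (EFin \o g2) ->
    P.-integrable setT (EFin \o (fun x => g1 x + g2 x)).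
  by move=> i1 i2; exact: (integrableD measurableT i1 i2).
have iB (g1 g2 : T -> R) : P.-integrable setT (EFin \o g1) ->
    P.-integrable setT (EFin \o g2) ->
    P.-integrable setT (EFin \o (fun x => g1 x - g2 x)).
  by move=> i1 i2; exact: (integrableB measurableT i1 i2).
have i_lV := sqint_integrable slV.
have i_l := sqint_integrable sl.
have i_f := sqint_integrable sf.
have i_fh := sqint_mul sf sh.
have i_ff := sqint_mul sf sf.
pose X x := l t x * V tau (y + t * f x) - (v * l t x +
  ((a * t) * f x + ((a * t ^+ 2) * (f x * h x) + (b * t ^+ 2 / 2) * (f x * f x)))).
have iX : P.-integrable setT (EFin \o X).
  apply: (iB _ _ i_lV); apply: (iD _ _ (iZ _ _ i_l)).
  by apply: (iD _ _ (iZ _ _ i_f)); exact: (iD _ _ (iZ _ _ i_fh) (iZ _ _ i_ff)).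
have XE : \int[P]_x X x = \int[P]_x (l t x * V tau (y + t * f x)) -
    (v * \int[P]_x l t x + (a * t ^+ 2 * m + b * t ^+ 2 / 2 * s2)).
  rewrite /X RintegralB//; last first.
    apply: (iD _ _ (iZ _ _ i_l)).
    by apply: (iD _ _ (iZ _ _ i_f)); exact: (iD _ _ (iZ _ _ i_fh) (iZ _ _ i_ff)).
  rewrite (RintegralD _ (iZ v _ i_l)) //; last first.
    by apply: (iD _ _ (iZ _ _ i_f)); exact: (iD _ _ (iZ _ _ i_fh) (iZ _ _ i_ff)).
  rewrite (RintegralD _ (iZ (a * t) _ i_f)) //; last first.
    exact: (iD _ _ (iZ _ _ i_fh) (iZ _ _ i_ff)).
  rewrite (RintegralD _ (iZ (a * t ^+ 2) _ i_fh) (iZ (b * t ^+ 2 / 2) _ i_ff)) //.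
  rewrite (RintegralZl v) // (RintegralZl (a * t)) // (RintegralZl (a * t ^+ 2)) //.
  by rewrite (RintegralZl (b * t ^+ 2 / 2)) // f0 mulr0 add0r.
pose G x := K0 * (t ^+ 3 * `|f x| + (t ^+ 3 * (f x * f x) +
  t ^+ 2 * (f x ^+ 2 * Num.min (t * `|f x|) 1))).
have i_nf : P.-integrable setT (EFin \o (fun x => `|f x|)).
  exact: (integrable_norm i_f).
have i_lind := integrable_lind t0.
have iG : P.-integrable setT (EFin \o G).
  by apply/iZ/(iD _ _ (iZ _ _ i_nf)); exact: (iD _ _ (iZ _ _ i_ff) (iZ _ _ i_lind)).
have GE : \int[P]_x G x = K0 * (t ^+ 3 * F1 + (t ^+ 3 * s2 + t ^+ 2 * lindeberg t)).
  rewrite RintegralZl//; last first.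
    by apply: (iD _ _ (iZ _ _ i_nf)); exact: (iD _ _ (iZ _ _ i_ff) (iZ _ _ i_lind)).
  rewrite (RintegralD _ (iZ (t ^+ 3) _ i_nf)) //; last first.
    exact: (iD _ _ (iZ _ _ i_ff) (iZ _ _ i_lind)).
  rewrite (RintegralD _ (iZ (t ^+ 3) _ i_ff) (iZ (t ^+ 2) _ i_lind)) //.
  by rewrite (RintegralZl (t ^+ 3)) // (RintegralZl (t ^+ 3)) // (RintegralZl (t ^+ 2)).
have XG x : `|X x| <= G x.
  have := taylorD tau y (t * f x) tau0; rewrite -/v -/a -/b.
  set r := V tau (y + t * f x) - v - a * (t * f x) - b * (t * f x) ^+ 2 / 2.
  rewrite normrM (ger0_norm t0) exprMn -mulrA => hr.
  (* Three errors: the Taylor remainder of the flow, the replacement of the tilt by 1 + t h in the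
     linear term, and its replacement by 1 in the quadratic term. *)
  rewrite (_ : X x = l t x * r + (a * t * f x * (l t x - 1 - t * h x) +
     b * t ^+ 2 / 2 * (f x * f x) * (l t x - 1))); last by rewrite /X /r; field.
  set p := t ^+ 2 * _ in hr.
  have p0 : 0 <= p by rewrite mulr_ge0//; have /andP[] := lind_le x t0.
  have q0 : 0 <= t ^+ 3 * (f x * f x) by rewrite mulr_ge0// -expr2 sqr_ge0.
  have w0 : 0 <= t ^+ 3 * `|f x| by rewrite mulr_ge0.
  have e1 : `|l t x * r| <= (1 + C) * (D1 * p).
    by rewrite normrM (ger0_norm (l_ge0 x)) ler_pM.
  have e2 : `|a * t * f x * (l t x - 1 - t * h x)| <= D1 * C * (t ^+ 3 * `|f x|).
    apply: (@le_trans _ _ (D1 * t * `|f x| * (C * t ^+ 2))).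
      rewrite normrM ler_pM//; last exact: b2.
      rewrite (normrM (a * t)) (normrM a) (ger0_norm t0) ler_wpM2r//.
      by rewrite ler_wpM2r// dyD.
    by rewrite le_eqVlt; apply/orP; left; apply/eqP; ring.
  have e3 : `|b * t ^+ 2 / 2 * (f x * f x) * (l t x - 1)| <= D1 * C * (t ^+ 3 * (f x * f x)).
    apply: (@le_trans _ _ (D1 * t ^+ 2 * (f x * f x) * (C * t))).
      rewrite normrM ler_pM//; last exact: b1.
      rewrite normrM -expr2 (ger0_norm (sqr_ge0 (f x))) ler_wpM2r ?sqr_ge0//.
      rewrite -mulrA normrM ler_pM// ?dyyD// ger0_norm ?divr_ge0//; lra.
    by rewrite le_eqVlt; apply/orP; left; apply/eqP; ring.
  rewrite (le_trans (ler_normD _ _))//.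
  have := ler_normD (a * t * f x * (l t x - 1 - t * h x))
    (b * t ^+ 2 / 2 * (f x * f x) * (l t x - 1)).
  rewrite /G -/p /K0.
  have DC0 : 0 <= D1 * C by rewrite mulr_ge0.
  have := mulr_ge0 DC0 p0; have := mulr_ge0 DC0 q0; have := mulr_ge0 DC0 w0.
  have := mulr_ge0 D1_ge0 p0; have := mulr_ge0 D1_ge0 q0; have := mulr_ge0 D1_ge0 w0.
  move: (`|a * t * f x * (l t x - 1 - t * h x) + _|) e1 e2 e3 => Y.
  by lra.
have := le_trans (le_normr_Rintegral measurableT iX)
  (le_Rintegral measurableT (integrable_norm iX) iG (fun x _ => XG x)).
rewrite XE GE.
set I := \int[P]_x _; set L := \int[P]_x _ => hI.
have hL : `|v * (L - 1)| <= C * t ^+ 3.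
  rewrite normrM ger0_norm ?flow_ge0// -[leRHS]mul1r.
  by rewrite ler_pM ?flow_ge0 ?flow_le1 ?b3.
have hT := timeD tau (t ^+ 2) y tau0 t20.
rewrite -/v -/a -/b -exprM in hT.
have Lin0 := mulr_ge0 t20 (lindeberg_ge0 t0).
rewrite (_ : I - _ = (I - (v * L + (a * t ^+ 2 * m + b * t ^+ 2 / 2 * s2))) +
  (v * (L - 1) - (V (tau + t ^+ 2) y - v - t ^+ 2 * (m * a + s2 / 2 * b)))); last by field.
rewrite (le_trans (ler_normD _ _))//.
have hB := ler_normB (v * (L - 1)) (V (tau + t ^+ 2) y - v - t ^+ 2 * (m * a + s2 / 2 * b)).
apply: (@le_trans _ _ (K0 * (t ^+ 3 * F1 + (t ^+ 3 * s2 + t ^+ 2 * lindeberg t))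
  + (C * t ^+ 3 + D2 * t ^+ 3))).
  apply: lerD => //; apply: (le_trans hB); apply: lerD => //.
  by rewrite (le_trans hT)// ler_wpM2l.
set z := t ^+ 3; set w := t ^+ 2 * _.
have K1 := mulr_ge0 K0_ge0 Lin0.
rewrite -subr_ge0 (_ : _ - _ = K0 * (F1 + s2) * w + K0 * z + (C + D2) * w);
  last by rewrite /w /z; ring.
by rewrite !addr_ge0// mulr_ge0// ?mulr_ge0// addr_ge0.
Qed.

End one_step.

Section iterate.
Context d (T : measurableType d) (R : realType) (P : probability T R).
Variables (f h : T -> R) (H : R).
Hypotheses (sf : sqint P f) (f0 : \int[P]_x f x = 0)
  (mh : measurable_fun setT h) (hH : forall x, `|h x| <= H)
  (h0 : \int[P]_x h x = 0).

Let s2 := inner P f f.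
Let m := inner P f h.
Local Notation l := (tilt P h).
Let mf : measurable_fun setT f. Proof. by case: sf. Qed.

Lemma tuple_prod_tilt n (x : n.-tuple T) : (0 < n)%N ->
  tuple_prod (tilt P h (Num.sqrt n%:R)^-1) x =
  expR ((Num.sqrt n%:R)^-1 * tuple_sum h x - inner P h h / 2).
Proof.
move=> n0; rewrite /tuple_prod /tilt -expR_sum; congr expR.
rewrite big_split /= -mulr_sumr sumr_const card_ord -[X in _ + X]mulr_natl.
congr (_ + _); rewrite mulrN; congr (- _).
have n00 : (n%:R : R) != 0 by rewrite pnatr_eq0 -lt0n.
by rewrite exprVn sqr_sqrtr// mulrA divff ?mul1r.
Qed.

Lemma inv_sqrt_nat_bounds n : 0 <= (Num.sqrt (n%:R : R))^-1 <= 1.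
Proof.
rewrite invr_ge0 sqrtr_ge0/=; case: n => [|n]; first by rewrite sqrtr0 invr0.
rewrite invf_le1 ?sqrtr_gt0 ?ltr0n// -[leLHS]sqrtr1 ler_wsqrtr//.
by rewrite ler1n.
Qed.

Lemma cvg_inv_sqrt_nat : (Num.sqrt (n%:R : R))^-1 @[n --> \oo] --> 0.
Proof.
apply/cvgrPdist_lt => e e0; exists (Num.truncn (e ^- 2)).+1 => // n /= en.
rewrite sub0r normrN ger0_norm ?invr_ge0 ?sqrtr_ge0//.
have n0 : 0 < n%:R :> R by rewrite ltr0n; exact: leq_trans en.
rewrite -[ltRHS]invrK ltf_pV2 ?posrE ?sqrtr_gt0 ?invr_gt0//.
rewrite -[ltLHS]ger0_norm ?invr_ge0 ?ltW// -sqrtr_sqr ltr_sqrt// exprVn.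
by rewrite (lt_le_trans (truncnS_gt _))// ler_nat.
Qed.

Lemma sqrt_nat_pow3 n : n%:R * (Num.sqrt (n%:R : R))^-1 ^+ 3 <= 1.
Proof.
have /andP[t0 t1] := inv_sqrt_nat_bounds n.
case: n t0 t1 => [|n] t0 t1; first by rewrite mul0r.
by rewrite exprS mulrCA exprVn sqr_sqrtr// divff ?mulr1.
Qed.

(** Mass defects of order n^(-3/2) in each of n coordinates accumulate to a bounded factor. *)
Lemma one_plus_pow_le n C : 0 <= C ->
  (1 + C * (Num.sqrt (n%:R : R))^-1 ^+ 3) ^+ n <= expR C.
Proof.
move=> C0; have /andP[t0 t1] := inv_sqrt_nat_bounds n.
set t := (Num.sqrt n%:R)^-1 in t0 t1 *.
have t30 : 0 <= t ^+ 3 by exact: exprn_ge0.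
apply: (@le_trans _ _ (expR (C * t ^+ 3) ^+ n)).
  rewrite lerXn2r ?nnegrE ?expR_ge0 ?expR_ge1Dx//.
  by rewrite addr_ge0// mulr_ge0.
rewrite -expRM_natl ler_expR mulrCA ler_piMr//.
exact: sqrt_nat_pow3.
Qed.

(** The tilted products are not normalised. Their masses are nevertheless bounded uniformly in [n],
    which suffices for integrability and for the tail estimates. *)
Lemma tilt_mass_bound : exists C, forall n (g : n.-tuple T -> R) (b : R),
  measurable_fun setT g -> (forall x, `|g x| <= b) ->
  (power_probability P n).-integrable setT (EFin \o
    (fun x => g x * tuple_prod (l (Num.sqrt n%:R)^-1) x)) /\
  `|\int[power_probability P n]_x
    (g x * tuple_prod (l (Num.sqrt n%:R)^-1) x)| <= b * C.
Proof.
have [C [C0 b1 _ b3]] := tilt_bounds mh hH h0.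
exists (expR C) => n g b mg gb; have t01 := inv_sqrt_nat_bounds n.
set t := (Num.sqrt n%:R)^-1 in t01 *; have /andP[t0 t1] := t01.
have b0 : 0 <= b by rewrite (le_trans _ (gb point)).
have ml : measurable_fun setT (l t) by exact: measurable_tilt.
have il : P.-integrable setT (EFin \o l t).
  apply: (@bounded_integrable _ _ _ _ _ (1 + C)) => // x.
  rewrite ger0_norm ?tilt_ge0//.
  have := b1 t x t01; rewrite ler_norml => /andP[_].
  have : C * t <= C by rewrite ler_piMr.
  by move=> h1 h2; lra.
have iP := integrable_tuple_prod n ml (tilt_ge0 P h t) il.
have iZ := integrableZl measurableT b iP.
have mp : measurable_fun setT (fun x => g x * tuple_prod (l t) x).
  by apply: measurable_funM => //; exact: measurable_tuple_prod.
have pb (x : n.-tuple T) : `|g x * tuple_prod (l t) x| <= b * tuple_prod (l t) x.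
  have p0 : 0 <= tuple_prod (l t) x by apply: tuple_prod_ge0 => y; exact: tilt_ge0.
  by rewrite normrM (ger0_norm p0) ler_wpM2r.
have ig : (power_probability P n).-integrable setT (EFin \o
    (fun x => g x * tuple_prod (l t) x)).
  apply: (le_integrable _ _ _ iZ) => //; first exact/measurable_EFinP.
  move=> x _ /=; rewrite lee_fin (le_trans (pb x))// ler_norm//.
split => //.
rewrite (le_trans (le_normr_Rintegral _ ig))//.
apply: (@le_trans _ _ (\int[power_probability P n]_x (b * tuple_prod (l t) x))).
  by apply: le_Rintegral => //; exact: (integrable_norm ig).
rewrite RintegralZl// Rintegral_tuple_prod//; last by move=> y; exact: tilt_ge0.
rewrite ler_wpM2l//; apply: le_trans (one_plus_pow_le n C0).
have m0 : 0 <= \int[P]_x l t x by apply: Rintegral_ge0 => x _; exact: tilt_ge0.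
rewrite lerXn2r ?nnegrE// -/t.
  by rewrite addr_ge0// mulr_ge0// exprn_ge0.
by have := b3 t t01; rewrite ler_norml => /andP[_]; lra.
Qed.

Variables (s0 c : R).
Hypothesis s0_gt0 : 0 < s0.
Local Notation V := (flow s0 s2 m c).

(* Lindeberg's method: replacing one summand t f(x_i) under the tilt costs
   K (t^3 + t^2 lindeberg t) against letting the flow run for a time t^2. *)
Lemma tilted_iterate : exists K C, [/\ 0 <= K, 0 <= C & forall t k y,
  0 <= t <= 1 ->
  `|\int[power_probability P k]_x
     (V 0 (y + t * tuple_sum f x) * tuple_prod (l t) x) - V (k%:R * t ^+ 2) y|
  <= k%:R * (K * (t ^+ 3 + t ^+ 2 * lindeberg P f t)) * (1 + C * t ^+ 3) ^+ k].
Proof.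
have [K [K0 stepK]] := tilted_one_step sf f0 mh hH h0 c s0_gt0.
have [C [C0 b1 _ b3]] := tilt_bounds mh hH h0.
exists K, C; split => // t k + t01; have /andP[t0 t1] := t01.
set eps := K * _; set L := 1 + C * t ^+ 3.
have L1 : 1 <= L by rewrite lerDl mulr_ge0// exprn_ge0.
have eps0 : 0 <= eps.
  by rewrite mulr_ge0// addr_ge0 ?mulr_ge0 ?exprn_ge0// lindeberg_ge0.
have l_ge0 x : 0 <= l t x by exact: tilt_ge0.
have l_le x : l t x <= 1 + C.
  have := b1 t x t01; rewrite ler_norml => /andP[_].
  have : C * t <= C by rewrite ler_piMr.
  by move=> h1 h2; lra.
have ml : measurable_fun setT (l t) by exact: measurable_tilt.
have mV0 : measurable_fun setT (V 0).
  by apply: continuous_measurable_fun; exact: continuous_flow.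
have prod_le n (x : n.-tuple T) : tuple_prod (l t) x <= (1 + C) ^+ n.
  rewrite -[X in _ <= _ ^+ X]card_ord -prodr_const.
  by apply: ler_prod => i _; rewrite l_ge0 l_le.
have prod_ge0 n (x : n.-tuple T) : 0 <= tuple_prod (l t) x.
  exact: tuple_prod_ge0.
pose F n (y : R) (x : n.-tuple T) := V 0 (y + t * tuple_sum f x) * tuple_prod (l t) x.
have F_le n y (x : n.-tuple T) : `|F n y x| <= (1 + C) ^+ n.
  rewrite ger0_norm ?mulr_ge0 ?flow_ge0// -[leRHS]mul1r.
  by rewrite ler_pM ?flow_ge0 ?flow_le1.
have mF n y : measurable_fun setT (F n y).
  apply: measurable_funM; last exact: measurable_tuple_prod.
  apply: measurableT_comp => //; apply: measurable_funD => //.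
  by apply: measurable_funM => //; exact: measurable_tuple_sum.
(* The starting point [y] stays universally quantified: after splitting off one coordinate the
   induction hypothesis is used at [y + t * f x]. *)
elim: k => [|k IH] y.
  rewrite (Rintegral_power0 _ (mF 0 y)) !mul0r /F /tuple_sum /tuple_prod !big_ord0.
  by rewrite mulr0 addr0 mulr1 subrr normr0.
rewrite (Rintegral_powerS _ (mF _ y) (F_le _ y)).
have sectE x : \int[power_probability P k]_xs F k.+1 y (tuple_cons (x, xs)) =
    l t x * \int[power_probability P k]_xs F k (y + t * f x) xs.
  rewrite -RintegralZl//; last first.
    exact: (bounded_integrable _ (mF _ _) (F_le _ _)).
  apply: eq_Rintegral => xs _.
  rewrite /F tuple_sum_cons tuple_prod_cons mulrCA; congr (_ * (V 0 _ * _)).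
  by ring.
have mI := measurable_power_section P (mF _ y) (F_le _ y).
have mW : measurable_fun setT (fun x => V (k%:R * t ^+ 2) (y + t * f x)).
  apply: measurableT_comp.
    by apply: continuous_measurable_fun; exact: continuous_flow.
  by apply: measurable_funD => //; exact: measurable_funM.
have sW : sqint P (fun x => l t x * V (k%:R * t ^+ 2) (y + t * f x)).
  apply: (@sqint_bounded _ _ _ _ _ (1 + C)); first exact: measurable_funM.
  move=> x; rewrite ger0_norm ?mulr_ge0 ?flow_ge0//.
  by rewrite -[leRHS]mulr1 ler_pM ?flow_ge0 ?flow_le1.
set e := k%:R * eps * L ^+ k in IH.
have L0 : 0 <= L by rewrite (le_trans _ L1).
have e0 : 0 <= e by apply: mulr_ge0; [exact: mulr_ge0|exact: exprn_ge0].
have diff x : `|\int[power_probability P k]_xs F k.+1 y (tuple_cons (x, xs)) -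
    l t x * V (k%:R * t ^+ 2) (y + t * f x)| <= e * l t x.
  by rewrite sectE -mulrBr normrM (ger0_norm (l_ge0 x)) mulrC ler_wpM2r// IH.
have sI : sqint P
    (fun x => \int[power_probability P k]_xs F k.+1 y (tuple_cons (x, xs))).
  apply: (@sqint_bounded _ _ _ _ _ (e * (1 + C) + (1 + C))) => // x.
  rewrite -[X in `|X|](subrK (l t x * V (k%:R * t ^+ 2) (y + t * f x))).
  rewrite (le_trans (ler_normD _ _))// lerD//.
    by rewrite (le_trans (diff x))// ler_wpM2l.
  rewrite ger0_norm ?mulr_ge0 ?flow_ge0//.
  by rewrite -[leRHS]mulr1 ler_pM ?flow_ge0 ?flow_le1.
have sl : sqint P (l t).
  by apply: (@sqint_bounded _ _ _ _ _ (1 + C)) => // x; rewrite ger0_norm.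
have step1 : `|\int[P]_x (\int[power_probability P k]_xs F k.+1 y (tuple_cons (x, xs))) -
   \int[P]_x (l t x * V (k%:R * t ^+ 2) (y + t * f x))| <= e * L.
  rewrite -RintegralB//; try exact: sqint_integrable.
  have sd := sqintB sI sW.
  rewrite (le_trans (le_normr_Rintegral _ (sqint_integrable sd)))//.
  apply: (@le_trans _ _ (\int[P]_x (e * l t x))).
    apply: le_Rintegral => //.
    - exact: (integrable_norm (sqint_integrable sd)).
    - exact: (sqint_integrable (sqintZ e sl)).
  rewrite RintegralZl//; last exact: sqint_integrable.
  rewrite ler_wpM2l// /L; have := b3 t t01.
  by rewrite ler_norml => /andP[_]; lra.
have step2 := stepK t (k%:R * t ^+ 2) y t01 (mulr_ge0 (ler0n _ _) (sqr_ge0 t)).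
rewrite (_ : k.+1%:R * t ^+ 2 = k%:R * t ^+ 2 + t ^+ 2); last by rewrite -natr1; ring.
have step := ler_normD (\int[P]_x (\int[power_probability P k]_xs F k.+1 y (tuple_cons (x, xs))) -
   \int[P]_x (l t x * V (k%:R * t ^+ 2) (y + t * f x)))
   (\int[P]_x (l t x * V (k%:R * t ^+ 2) (y + t * f x)) - V (k%:R * t ^+ 2 + t ^+ 2) y).
rewrite addrA subrK in step.
apply: (le_trans step); apply: (le_trans (lerD step1 step2)).
rewrite -/eps -natr1 [leRHS](_ : _ = e * L + eps * L ^+ k.+1); last first.
  by rewrite /e exprSr; ring.
by rewrite lerD2l ler_peMr// exprn_ege1.
Qed.

End iterate.

(** A squeeze in two stages: at each fixed quality [j] of approximation the bounds hold for large
    [n] and converge, and only their limits are then sent to [a]. It serves both smoothing of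
    indicators and approximation of tangents. *)
Lemma cvg_squeeze_family (R : realType) (x : nat -> R) (a : R)
    (U L : nat -> nat -> R) (u l : nat -> R) :
  (forall j, \forall n \near \oo, L j n <= x n <= U j n) ->
  (forall j, U j n @[n --> \oo] --> u j) -> u j @[j --> \oo] --> a ->
  (forall j, L j n @[n --> \oo] --> l j) -> l j @[j --> \oo] --> a ->
  x n @[n --> \oo] --> a.
Proof.
move=> LxU Uu ua Ll la; apply/cvgrPdist_lt => e e0.
have e2 : 0 < e / 2 by rewrite divr_gt0.
have /cvgrPdist_lt/(_ _ e2)[j1 _ uj] := ua.
have /cvgrPdist_lt/(_ _ e2)[j2 _ lj] := la.
pose j := maxn j1 j2.
have /cvgrPdist_lt/(_ _ e2)[n1 _ Un] := Uu j.
have /cvgrPdist_lt/(_ _ e2)[n2 _ Ln] := Ll j.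
have [n3 _ LU] := LxU j.
exists (maxn n3 (maxn n1 n2)) => // n.
rewrite /= !geq_max => /andP[n3n /andP[n1n n2n]].
have := uj j (leq_maxl _ _); have := lj j (leq_maxr _ _).
have := Un n n1n; have := Ln n n2n; have /andP[] := LU n n3n.
rewrite !ltr_norml => h1 h2 /andP[h3 h4] /andP[h5 h6] /andP[h7 h8] /andP[h9 h10].
by apply/andP; split; lra.
Qed.

Lemma measurable_superlevel d (T : measurableType d) (R : realType)
    (g : T -> R) (c : R) :
  measurable_fun setT g -> measurable [set x | c < g x].
Proof.
move=> mg; rewrite (_ : [set _ | _] = setT `&` g @^-1` `]c, +oo[%classic).
  by apply: mg => //; exact: measurable_itv.
by rewrite setTI; apply/seteqP; split => x /=; rewrite in_itv/= andbT.
Qed.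

Section clt.
Context d (T : measurableType d) (R : realType) (P : probability T R).
Variables (f h : T -> R) (H : R).
Hypotheses (sf : sqint P f) (f0 : \int[P]_x f x = 0)
  (mh : measurable_fun setT h) (hH : forall x, `|h x| <= H)
  (h0 : \int[P]_x h x = 0).

Let s2 := inner P f f.
Let m := inner P f h.
Local Notation rt n := (Num.sqrt n%:R)^-1.
Let s2_ge0 : 0 <= s2. Proof. exact: inner_ge0. Qed.
Let mf : measurable_fun setT f. Proof. by case: sf. Qed.

(** With t = n^(-1/2), the [n] steps of length t^2 add up to time 1, and the [n] errors t^3 + t^2
    [lindeberg] t add up to t + [lindeberg] t, which tends to 0. *)
Lemma tilted_clt_smooth (s0 c : R) : 0 < s0 ->
  \int[power_probability P n]_x (flow s0 s2 m c 0 (rt n * tuple_sum f x) *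
    tuple_prod (tilt P h (rt n)) x) @[n --> \oo] -->
  Phi ((m - c) / Num.sqrt (s0 + s2)).
Proof.
move=> s0_gt0.
have [K [C [K0 C0 iterK]]] := tilted_iterate sf f0 mh hH h0 c s0_gt0.
have rt0 : (rt n : R) @[n --> \oo] --> 0 := @cvg_inv_sqrt_nat R.
have rt_ge0 n : 0 <= rt n :> R by rewrite invr_ge0 sqrtr_ge0.
have lin0 := cvg_lindeberg sf rt_ge0 rt0.
apply/cvgrPdist_le => e e0.
have : (K * (rt n + lindeberg P f (rt n)) * expR C : R) @[n --> \oo] --> 0.
  rewrite [X in _ --> X](_ : 0 = K * (0 + 0) * expR C); last by rewrite addr0 mulr0 mul0r.
  by apply: cvgM; [apply: cvgM; [exact: cvg_cst|exact: cvgD]|exact: cvg_cst].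
move/cvgrPdist_le => /(_ e e0)[N _ HN].
exists N.+1 => // n /= Nn; rewrite distrC.
have n0 : (0 < n)%N by exact: leq_trans Nn.
have nt2 : n%:R * rt n ^+ 2 = 1 :> R.
  by rewrite exprVn sqr_sqrtr// divff// pnatr_eq0 -lt0n.
have := iterK (rt n) n 0 (@inv_sqrt_nat_bounds R n); rewrite nt2.
rewrite (_ : flow s0 s2 m c 1 0 = Phi ((m - c) / Num.sqrt (s0 + s2))); last first.
  by rewrite /flow /flow_arg /flow_scale add0r !mulr1.
under eq_Rintegral do rewrite add0r.
move=> /le_trans; apply.
have := HN n (ltnW Nn); rewrite sub0r normrN => /(le_trans (ler_norm _)).
apply: le_trans.
have lin_ge0 := lindeberg_ge0 P f (rt_ge0 n).
apply: ler_pM.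
- by rewrite mulr_ge0// mulr_ge0// addr_ge0 ?mulr_ge0 ?exprn_ge0.
- by rewrite exprn_ge0// addr_ge0// mulr_ge0// exprn_ge0.
- rewrite mulrCA ler_wpM2l// le_eqVlt; apply/orP; left; apply/eqP.
  by rewrite exprS mulrDr mulrCA nt2 mulr1 mulrA nt2 mul1r.
- exact: one_plus_pow_le.
Qed.

Lemma cvg_PhiN_nat : Phi (- n.+1%:R) @[n --> \oo] --> (0 : R).
Proof.
rewrite [X in _ --> X](_ : 0 = 1 - 1 :> R); last by rewrite subrr.
under eq_fun do rewrite PhiN.
apply: cvgB; first exact: cvg_cst.
by have := @cvg_Phi_nat R; rewrite -cvg_shiftS.
Qed.

(* The indicator of z > c is squeezed between the profiles flow (del^4) _ _ (c +- del) 0,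
   which are normal distribution functions with standard deviation del^2, up to the
   tail Phi (- 1 / del). *)
Lemma tilted_clt (c : R) : 0 < s2 ->
  \int[power_probability P n]_x
    (\1_[set x : n.-tuple T | c < rt n * tuple_sum f x] x *
     tuple_prod (tilt P h (rt n)) x) @[n --> \oo] -->
  Phi ((m - c) / Num.sqrt s2).
Proof.
move=> s2_gt0; have [C massC] := tilt_mass_bound mh hH h0.
pose del (j : nat) : R := j.+1%:R^-1.
have del_gt0 j : 0 < del j by rewrite invr_gt0.
pose A cc j n := \int[power_probability P n]_x
  (flow (del j ^+ 4) s2 m cc 0 (rt n * tuple_sum f x) *
    tuple_prod (tilt P h (rt n)) x).
pose tl (j : nat) : R := Phi (- j.+1%:R) * C.
(* The profile has standard deviation [del j ^+ 2], so moving its centre by [del j] amounts to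
   [j.+1] standard deviations. *)
have delE j : j.+1%:R * del j ^+ 2 = del j.
  by rewrite /del expr2 mulrA divff ?mul1r// pnatr_eq0.
have del0 : del j @[j --> \oo] --> 0 by exact: cvg_harmonic.
have tl0 : tl j @[j --> \oo] --> 0.
  by rewrite -(mul0r C); apply: cvgM; [exact: cvg_PhiN_nat|exact: cvg_cst].
have cvg_Phi_arg (b : nat -> R) (b0 : R) : b j @[j --> \oo] --> b0 ->
    Phi ((m - b j) / Num.sqrt (del j ^+ 4 + s2)) @[j --> \oo] -->
    Phi ((m - b0) / Num.sqrt s2).
  move=> bb0; apply: continuous_cvg; first exact: continuous_Phi.
  apply: cvgM; first by apply: cvgB => //; exact: cvg_cst.
  apply: cvgV; first by rewrite gt_eqF// sqrtr_gt0.
  apply: continuous_cvg; first exact: sqrt_continuous.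
  rewrite -[X in _ --> X]add0r; apply: cvgD; last exact: cvg_cst.
  rewrite [X in _ --> X](_ : 0 = 0 * 0 * (0 * 0)); last by rewrite !mul0r.
  under eq_fun do rewrite (exprM _ 2 2) expr2 expr2.
  by apply: cvgM; apply: cvgM.
have flowE cc j (z : R) : flow (del j ^+ 4) s2 m cc 0 z = Phi ((z - cc) / del j ^+ 2).
  rewrite /flow /flow_arg /flow_scale !mulr0 !addr0.
  by rewrite (exprM _ 2 2) sqrtr_sqr ger0_norm// exprn_ge0// ltW.
have mS n (c' : R) : measurable_fun setT
    (\1_[set x : n.-tuple T | c' < rt n * tuple_sum f x] : n.-tuple T -> R).
  apply: measurable_indic; apply: measurable_superlevel.
  by apply: measurable_funM => //; exact: measurable_tuple_sum.
have mflow cc j n : measurable_fun setT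
    (fun x : n.-tuple T => flow (del j ^+ 4) s2 m cc 0 (rt n * tuple_sum f x)).
  apply: measurableT_comp.
    by apply: continuous_measurable_fun; apply: continuous_flow.
  by apply: measurable_funM => //; exact: measurable_tuple_sum.
have I1 n c' := (massC n (\1_[set x : n.-tuple T | c' < rt n * tuple_sum f x]) 1 (mS n c')).
have I2 cc j n := (massC n _ 1 (mflow cc j n)).
have I3 j n := (massC n (fun=> Phi (- j.+1%:R)) (Phi (- j.+1%:R)) (measurable_cst _)).
have ind1 n c' (x : n.-tuple T) : `|\1_[set x | c' < rt n * tuple_sum f x] x| <= 1 :> R.
  by rewrite indicE; case: (_ \in _); rewrite ?normr1 ?normr0.
have fl1 cc j n (x : n.-tuple T) :
    `|flow (del j ^+ 4) s2 m cc 0 (rt n * tuple_sum f x)| <= 1.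
  by rewrite ger0_norm ?flow_ge0 ?flow_le1.
have tlb j n : \int[power_probability P n]_x (Phi (- j.+1%:R) *
    tuple_prod (tilt P h (rt n)) x) <= tl j.
  apply: le_trans (ler_norm _) _; apply: (I3 j n _).2 => _.
  by rewrite ger0_norm// Phi_ge0.
have prod0 n (x : n.-tuple T) : 0 <= tuple_prod (tilt P h (rt n)) x.
  by apply: tuple_prod_ge0 => y; exact: tilt_ge0.
have i3 j n := (I3 j n (fun=> eq_ind_r (fun z => z <= _) (lexx _) (ger0_norm (Phi_ge0 (- j.+1%:R))))).1.
apply: (@cvg_squeeze_family _ _ _ (fun j n => A (c - del j) j n + tl j)
  (fun j n => A (c + del j) j n - tl j)
  (fun j => Phi ((m - (c - del j)) / Num.sqrt (del j ^+ 4 + s2)) + tl j)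
  (fun j => Phi ((m - (c + del j)) / Num.sqrt (del j ^+ 4 + s2)) - tl j)).
- move=> j; apply: nearW => n; apply/andP; split.
  + rewrite lerBlDr; apply: le_trans _ (lerD (lexx _) (tlb j n)).
    rewrite -RintegralD//; [|exact: (I1 n c (ind1 n c)).1].
    apply: le_Rintegral => //.
    * exact: (I2 _ _ _ (fl1 _ _ _)).1.
    * exact: (integrableD measurableT (I1 n c (ind1 n c)).1 (i3 j n)).
    move=> x _; rewrite -mulrDl ler_wpM2r// indicE.
    case: (boolP (x \in _)) => [_|]; first by rewrite (le_trans (flow_le1 _ _ _ _ _ _))// lerDl Phi_ge0.
    rewrite notin_setE /= => /negP; rewrite -leNgt => hx.
    by rewrite add0r flowE Phi_le ler_pdivrMr ?exprn_gt0// mulNr delE; lra.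
  + apply: le_trans _ (lerD (lexx _) (tlb j n)).
    rewrite -RintegralD//; [|exact: (I2 _ _ _ (fl1 _ _ _)).1].
    apply: le_Rintegral => //.
    * exact: (I1 n c (ind1 n c)).1.
    * exact: (integrableD measurableT (I2 _ _ _ (fl1 _ _ _)).1 (i3 j n)).
    move=> x _; rewrite -mulrDl ler_wpM2r// indicE.
    case: (boolP (x \in _)) => [|_]; last first.
      by apply: addr_ge0; [exact: flow_ge0|exact: Phi_ge0].
    rewrite inE /= => hx; rewrite PhiN addrCA lerDl subr_ge0 flowE Phi_le.
    by rewrite ler_pdivlMr ?exprn_gt0// delE; lra.
- move=> j; apply: cvgD; last exact: cvg_cst.
  by apply: tilted_clt_smooth; rewrite exprn_gt0.
- rewrite -[X in _ --> X]addr0; apply: cvgD => //.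
  rewrite -[c in X in _ --> X]subr0; apply: cvg_Phi_arg.
  by apply: cvgB => //; exact: cvg_cst.
- move=> j; apply: cvgB; last exact: cvg_cst.
  by apply: tilted_clt_smooth; rewrite exprn_gt0.
- rewrite -[X in _ --> X]subr0; apply: cvgB => //.
  rewrite -[c in X in _ --> X]addr0; apply: cvg_Phi_arg.
  by apply: cvgD => //; exact: cvg_cst.
Qed.

End clt.

(** * Local asymptotic equivalence *)

(** With [x] the mass of one factor, this controls the mass lost by the product through n (1 - x),
    the quantity known to vanish. *)
Lemma bernoulli_ineq (R : realType) (x : R) n : 0 <= x ->
  1 - n%:R * (1 - x) <= x ^+ n.
Proof.
move=> x0; elim: n => [|n IH]; first by rewrite mul0r subr0.
rewrite exprS; apply: (@le_trans _ _ (x * (1 - n%:R * (1 - x)))); last first.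
  by rewrite ler_wpM2l.
rewrite -subr_ge0 -natr1 (_ : _ - _ = n%:R * (1 - x) ^+ 2); last by ring.
by rewrite mulr_ge0// sqr_ge0.
Qed.

Section local_density.
Context d (T : measurableType d) (R : realType) (P : probability T R).
Local Notation rt n := (Num.sqrt n%:R)^-1.

(* l n is the density of the P-continuous part of Q n.  Its square root is
   1 + h / (2 sqrt n) + o(1 / sqrt n) in L_2(P), and the singular part of Q n has
   mass o(1 / n). *)
Definition local_density (Q : nat -> probability T R) (l : nat -> T -> R)
    (h : T -> R) : Prop :=
  [/\ (forall n, measurable_fun setT (l n) /\ forall x, 0 <= l n x),
      (forall n (F : T -> \bar R), measurable_fun setT F ->
        (forall x, 0 <= F x)%E ->
        (\int[P]_x (F x * (l n x)%:E) <= \int[Q n]_x F x)%E),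
      n%:R * (1 - \int[P]_x l n x) @[n --> \oo] --> 0 &
      Num.sqrt n%:R *
        norm2 P (fun x => Num.sqrt (l n x) - 1 - rt n * (h x / 2))
        @[n --> \oo] --> 0].

Section basic.
Variables (Q : nat -> probability T R) (l : nat -> T -> R) (h : T -> R).
Hypotheses (ldQ : local_density Q l h) (sh : sqint P h).

Let r n x := Num.sqrt (l n x).

Let mass_le1 n : (\int[P]_x (l n x)%:E <= 1)%E.
Proof.
have [_ lQ _ _] := ldQ.
have := lQ n (cst 1%E) (measurable_cst _) (fun=> lee01).
rewrite [leLHS](_ : _ = (\int[P]_x (l n x)%:E)%E); last first.
  by apply: eq_integral => x _; rewrite mul1e.
move=> /le_trans; apply; rewrite integral_cst// mul1e.
exact: probability_le1.
Qed.

Lemma local_density_integrable n : P.-integrable setT (EFin \o l n).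
Proof.
have [/(_ n)[ml l0] _ _ _] := ldQ; apply/integrableP; split.
  exact/measurable_EFinP.
under eq_integral do rewrite /= ger0_norm//.
by rewrite (le_lt_trans (mass_le1 n))// ltry.
Qed.

Lemma local_density_mass n : 0 <= \int[P]_x l n x <= 1.
Proof.
have [/(_ n)[ml l0] _ _ _] := ldQ; apply/andP; split.
  exact: Rintegral_ge0.
rewrite -lee_fin /Rintegral fineK//.
exact: (integrable_fin_num _ (local_density_integrable n)).
Qed.

Lemma sqint_sqrt_density n : sqint P (r n).
Proof.
have [/(_ n)[ml l0] _ _ _] := ldQ; split.
  apply: (measurableT_comp _ ml); apply: continuous_measurable_fun.
  exact: sqrt_continuous.
under eq_fun do rewrite sqr_sqrtr//.
exact: local_density_integrable.
Qed.

Lemma inner_sqrt_density n : inner P (r n) (r n) = \int[P]_x l n x.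
Proof.
have [/(_ n)[ml l0] _ _ _] := ldQ.
by apply: eq_Rintegral => x _; rewrite -expr2 sqr_sqrtr.
Qed.

Lemma power_density_le n (psi : n.-tuple T -> R) : measurable_fun setT psi ->
  (forall x, 0 <= psi x <= 1) ->
  \int[power_probability P n]_x (psi x * tuple_prod (l n) x) <=
  \int[power_probability (Q n) n]_x psi x.
Proof.
move=> mpsi psi01; have [/(_ n)[ml l0] lQ _ _] := ldQ.
have := @tensorized_domination _ T R P (Q n) (l n) n (EFin \o psi) ml l0
  (lQ n) (iffRL (measurable_EFinP _ _) mpsi).
have psi0 x : (0 <= (psi x)%:E)%E by rewrite lee_fin; have /andP[] := psi01 x.
move=> /(_ psi0) /=; rewrite /Rintegral => le; apply: fine_le => //.
  apply: integrable_fin_num => //.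
  apply: (le_integrable _ _ _ (integrable_tuple_prod n ml l0 (local_density_integrable n))) => //.
    by apply/measurable_EFinP; apply: measurable_funM => //; exact: measurable_tuple_prod.
  move=> x _ /=; rewrite lee_fin normrM ler_piMl//.
  by have /andP[p0 p1] := psi01 x; rewrite ger0_norm.
apply: integrable_fin_num => //.
apply: (@bounded_integrable _ _ _ _ _ 1) => // x.
by have /andP[p0 p1] := psi01 x; rewrite ger0_norm.
Qed.

(** The lower bound applied to the complementary test [1 - psi], combined with the mass of the
    product density, which Bernoulli's inequality bounds from below. *)
Lemma power_density_ge n (psi : n.-tuple T -> R) : measurable_fun setT psi ->
  (forall x, 0 <= psi x <= 1) ->
  \int[power_probability (Q n) n]_x psi x <=
  \int[power_probability P n]_x (psi x * tuple_prod (l n) x) +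
  n%:R * (1 - \int[P]_x l n x).
Proof.
move=> mpsi psi01; have [/(_ n)[ml l0] lQ _ _] := ldQ.
have il := integrable_tuple_prod n ml l0 (local_density_integrable n).
have ipsil : (power_probability P n).-integrable setT
    (EFin \o (fun x => psi x * tuple_prod (l n) x)).
  apply: (le_integrable _ _ _ il) => //.
    by apply/measurable_EFinP; apply: measurable_funM => //; exact: measurable_tuple_prod.
  move=> x _ /=; rewrite lee_fin normrM ler_piMl//.
  by have /andP[p0 p1] := psi01 x; rewrite ger0_norm.
have ipsi : (power_probability (Q n) n).-integrable setT (EFin \o psi).
  apply: (@bounded_integrable _ _ _ _ _ 1) => // x.
  by have /andP[p0 p1] := psi01 x; rewrite ger0_norm.
have := @power_density_le n (fun x => 1 - psi x).
have m1 : measurable_fun setT (fun x => 1 - psi x) by exact: measurable_funB.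
have h1 x : 0 <= 1 - psi x <= 1 by have /andP[p0 p1] := psi01 x; lra.
move=> /(_ m1 h1).
rewrite [X in _ <= X -> _](_ : _ = 1 - \int[power_probability (Q n) n]_x psi x);
  last first.
  rewrite RintegralB//; last exact: (sqint_integrable (sqint_cst _ 1)).
  rewrite Rintegral_cst// [X in fine X](_ : _ = 1%E) ?mulr1//.
  exact: probability_setT.
rewrite [X in X <= _ -> _](_ : _ = (\int[P]_x l n x) ^+ n -
   \int[power_probability P n]_x (psi x * tuple_prod (l n) x)); last first.
  rewrite -(Rintegral_tuple_prod n ml l0 (local_density_integrable n)).
  rewrite -RintegralB//; apply: eq_Rintegral => x _.
  by rewrite mulrBl mul1r.
have /andP[a0 _] := local_density_mass n.
have := bernoulli_ineq n a0.
by lra.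
Qed.

Let rho n := Num.sqrt n%:R *
  norm2 P (fun x => r n x - 1 - rt n * (h x / 2)).
Let eta n := n%:R * (1 - \int[P]_x l n x).

Let rho_cvg : rho n @[n --> \oo] --> 0. Proof. by have [] := ldQ. Qed.
Let eta_cvg : eta n @[n --> \oo] --> 0. Proof. by have [] := ldQ. Qed.

Let sqrt_mul_rt n : (0 < n)%N -> Num.sqrt n%:R * rt n = 1 :> R.
Proof. by move=> n0; rewrite divff// gt_eqF// sqrtr_gt0 ltr0n. Qed.

Let sh2 k : sqint P (fun x => k * (h x / 2)).
Proof.
rewrite (_ : (fun x => _) = (fun x => k / 2 * h x)); first exact: sqintZ.
by apply/funext => x; field.
Qed.

Let srho n : sqint P (fun x => r n x - 1 - rt n * (h x / 2)).
Proof.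
apply: sqintB; last exact: sh2.
by apply: sqintB; [exact: sqint_sqrt_density|exact: sqint_cst].
Qed.

Let sr1 n : sqint P (fun x => r n x - 1).
Proof. by apply: sqintB; [exact: sqint_sqrt_density|exact: sqint_cst]. Qed.

Let norm_r1 n : (0 < n)%N ->
  Num.sqrt n%:R * norm2 P (fun x => r n x - 1) <= rho n + norm2 P h / 2.
Proof.
move=> n0.
rewrite (@eq_norm2 _ _ _ _ _
  (fun x => (r n x - 1 - rt n * (h x / 2)) + rt n / 2 * h x)); last first.
  by move=> x; field; rewrite gt_eqF// sqrtr_gt0 ltr0n.
apply: (le_trans (ler_wpM2l (sqrtr_ge0 _) (norm2D (srho n) (sqintZ _ sh)))).
rewrite mulrDr lerD2l norm2Z// mulrA ger0_norm; last first.
  by rewrite divr_ge0// invr_ge0 sqrtr_ge0.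
by rewrite mulrA sqrt_mul_rt// mulrC mul1r.
Qed.

(** The square root r of the density satisfies 2 int (r - 1) = (int r^2 - 1) - ||r - 1||^2, and both
    terms on the right are O(1/n). The left side has leading term n^(-1/2) int h, which forces int h
    = 0. *)
Lemma local_density_mean0 : \int[P]_x h x = 0.
Proof.
pose E n := rt n * eta n + rt n * (rho n + norm2 P h / 2) ^+ 2 + 2 * rho n.
have E0 : E n @[n --> \oo] --> 0.
  rewrite [X in _ --> X](_ : 0 = 0 * 0 + 0 * (0 + norm2 P h / 2) ^+ 2 + 2 * 0);
    last by rewrite !mulr0 !mul0r !addr0.
  have rt0 := @cvg_inv_sqrt_nat R.
  apply: cvgD; last by apply: cvgM => //; exact: cvg_cst.
  apply: cvgD; first exact: cvgM.
  apply: cvgM => //.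
  have : rho n + norm2 P h / 2 @[n --> \oo] --> 0 + norm2 P h / 2.
    by apply: cvgD => //; exact: cvg_cst.
  by move=> H; under eq_fun do rewrite expr2; rewrite expr2; exact: cvgM.
suff H n : (0 < n)%N -> `|\int[P]_x h x| <= E n.
  apply/eqP; rewrite -normr_eq0 eq_le normr_ge0 andbT.
  apply: (@ler_cvg_to _ _ _ _ (fun=> `|\int[P]_x h x|) E _ _ _ E0).
    exact: cvg_cst.
  by exists 1%N.
move=> n0; pose a := \int[P]_x l n x.
have rn1 : norm2 P (fun x => r n x - 1) ^+ 2 = a - 1 - 2 * \int[P]_x (r n x - 1).
  rewrite norm2_sqr /a -inner_sqrt_density.
  have sr := sqint_sqrt_density n; have s1 := sqint_cst P (1 : R).
  rewrite (innerBr sr s1 (sr1 n)) (innerBl sr s1 sr) (innerBl sr s1 s1).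
  rewrite RintegralB//; try exact: sqint_integrable.
  rewrite Rintegral_cst// [X in fine X](_ : _ = 1%E); last exact: probability_setT.
  have in1 (u : T -> R) : inner P u (fun=> 1) = \int[P]_x u x.
    by apply: eq_Rintegral => x _; rewrite mulr1.
  rewrite (innerC P (fun=> 1) (r n)) !in1 Rintegral_cst//.
  rewrite [X in fine X](_ : _ = 1%E); last exact: probability_setT.
  by rewrite /=; ring.
have hE : \int[P]_x (r n x - 1) = rt n / 2 * \int[P]_x h x +
    \int[P]_x (r n x - 1 - rt n * (h x / 2)).
  rewrite -RintegralZl//; last exact: sqint_integrable.
  rewrite -RintegralD//; last exact: sqint_integrable.
    by apply: eq_Rintegral => x _; field; rewrite gt_eqF// sqrtr_gt0 ltr0n.
  exact: (sqint_integrable (sqintZ _ sh)).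
have m1 := mean_le_norm2 (srho n).
have m2 := norm_r1 n0.
have s1 := sqrt_mul_rt n0.
have sn : Num.sqrt n%:R * Num.sqrt n%:R = n%:R :> R by rewrite -expr2 sqr_sqrtr.
set z := Num.sqrt n%:R in s1 m2 sn hE m1 *.
have z0 : 0 <= z by exact: sqrtr_ge0.
have t0 : 0 <= z^-1 by rewrite invr_ge0.
set w := norm2 P (fun x => r n x - 1) in rn1 m2.
set I := \int[P]_x (r n x - 1) in rn1 hE.
set J := \int[P]_x (r n x - 1 - _) in hE m1.
have key : \int[P]_x h x = - (z^-1 * eta n) - z^-1 * (z * w) ^+ 2 - 2 * (z * J).
  have -> : (z * w) ^+ 2 = n%:R * w ^+ 2 by rewrite exprMn expr2 sn.
  rewrite rn1 hE /eta -/a -sn.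
  by field; rewrite gt_eqF// sqrtr_gt0 ltr0n.
rewrite key -opprD -opprD normrN /E -/z.
have w0 : 0 <= w by exact: norm2_ge0.
have eta0 : 0 <= eta n.
  by rewrite mulr_ge0// subr_ge0; have /andP[] := local_density_mass n.
rewrite (le_trans (ler_normD _ _))// lerD//.
  rewrite ger0_norm; last by apply: addr_ge0; apply: mulr_ge0 => //; exact: sqr_ge0.
  rewrite lerD2l ler_wpM2l// lerXn2r ?nnegrE ?mulr_ge0//.
  by apply: le_trans m2; rewrite mulr_ge0.
by rewrite normrM ger0_norm// ler_wpM2l// normrM (ger0_norm z0) ler_wpM2l.
Qed.

End basic.
End local_density.

(** * Comparison of local sequences with exponential tilts *)

Section equivalence.
Context d (T : measurableType d) (R : realType) (P : probability T R).
Local Notation rt n := (Num.sqrt n%:R)^-1.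
Variables (Q : nat -> probability T R) (l : nat -> T -> R) (h : T -> R).
Hypotheses (ldQ : local_density P Q l h) (sh : sqint P h).
Variables (hb : T -> R) (H : R).
Hypotheses (mhb : measurable_fun setT hb) (hbH : forall x, `|hb x| <= H)
  (hb0 : \int[P]_x hb x = 0).

Let r n x := Num.sqrt (l n x).
Let s n x := Num.sqrt (tilt P hb (rt n) x).
Let rho n := Num.sqrt n%:R *
  norm2 P (fun x => r n x - 1 - rt n * (h x / 2)).
Let eta n := n%:R * (1 - \int[P]_x l n x).
Let shb : sqint P hb. Proof. exact: (@sqint_bounded _ _ _ _ _ H). Qed.

(** For the square root u of the tilt, u - 1 = (u^2 - 1) / (u + 1) with u + 1 >= 1, so the bounds on
    the tilt itself pass to its square root. *)
Let s_taylor : exists C, 0 <= C /\ forall n x,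
  `|s n x - 1 - rt n * (hb x / 2)| <= C * rt n ^+ 2.
Proof.
have [C [C0 b1 b2 _]] := tilt_bounds mhb hbH hb0.
have H0 : 0 <= H := le_trans (normr_ge0 _) (hbH point).
exists (C * (1 + H)); split; first by rewrite mulr_ge0// addr_ge0.
move=> n x; have t01 := @inv_sqrt_nat_bounds R n.
set t := rt n in t01 *; have /andP[t0 t1] := t01.
have L0 := tilt_ge0 P hb t x.
have := b1 t x t01; have := b2 t x t01; rewrite /s -/t.
have sL : Num.sqrt (tilt P hb t x) ^+ 2 = tilt P hb t x by rewrite sqr_sqrtr.
rewrite -[X in `|X - 1 - _|]sL -[X in `|X - 1| <= _]sL.
set u := Num.sqrt _; have u0 : 0 <= u by exact: sqrtr_ge0.
move=> k2 k1.
have u1 : 0 < u + 1 by rewrite ltr_wpDl.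
have u1n : (u + 1)^-1 <= 1 by rewrite invf_le1// lerDr.
have u1i : 0 <= (u + 1)^-1 by rewrite invr_ge0 ltW.
have k3 : `|u - 1| <= C * t.
  rewrite (_ : u - 1 = (u ^+ 2 - 1) * (u + 1)^-1); last by field; rewrite gt_eqF.
  by rewrite normrM (ger0_norm u1i) -[leRHS]mulr1 ler_pM.
rewrite (_ : u - 1 - _ = (u ^+ 2 - 1 - t * hb x) * (u + 1)^-1 -
    t * hb x / 2 * (u - 1) * (u + 1)^-1); last by field; rewrite gt_eqF.
rewrite (_ : C * (1 + H) * t ^+ 2 = C * t ^+ 2 + C * H * t ^+ 2); last by ring.
rewrite (le_trans (ler_normB _ _))// lerD//.
  by rewrite normrM (ger0_norm u1i) -[leRHS]mulr1 ler_pM.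
rewrite normrM (ger0_norm u1i) -[leRHS]mulr1 ler_pM// normrM.
rewrite (_ : C * H * t ^+ 2 = (t * H) * (C * t)); last by ring.
rewrite ler_pM// normrM (@ger0_norm _ 2^-1)//.
apply: (@le_trans _ _ (`|t * hb x|)); first by rewrite ler_piMr//; lra.
by rewrite normrM (ger0_norm t0) ler_wpM2l.
Qed.

Let ms n : measurable_fun setT (s n).
Proof.
apply: (measurableT_comp _ (measurable_tilt _ _ mhb)).
by apply: continuous_measurable_fun; exact: sqrt_continuous.
Qed.

Let inner_s n : inner P (s n) (s n) = \int[P]_x tilt P hb (rt n) x.
Proof.
by apply: eq_Rintegral => x _; rewrite -expr2 sqr_sqrtr// tilt_ge0.
Qed.

Let ss n : sqint P (s n).
Proof.
have [C [C0 /(_ n) sC]] := s_taylor.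
have H0 : 0 <= H := le_trans (normr_ge0 _) (hbH point).
have /andP[t0 t1] := @inv_sqrt_nat_bounds R n.
set t := rt n in t0 t1 sC.
apply: (@sqint_bounded _ _ _ _ _ (C + (1 + H))) => // x.
rewrite (_ : s n x = (s n x - 1 - t * (hb x / 2)) + (1 + t * (hb x / 2)));
  last by ring.
rewrite (le_trans (ler_normD _ _))// lerD//.
  by rewrite (le_trans (sC x))// ler_piMr// expr_le1.
rewrite (le_trans (ler_normD _ _))// normr1 lerD2l normrM (ger0_norm t0).
rewrite -[leRHS]mul1r ler_pM// normrM (@ger0_norm _ 2^-1)//.
have := hbH x; have := normr_ge0 (hb x); lra.
Qed.

(** Both square roots are compared with their linearisations 1 + h / (2 sqrt n) and 1 + hb / (2 sqrt
    n), which differ by (h - hb) / (2 sqrt n). *)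
Let distance_bound : exists C, 0 <= C /\ forall n, (0 < n)%N ->
  Num.sqrt n%:R * norm2 P (fun x => r n x - s n x) <=
  rho n + norm2 P (fun x => h x - hb x) / 2 + C * rt n.
Proof.
have [C [C0 sC]] := s_taylor; exists C; split => // n n0.
have zt : Num.sqrt n%:R * rt n = 1 :> R.
  by rewrite divff// gt_eqF// sqrtr_gt0 ltr0n.
have z0 : 0 <= Num.sqrt n%:R :> R by exact: sqrtr_ge0.
have t0 : 0 <= rt n :> R by rewrite invr_ge0.
have sr := sqint_sqrt_density ldQ n.
have s1 := sqint_cst P (1 : R).
have sv k (g : T -> R) : sqint P g -> sqint P (fun x => k * (g x / 2)).
  move=> sg; rewrite (_ : (fun x => _) = (fun x => k / 2 * g x)).
    exact: sqintZ.
  by apply/funext => x; field.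
have sA : sqint P (fun x => r n x - 1 - rt n * (h x / 2)).
  by apply: sqintB; [exact: sqintB|exact: sv].
have sB : sqint P (fun x => s n x - 1 - rt n * (hb x / 2)).
  by apply: sqintB; [exact: sqintB|exact: sv].
have sD : sqint P (fun x => rt n / 2 * (h x - hb x)).
  by apply: sqintZ; exact: sqintB.
rewrite (@eq_norm2 _ _ _ _ _ (fun x => ((r n x - 1 - rt n * (h x / 2)) +
  rt n / 2 * (h x - hb x)) + (-1) * (s n x - 1 - rt n * (hb x / 2)))); last first.
  by move=> x; field; rewrite gt_eqF// sqrtr_gt0 ltr0n.
apply: (le_trans (ler_wpM2l z0 (norm2D (sqintD sA sD) (sqintZ _ sB)))).
rewrite mulrDr lerD//.
  apply: (le_trans (ler_wpM2l z0 (norm2D sA sD))).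
  rewrite mulrDr lerD2l norm2Z; last exact: sqintB.
  by rewrite ger0_norm ?divr_ge0// !mulrA zt mul1r mulrC.
rewrite norm2Z// normrN1 mul1r.
suff nB : norm2 P (fun x => s n x - 1 - rt n * (hb x / 2)) <= C * rt n ^+ 2.
  apply: (le_trans (ler_wpM2l z0 nB)).
  rewrite (_ : _ * (C * _) = C * ((Num.sqrt n%:R * rt n) * rt n)); last by ring.
  by rewrite zt mul1r.
have c0 : 0 <= C * rt n ^+ 2 by rewrite mulr_ge0// exprn_ge0.
rewrite -[leRHS]ger0_norm// -(norm2_cst P).
rewrite /norm2 ler_wsqrtr//; apply: le_Rintegral => //.
- exact: sB.2.
- exact: (sqint_cst P (C * rt n ^+ 2)).2.
- by move=> x _; rewrite -real_normK ?num_real// lerXn2r ?nnegrE.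
Qed.

(** The Hellinger bound is used in both directions, with the two square roots exchanged. The leading
    [eta n] accounts for the part of [Q n] that is singular to [P]. *)
Let error_bound : exists C, 0 <= C /\ forall n (psi : n.-tuple T -> R) (lam : R),
  (0 < n)%N -> measurable_fun setT psi -> (forall x, 0 <= psi x <= 1) -> 0 < lam ->
  `|\int[power_probability (Q n) n]_x psi x -
    \int[power_probability P n]_x (psi x * tuple_prod (tilt P hb (rt n)) x)| <=
  eta n + (lam * (expR (C * rt n) - 1 + eta n + C * rt n +
      (rho n + norm2 P (fun x => h x - hb x) / 2 + C * rt n) ^+ 2) +
    lam^-1 * (4 * expR (C * rt n))) / 2.
Proof.
have [C1 [C1_ge0 dist]] := distance_bound.
have [C2 [C2_ge0 b1 _ b3]] := tilt_bounds mhb hbH hb0.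
exists (C1 + C2); split; first exact: addr_ge0.
move=> n psi lam n0 mpsi psi01 lam0.
have t01 := @inv_sqrt_nat_bounds R n.
have /andP[t0 t1] := t01.
have n00 : (n%:R : R) != 0 by rewrite pnatr_eq0 -lt0n.
have nt2 : n%:R * rt n ^+ 2 = 1 :> R by rewrite exprVn sqr_sqrtr// divff.
have nt3 : n%:R * rt n ^+ 3 = rt n :> R by rewrite exprS mulrCA nt2 mulr1.
have zz : Num.sqrt n%:R ^+ 2 = n%:R :> R by rewrite sqr_sqrtr.
have sr := sqint_sqrt_density ldQ n.
have sn := ss n.
have r0 y : 0 <= r n y by exact: sqrtr_ge0.
have s0 y : 0 <= s n y by exact: sqrtr_ge0.
have [/(_ n)[ml l0] _ _ _] := ldQ.
have rrE : (fun y => r n y * r n y) = l n.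
  by apply/funext => y; rewrite -expr2 sqr_sqrtr.
have ssE : (fun y => s n y * s n y) = tilt P hb (rt n).
  by apply/funext => y; rewrite -expr2 sqr_sqrtr// tilt_ge0.
have H1 := test_hellinger_bound sr sn r0 s0 mpsi psi01 lam0.
have H2 := test_hellinger_bound sn sr s0 r0 mpsi psi01 lam0.
rewrite -/(r n) -/(s n) rrE ssE in H1 H2.
rewrite (innerC P (s n) (r n)) in H2.
have /andP[a0 a1] := local_density_mass ldQ n.
have aE : inner P (r n) (r n) = \int[P]_x l n x := inner_sqrt_density ldQ n.
have bE := inner_s n.
set a := inner P (r n) (r n) in H1 H2 aE.
set b := inner P (s n) (s n) in H1 H2 bE.
set c := inner P (r n) (s n) in H1 H2.
have b_ge0 : 0 <= b by exact: inner_ge0.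
have c_ge0 : 0 <= c by apply: Rintegral_ge0 => x _; rewrite mulr_ge0.
rewrite -aE in a0 a1.
have etaE : eta n = n%:R * (1 - a) by rewrite aE.
have eta0 : 0 <= eta n by rewrite etaE mulr_ge0// subr_ge0.
have b3n : `|b - 1| <= C2 * rt n ^+ 3 by rewrite bE b3.
have := b3n; rewrite ler_norml => /andP[b_lo b_hi].
pose B := 1 + C2 * rt n ^+ 3.
have X0 : 0 <= C2 * rt n ^+ 3 by rewrite mulr_ge0// exprn_ge0.
have B1 : 1 <= B by rewrite lerDl.
have BE : B ^+ n <= expR ((C1 + C2) * rt n).
  apply: (@le_trans _ _ (expR (C2 * rt n ^+ 3) ^+ n)).
    by rewrite lerXn2r ?nnegrE ?expR_ge0 ?expR_ge1Dx// (le_trans _ B1).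
  rewrite -expRM_natl ler_expR mulrCA nt3 ler_wpM2r//.
  by rewrite lerDr.
have dd : norm2 P (fun x => r n x - s n x) ^+ 2 = a + b - 2 * c.
  rewrite norm2_sqr; have srs := sqintB sr sn.
  rewrite (innerBr sr sn srs) (innerBl sr sn sr) (innerBl sr sn sn).
  by rewrite (innerC P (s n) (r n)) -/a -/b -/c; ring.
have c_le : 2 * c <= a + b by rewrite -subr_ge0 -dd sqr_ge0.
have powB (z : R) : 0 <= z -> z <= B -> z ^+ n <= expR ((C1 + C2) * rt n).
  move=> z0 zB; apply: le_trans BE.
  by rewrite lerXn2r ?nnegrE// (le_trans _ zB).
have an : a ^+ n <= 1 by rewrite exprn_ile1.
have an' : a ^+ n <= expR ((C1 + C2) * rt n) by apply: powB => //; exact: le_trans B1.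
have bn : b ^+ n <= expR ((C1 + C2) * rt n).
  by apply: powB => //; rewrite /B -lerBlDl.
have cn' : c ^+ n <= expR ((C1 + C2) * rt n).
  by apply: powB => //; rewrite /B; clear H1 H2 aE bE b3n b_lo a0 t0 t1; lra.
have cn := bernoulli_ineq n c_ge0.
set D := rho n + norm2 P (fun x => h x - hb x) / 2 + (C1 + C2) * rt n.
have zd : Num.sqrt n%:R * norm2 P (fun x => r n x - s n x) <= D.
  apply: (le_trans (dist n n0)); rewrite lerD2l ler_wpM2r//.
  by rewrite lerDl.
have nd2 : n%:R * (a + b - 2 * c) <= D ^+ 2.
  rewrite -dd -zz -exprMn lerXn2r ?nnegrE ?mulr_ge0 ?norm2_ge0//.
  by apply: le_trans zd; rewrite mulr_ge0 ?norm2_ge0.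
have nb : n%:R * (1 - b) <= (C1 + C2) * rt n.
  apply: (@le_trans _ _ (n%:R * (C2 * rt n ^+ 3))).
    by rewrite ler_wpM2l//; clear H1 H2; lra.
  by rewrite mulrCA nt3 ler_wpM2r// lerDr.
have low := power_density_le ldQ mpsi psi01.
have upp := power_density_ge ldQ mpsi psi01.
rewrite -/(eta n) in upp.
set E := expR _ in an' bn cn' *.
have K1 : lam * (a ^+ n + b ^+ n - 2 * c ^+ n) <=
    lam * (E - 1 + eta n + (C1 + C2) * rt n + D ^+ 2).
  rewrite ler_wpM2l ?(ltW lam0)//.
  (* The defect of the affinity [c] consists of the two mass defects and the squared distance.
     Bernoulli's inequality turns it into a lower bound for the affinity of the products. *)
  have : 2 * (n%:R * (1 - c)) = eta n + n%:R * (1 - b) + n%:R * (a + b - 2 * c).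
    by rewrite etaE; ring.
  clear H1 H2 low upp b3n b_lo b_hi t0 t1 dd; move: (n%:R * (a + b - 2 * c)) nd2 => X nd2.
  move: (n%:R * (1 - c)) cn (n%:R * (1 - b)) nb => Y cn Z nb h2; lra.
have K2 : lam^-1 * (a ^+ n + b ^+ n + 2 * c ^+ n) <= lam^-1 * (4 * E).
  by rewrite ler_wpM2l ?invr_ge0 ?(ltW lam0)//; clear H1 H2 low upp b3n b_lo b_hi t0 t1 dd K1 nd2; lra.
rewrite (addrC (b ^+ n)) in H2.
clear an an' bn cn' cn nd2 nb c_le b_lo b_hi b3n dd a0 a1 B1 BE X0 t0 t1 nt2 nt3 zz zd.
rewrite ler_norml; apply/andP; split; lra.
Qed.

(** The rank from which the bound holds is fixed before [psi], so the estimate is uniform over all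
    tests. This is what permits it to be applied to an arbitrary sequence of tests. *)
Lemma local_asymptotic_equivalence (delta : R) :
  norm2 P (fun x => h x - hb x) < delta ->
  \forall n \near \oo, forall psi : n.-tuple T -> R,
    measurable_fun setT psi -> (forall x, 0 <= psi x <= 1) ->
    `|\int[power_probability (Q n) n]_x psi x -
      \int[power_probability P n]_x (psi x * tuple_prod (tilt P hb (rt n)) x)|
    <= delta.
Proof.
move=> hd; have delta0 : 0 < delta := le_lt_trans (norm2_ge0 _ _) hd.
have [C [C0 HC]] := error_bound.
have [_ _ eta0 rho0] := ldQ.
set N := norm2 P _ in hd HC.
(* With N the norm of h - hb, the limit of the error is (lam N^2 / 4 + 4 / lam) / 2. This choice
   makes it (N^2 / delta + delta) / 2, which is below delta since N < delta. *)
pose lam := 4 / delta.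
have lam0 : 0 < lam by rewrite divr_gt0.
pose E n := eta n + (lam * (expR (C * rt n) - 1 + eta n + C * rt n +
      (rho n + N / 2 + C * rt n) ^+ 2) + lam^-1 * (4 * expR (C * rt n))) / 2.
have Ct : C * rt n @[n --> \oo] --> (0 : R).
  rewrite -[X in _ --> X](mulr0 C); apply: cvgM; first exact: cvg_cst.
  exact: (@cvg_inv_sqrt_nat R).
have eC : expR (C * rt n) @[n --> \oo] --> (1 : R).
  rewrite -[X in _ --> X]expR0.
  by apply: (@cvg_comp _ _ _ (fun n => C * rt n) expR _ _ _ Ct); exact: continuous_expR.
have Elim : E n @[n --> \oo] --> 0 + (lam * (1 - 1 + 0 + 0 + (0 + N / 2 + 0) ^+ 2) +
   lam^-1 * (4 * 1)) / 2.
  apply: cvgD => //; apply: cvgM; last exact: cvg_cst.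
  apply: cvgD.
    apply: cvgM; first exact: cvg_cst.
    apply: cvgD.
      by apply: cvgD => //; apply: cvgD => //; apply: cvgB => //; exact: cvg_cst.
    have : rho n + N / 2 + C * rt n @[n --> \oo] --> 0 + N / 2 + 0.
      by apply: cvgD => //; apply: cvgD => //; exact: cvg_cst.
    by move=> G; under eq_fun do rewrite expr2; rewrite expr2; exact: cvgM.
  by apply: cvgM; [exact: cvg_cst|apply: cvgM => //; exact: cvg_cst].
have Elt : 0 + (lam * (1 - 1 + 0 + 0 + (0 + N / 2 + 0) ^+ 2) +
   lam^-1 * (4 * 1)) / 2 < delta.
  rewrite (_ : _ + _ = (N ^+ 2 / delta + delta) / 2); last first.
    by rewrite /lam; field; rewrite gt_eqF.
  have : N ^+ 2 / delta < delta.
    by rewrite ltr_pdivrMr// expr2 ltr_pM// norm2_ge0.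
  by lra.
have [M _ HM] := cvgr_lt _ Elim _ Elt.
exists M.+1 => // n /= Mn psi mpsi psi01.
apply: (le_trans (HC n psi lam _ mpsi psi01 lam0)); first exact: leq_trans Mn.
by rewrite ltW// (HM n)//= ltnW.
Qed.

End equivalence.

(** * Likelihood ratios along differentiable curves *)

Section density.
Context d (T : measurableType d) (R : realType).
Variables (P Q : {measure set T -> \bar R}) (l : T -> R).
Hypotheses (ml : measurable_fun setT l) (l0 : forall x, 0 <= l x)
  (lPQ : forall E, measurable E -> (\int[P]_(x in E) (l x)%:E <= Q E)%E).
Import HBNNSimple.

Let mEl : measurable_fun setT (fun x => (l x)%:E).
Proof. exact/measurable_EFinP. Qed.

Let density_le_nnsfun (h : {nnsfun T >-> R}) :
  (\int[P]_x ((h x)%:E * (l x)%:E) <= \int[Q]_x (h x)%:E)%E.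
Proof.
have mh r : measurable (h @^-1` [set r]) by [].
have h1 x : (h x)%:E =
    (\sum_(y \in range h) (y * \1_(h @^-1` [set y]) x)%:E)%E.
  by rewrite fimfunE -fsumEFin.
have mind r : measurable_fun setT (fun x => (r * \1_(h @^-1` [set r]) x)%:E).
  by apply/measurable_EFinP; exact: measurable_funM.
rewrite [leLHS](_ : _ = \int[P]_x
   (\sum_(y \in range h) ((y * \1_(h @^-1` [set y]) x)%:E * (l x)%:E)))%E; last first.
  apply: eq_integral => x _.
  by rewrite h1 ge0_mule_fsuml// => y; exact: nnfun_muleindic_ge0.
under [leRHS]eq_integral do rewrite h1.
rewrite !ge0_integral_fsum//; last 3 first.
- by move=> y x _; exact: nnfun_muleindic_ge0.
- by move=> y; apply: emeasurable_funM.
- by move=> y x _; rewrite mule_ge0// ?nnfun_muleindic_ge0// lee_fin.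
apply: lee_fsum => // r [t _ <-].
set y := h t; have y0 : 0 <= y by [].
under eq_integral do rewrite EFinM -muleA.
rewrite ge0_integralZl//; last 2 first.
- by apply: emeasurable_funM => //; exact/measurable_EFinP.
- by move=> x _; rewrite mule_ge0// lee_fin.
under [leRHS]eq_integral do rewrite EFinM.
rewrite ge0_integralZl//; last first.
  exact/measurable_EFinP.
rewrite lee_wpmul2l//.
rewrite integral_indic// setIT.
apply: le_trans (lPQ (mh y)).
rewrite [leRHS]integral_mkcond.
rewrite le_eqVlt; apply/orP; left; apply/eqP; apply: eq_integral => x _.
by rewrite epatch_indic muleC.
Qed.

(** Extension from sets to nonnegative functions through simple functions and monotone convergence.
    An inequality is the right statement, since [Q] may have a part not seen by the density. *)
Lemma density_le (F : T -> \bar R) : measurable_fun setT F ->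
  (forall x, (0 <= F x)%E) ->
  (\int[P]_x (F x * (l x)%:E) <= \int[Q]_x F x)%E.
Proof.
move=> mF F0; pose h := nnsfun_approx measurableT mF.
have nd x : nondecreasing_seq (fun n => (h n x)%:E).
  by move=> a b ab; rewrite lee_fin; exact/lefP/nd_nnsfun_approx.
have hF n x : ((h n x)%:E <= F x)%E.
  by rewrite nnsfun_approxE; apply: le_approx => //.
have Fl x : (F x * (l x)%:E)%E = limn (fun n => (h n x)%:E * (l x)%:E)%E.
  apply/esym/cvg_lim => //; apply: cvgeZr => //.
  exact: (@cvg_nnsfun_approx _ T R setT measurableT F mF (fun x _ => F0 x) x I).
under eq_integral do rewrite Fl.
rewrite monotone_convergence//; last 3 first.
- by move=> n; apply: emeasurable_funM => //; exact/measurable_EFinP.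
- by move=> n x _; rewrite mule_ge0// lee_fin.
- by move=> x _ a b ab; rewrite lee_wpmul2r ?lee_fin//; exact/lefP/nd_nnsfun_approx.
apply: lime_le.
  apply: ereal_nondecreasing_is_cvgn => a b ab; apply: ge0_le_integral => //.
  - by move=> x _; rewrite mule_ge0// lee_fin.
  - by apply: emeasurable_funM => //; exact/measurable_EFinP.
  - by apply: emeasurable_funM => //; exact/measurable_EFinP.
  - by move=> x _; rewrite lee_wpmul2r ?lee_fin//; exact/lefP/nd_nnsfun_approx.
apply: nearW => n; apply: (le_trans (density_le_nnsfun (h n))).
apply: ge0_le_integral => //.
by move=> x _; rewrite lee_fin.
exact/measurable_EFinP.
Qed.

End density.

Lemma cvg_dnbhs_comp (R : realType) (V : topologicalType) (F : R -> V)
    (t : nat -> R) (y : V) :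
  F u @[u --> 0^'] --> y -> t n @[n --> \oo] --> 0 ->
  (\forall n \near \oo, t n != 0) -> F (t n) @[n --> \oo] --> y.
Proof.
move=> Fy t0 tn0; apply: cvg_comp Fy.
move=> A /= [e e0 Ae].
have := t0 _ (nbhsx_ballx 0 e e0) => tA.
near=> n; apply: Ae => //=; last by near: n.
by near: n.
Unshelve. all: by end_near. Qed.

Lemma root_n_scaled_cvg0 (R : realType) (t : nat -> R) (b : R) :
  t n * Num.sqrt n%:R @[n --> \oo] --> b -> t n @[n --> \oo] --> 0.
Proof.
move=> tb.
have : t n * Num.sqrt n%:R * (Num.sqrt n%:R)^-1 @[n --> \oo] --> b * 0.
  by apply: cvgM => //; exact: (@cvg_inv_sqrt_nat R).
rewrite mulr0; apply: cvg_trans; apply: near_eq_cvg.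
by exists 1%N => // n /= n0; rewrite mulfK// gt_eqF// sqrtr_gt0 ltr0n.
Qed.

(** Finitely many parameters may be 0. Positivity from some rank on gives access to limits at 0 that
    exclude the point 0 itself. *)
Lemma root_n_scaled_gt0 (R : realType) (t : nat -> R) (b : R) : 0 < b ->
  t n * Num.sqrt n%:R @[n --> \oo] --> b -> \forall n \near \oo, 0 < t n.
Proof.
move=> b0 tb; apply: filterS (cvgr_gt _ tb _ b0) => n /= zn.
by rewrite ltNge; apply: contraTN zn => tn; rewrite -leNgt mulr_le0_ge0// sqrtr_ge0.
Qed.

Section curve.
Context d (T : measurableType d) (R : realType).
Implicit Types (P : probability T R) (PP : set (probability T R)).
Local Notation rt n := (Num.sqrt n%:R)^-1.

(** [fine] maps +oo to 0, which changes the ratio on a [P0]-null set only. The result is a real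
    density of the absolutely continuous part, and its missing mass is the mass of the singular
    part. *)
Lemma likelihood_ratio_fine P P0 (L : T -> \bar R) :
  is_likelihood_ratio P P0 L ->
  [/\ measurable_fun setT (fine \o L), (forall x, 0 <= (fine \o L) x),
    (forall F : T -> \bar R, measurable_fun setT F -> (forall x, 0 <= F x)%E ->
        (\int[P0]_x (F x * ((fine \o L) x)%:E) <= \int[P]_x F x)%E) &
    P [set x | L x = +oo%E] = (1 - \int[P0]_x (fine \o L) x)%:E].
Proof.
move=> [mL L0 Loo LE].
have ml : measurable_fun setT (fine \o L).
  exact: (measurableT_comp (@fine_measurable R setT measurableT) mL).
have l0 x : 0 <= (fine \o L) x by exact: fine_ge0.
have moo : measurable [set x | L x = +oo%E].
  by have := mL measurableT [set +oo%E] (emeasurable_set1 _); rewrite setTI.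
have aeL : ae_eq P0 setT L (EFin \o (fine \o L)).
  exists [set x | L x = +oo%E]; split => // x /= Lx.
  apply: contrapT => Lxoo; apply: Lx => _.
  by rewrite fineK// ge0_fin_numE// ltey; apply/eqP.
have intE E : measurable E ->
    (\int[P0]_(x in E) ((fine \o L) x)%:E = \int[P0]_(x in E) L x)%E.
  move=> mE; apply: ge0_ae_eq_integral => //.
  - by apply/measurable_EFinP; exact: measurable_funTS.
  - exact: measurable_funTS.
  - by move=> x _; rewrite lee_fin.
  - by apply: ae_eq_subset (ae_eq_sym aeL).
have leE E : measurable E -> (\int[P0]_(x in E) ((fine \o L) x)%:E <= P E)%E.
  by move=> mE; rewrite intE// (LE E mE) leeDl.
split=> //.
- by move=> F mF F0; exact: density_le.
- have := LE setT measurableT; rewrite -intE// setTI.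
  rewrite (_ : P [set: T] = 1%E); last exact: probability_setT.
  have fin : (\int[P0]_x ((fine \o L) x)%:E \is a fin_num)%E.
    rewrite ge0_fin_numE; last by apply: integral_ge0 => x _; rewrite lee_fin.
    by apply: (le_lt_trans (leE _ measurableT)); rewrite -ge0_fin_numE ?fin_num_measure.
  rewrite EFinB /Rintegral fineK// => ->.
  by rewrite addeAC subee// add0e.
Qed.

Lemma ae_eq_Lnorm2 P (F G : T -> \bar R) : measurable_fun setT F ->
  measurable_fun setT G -> ae_eq P setT F G -> 'N[P]_2%:E[F]%E = 'N[P]_2%:E[G]%E.
Proof.
move=> mF mG FG; rewrite unlock; congr (_ `^ _)%E.
have mp (H : T -> \bar R) : measurable_fun setT H ->
    measurable_fun setT (fun x => `|H x| `^ 2)%E.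
  move=> mH; apply: (measurableT_comp (measurable_poweR 2)).
  exact: measurableT_comp.
apply: ge0_ae_eq_integral => //; [exact: mp|exact: mp|..].
- by move=> x _; exact: poweR_ge0.
- by move=> x _; exact: poweR_ge0.
- by apply: filterS FG => x FG Dx; rewrite FG.
Qed.

Lemma sqint_sqrt_likelihood_ratio P P0 (L : T -> \bar R) :
  is_likelihood_ratio P P0 L -> sqint P0 (fun x => Num.sqrt (fine (L x))).
Proof.
move=> /likelihood_ratio_fine[ml l0 lP _]; split.
  apply: (measurableT_comp _ ml); apply: continuous_measurable_fun.
  exact: sqrt_continuous.
under eq_fun do rewrite sqr_sqrtr ?l0//.
apply/integrableP; split; first exact/measurable_EFinP.
have := lP (cst 1%E) (measurable_cst _) (fun=> lee01).
rewrite [leLHS](_ : _ = (\int[P0]_x `|(fine (L x))%:E|)%E); last first.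
  by apply: eq_integral => x _; rewrite mul1e /= ger0_norm// l0.
move=> /le_lt_trans; apply; rewrite integral_cst// mul1e.
by rewrite -ge0_fin_numE// fin_num_measure.
Qed.

(** The extended and the real integrand differ only where the ratio is infinite, that is, on a
    [P0]-null set. *)
Lemma Lnorm2_likelihood_ratio P P0 (L : T -> \bar R) (g : T -> R) (s : R) :
  is_likelihood_ratio P P0 L -> sqint P0 g ->
  'N[P0]_2%:E[(fun x => (2 / s)%:E * (sqrte (L x) - 1) - (g x)%:E)]%E =
  (norm2 P0 (fun x => 2 / s * (Num.sqrt (fine (L x)) - 1) - g x))%:E.
Proof.
move=> LR sg; have [ml l0 _ _] := likelihood_ratio_fine LR.
have [mL L0 Loo LE] := LR.
have mr : measurable_fun setT (fun x => Num.sqrt (fine (L x))).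
  apply: (measurableT_comp _ ml); apply: continuous_measurable_fun.
  exact: sqrt_continuous.
have mF : measurable_fun setT (fun x => 2 / s * (Num.sqrt (fine (L x)) - 1) - g x).
  apply: measurable_funB; last exact: sg.1.
  by apply: measurable_funM => //; exact: measurable_funB.
have moo : measurable [set x | L x = +oo%E].
  by have := mL measurableT [set +oo%E] (emeasurable_set1 _); rewrite setTI.
rewrite -Lnorm_norm2; last first.
  apply: sqintB => //; apply: sqintZ; apply: sqintB.
    exact: sqint_sqrt_likelihood_ratio LR.
  exact: sqint_cst.
apply: ae_eq_Lnorm2.
- apply: emeasurable_funB; last by apply/measurable_EFinP; case: sg.
  apply: emeasurable_funM => //; apply: emeasurable_funB => //.
  under eq_fun do rewrite -poweR12_sqrt//.
  exact: (measurableT_comp (measurable_poweR 2^-1) mL).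
- exact/measurable_EFinP.
- exists [set x | L x = +oo%E]; split => // x /= Lx.
  apply: contrapT => Lxoo; apply: Lx => _.
  have : L x \is a fin_num by rewrite ge0_fin_numE// ltey; apply/eqP.
  by case: (L x).
Qed.

(** Since t_n is asymptotic to b / sqrt n, passing from the scale t_n to the scale n^(-1/2)
    multiplies the tangent by b. *)
Lemma differentiable_curve_local_density PP P0 eps c g (t : nat -> R) (b : R) :
  differentiable_curve PP P0 eps c g ->
  (forall n, `|t n| < eps) -> 0 < b ->
  t n * Num.sqrt n%:R @[n --> \oo] --> b ->
  exists l, local_density P0 (fun n => c (t n)) l (fun x => b * g x).
Proof.
move=> [eps0 cP c0 /sqintP sg [L [LR Lg Lsing]]] teps b0 tb.
pose l n := fine \o L (t n).
have lr n := LR (t n) (teps n).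
have lrf n := likelihood_ratio_fine (lr n).
pose z n := t n * Num.sqrt n%:R.
have t0 : t n @[n --> \oo] --> 0 := root_n_scaled_cvg0 tb.
have tgt0 := root_n_scaled_gt0 b0 tb.
have tn0 : \forall n \near \oo, t n != 0.
  by apply: filterS tgt0 => n /gt_eqF ->.
have Lg' := cvg_dnbhs_comp Lg t0 tn0.
have Ls' := cvg_dnbhs_comp Lsing t0 tn0.
pose nn n := norm2 P0 (fun x => 2 / t n * (Num.sqrt (l n x) - 1) - g x).
have nn0 : nn n @[n --> \oo] --> 0.
  have : (nn n)%:E @[n --> \oo] --> 0%:E.
    apply: cvg_trans Lg'; apply: near_eq_cvg; apply: nearW => n.
    by rewrite (Lnorm2_likelihood_ratio _ (lr n) sg).
  by move/fine_cvgP => [].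
exists l; split.
- by move=> n; have [] := lrf n.
- by move=> n; have [] := lrf n.
- have : (t n ^- 2) * (1 - \int[P0]_x l n x) @[n --> \oo] --> 0.
    have : ((t n ^- 2) * (1 - \int[P0]_x l n x))%:E @[n --> \oo] --> 0%:E.
      apply: cvg_trans Ls'; apply: near_eq_cvg; apply: nearW => n.
      by have [_ _ _ ->] := lrf n.
    by move/fine_cvgP => [].
  move=> S0.
  have : z n * z n * ((t n ^- 2) * (1 - \int[P0]_x l n x)) @[n --> \oo] --> b * b * 0.
    by apply: cvgM => //; exact: cvgM.
  rewrite mulr0; apply: cvg_trans; apply: near_eq_cvg.
  apply: filterS tn0 => n tn; rewrite mulrA; congr (_ * _).
  rewrite /z mulrACA -!expr2 sqr_sqrtr// mulrAC divff ?mul1r//.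
  by rewrite expf_neq0.
- have sl n : sqint P0 (fun x => Num.sqrt (l n x) - 1).
    apply: sqintB; last exact: sqint_cst.
    exact: sqint_sqrt_likelihood_ratio (lr n).
  apply: (@squeeze_cvgr _ _ _ _ (fun=> 0)
    (fun n => z n / 2 * nn n + `|z n - b| / 2 * norm2 P0 g)); last 2 first.
  + exact: cvg_cst.
  + have : z n / 2 * nn n + `|z n - b| / 2 * norm2 P0 g @[n --> \oo] -->
        b / 2 * 0 + `|b - b| / 2 * norm2 P0 g.
      apply: cvgD; first by apply: cvgM => //; apply: cvgM => //; exact: cvg_cst.
      apply: cvgM; last exact: cvg_cst.
      apply: cvgM; last exact: cvg_cst.
      by apply: cvg_norm; apply: cvgB => //; exact: cvg_cst.
    by rewrite subrr normr0 mulr0 !mul0r addr0.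
  have zpos : \forall n \near \oo, 0 < z n by exact: cvgr_gt tb _ b0.
  apply: filterS2 tn0 (filterI zpos (nbhs_infty_gt 0)) => n tn [zn n0].
  rewrite mulr_ge0 ?norm2_ge0 ?sqrtr_ge0//=.
  have s0 : Num.sqrt n%:R != 0 :> R by rewrite gt_eqF// sqrtr_gt0 ltr0n.
  have sA : sqint P0 (fun x => 2 / t n * (Num.sqrt (l n x) - 1) - g x).
    by apply: sqintB => //; exact: sqintZ.
  rewrite -[X in X * _ <= _]ger0_norm ?sqrtr_ge0// -norm2Z; last first.
    apply: sqintB => //.
    rewrite (_ : (fun x => _) = (fun x => rt n * b / 2 * g x)); first exact: sqintZ.
    by apply/funext => x; field.
  (* The remainder of the curve, rescaled, plus the error of replacing t_n sqrt n by its limit. *)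
  rewrite (@eq_norm2 _ _ _ _ _ (fun x => z n / 2 *
    (2 / t n * (Num.sqrt (l n x) - 1) - g x) + (z n - b) / 2 * g x)); last first.
    by move=> x; rewrite /z; field; rewrite tn s0.
  apply: (le_trans (norm2D (sqintZ _ sA) (sqintZ _ sg))).
  rewrite !norm2Z// lerD//.
    by rewrite ger0_norm// divr_ge0// ltW.
  by rewrite normrM (@ger0_norm _ 2^-1).
Qed.

End curve.

Section curve_sequences.
Context d (T : measurableType d) (R : realType).
Variables (PP : set (probability T R)) (P0 : probability T R).
Local Notation rt n := (Num.sqrt n%:R)^-1.

Definition local_sequence Q h : Prop :=
  [/\ curve_sequences PP P0 Q, exists l, local_density P0 Q l h &
    forall k dk, is_gradient PP P0 k dk ->
      Num.sqrt n%:R * (k (Q n) - k P0) @[n --> \oo] --> inner P0 dk h].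

Let differentiable_curve_local_sequence eps c g (t : nat -> R) (b : R) :
  differentiable_curve PP P0 eps c g ->
  (forall n, 0 <= t n) -> (forall n, t n < eps) -> 0 < b ->
  t n * Num.sqrt n%:R @[n --> \oo] --> b ->
  local_sequence (fun n => c (t n)) (fun x => b * g x).
Proof.
move=> dc t_ge0 t_lt b0 tb; split.
- exists t; split => //; first by exists b.
  by exists eps, c, g.
- apply: differentiable_curve_local_density dc _ b0 tb => n.
  by rewrite ger0_norm.
move=> k dk [dk2 _ /(_ _ _ _ dc) gk].
have t0 := root_n_scaled_cvg0 tb.
have tgt0 := root_n_scaled_gt0 b0 tb.
have gk' : (t n)^-1 * (k (c (t n)) - k P0) @[n --> \oo] --> inner P0 dk g.
  apply: (@cvg_comp _ _ _ t (fun u => u^-1 * (k (c u) - k P0)) _ _ _ _ gk).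
  move=> A /= [e e0 Ae].
  have tA : \forall n \near \oo, ball 0 e (t n) := t0 _ (nbhsx_ballx 0 e e0).
  by apply: filterS2 tA tgt0 => n tn tn0; exact: (Ae (t n) tn tn0).
have sdk : sqint P0 dk by apply/sqintP.
have sg : sqint P0 g by have [_ _ _ /sqintP] := dc.
rewrite innerZr//.
have : t n * Num.sqrt n%:R * ((t n)^-1 * (k (c (t n)) - k P0)) @[n --> \oo] -->
    b * inner P0 dk g by exact: cvgM.
apply: cvg_trans; apply: near_eq_cvg.
apply: filterS tgt0 => n tn.
by rewrite mulrACA mulrA divff ?mul1r// gt_eqF.
Qed.

Lemma curve_sequences_local Q : curve_sequences PP P0 Q ->
  exists b g, [/\ 0 < b, tangents PP P0 g & local_sequence Q (fun x => b * g x)].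
Proof.
move=> [t [t0 [b b0 tb] [eps [c [g [dc tc]]]]]].
exists b, g; split => //; first by exists eps, c.
rewrite (_ : Q = fun n => c (t n)); last first.
  by apply/funext => n; have [_ ->] := tc n.
apply: (differentiable_curve_local_sequence dc) => // n.
by have [] := tc n.
Qed.

Lemma tangents_local g : tangents PP P0 g -> exists Q, local_sequence Q g.
Proof.
move=> [eps [c dc]]; have [eps0 _ _ _ _] := dc.
(* The minimum keeps the parameter inside the domain of the curve for small [n]; from some rank on
   it equals n^(-1/2), so the limit of t_n sqrt n is 1 and the tangent is not rescaled. *)
pose t n : R := Num.min (rt n) (eps / 2).
have rt0 := @cvg_inv_sqrt_nat R.
have e2 : 0 < eps / 2 by rewrite divr_gt0.
have t1 : t n * Num.sqrt n%:R @[n --> \oo] --> (1 : R).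
  have rlt : \forall n \near \oo, rt n < eps / 2 := cvgr_lt _ rt0 _ e2.
  apply/cvgrPdist_le => e e0; have [N _ HN] := rlt.
  exists N.+1 => // n /= Nn; have rn := HN n (ltnW Nn).
  have n0 : (0 < n)%N by exact: leq_trans Nn.
  rewrite (_ : t n * _ = 1) ?subrr ?normr0 ?ltW//.
  by rewrite /t min_l ?(ltW rn)// mulVf// gt_eqF// sqrtr_gt0 ltr0n.
exists (fun n => c (t n)).
rewrite (_ : g = fun x => 1 * g x); last by apply/funext => x; rewrite mul1r.
apply: (differentiable_curve_local_sequence dc) => // n.
  by rewrite le_min invr_ge0 sqrtr_ge0 ltW.
by rewrite gt_min; apply/orP; right; lra.
Qed.

End curve_sequences.

(** * Optimality of the two-sided test *)

Section chord.
Context {R : realType}.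
Implicit Types a c z : R.

(** The affine function of [z] that agrees with exp(a z) at -c and at c. *)
Definition exp_chord c a z : R :=
  (expR (a * c) + expR (- (a * c))) / 2 +
  (expR (a * c) - expR (- (a * c))) / (2 * c) * z.

Lemma expR_convex (x y t : R) : 0 <= t <= 1 ->
  expR (t * x + (1 - t) * y) <= t * expR x + (1 - t) * expR y.
Proof.
move=> /andP[t0 t1]; set p := t * x + (1 - t) * y.
have tangent w : expR p * (1 + (w - p)) <= expR w.
  have -> : expR w = expR (w - p) * expR p by rewrite -expRD subrK.
  by rewrite mulrC ler_wpM2r ?expR_ge0 ?expR_ge1Dx.
have h1 := ler_wpM2l t0 (tangent x).
have t1' : 0 <= 1 - t by rewrite subr_ge0.
have h2 := ler_wpM2l t1' (tangent y).
apply: le_trans (lerD h1 h2).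
rewrite (_ : _ + _ = expR p * (1 + (t * x + (1 - t) * y - p))); last by ring.
by rewrite subrr addr0 mulr1.
Qed.

Lemma expR_le_chord c a z : 0 < c -> `|z| <= c ->
  expR (a * z) <= exp_chord c a z.
Proof.
move=> c0; rewrite ler_norml => /andP[z1 z2].
have t01 : 0 <= (z + c) / (2 * c) <= 1.
  by rewrite divr_ge0 ?ler_pdivrMr ?mulr_gt0//; lra.
have := expR_convex (a * c) (- (a * c)) t01.
rewrite (_ : _ / _ * _ + _ = a * z); last by field; rewrite gt_eqF.
move=> /le_trans; apply; rewrite le_eqVlt; apply/orP; left; apply/eqP.
by rewrite /exp_chord; field; rewrite gt_eqF.
Qed.

(** For z > c the point c is a convex combination of z and -c, so convexity places exp(a z) above
    the prolonged chord. The other side follows by changing the signs of [a] and [z]. *)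
Lemma expR_ge_chord c a z : 0 < c -> c < `|z| ->
  exp_chord c a z <= expR (a * z).
Proof.
move=> c0; wlog z0 : a z / 0 <= z => [H|].
  have [z0|z0] := leP 0 z; first exact: H.
  move=> cz; have := H (- a) (- z); rewrite normrN mulrNN oppr_ge0 (ltW z0).
  move=> /(_ isT cz); apply: le_trans.
  by rewrite /exp_chord mulNr opprK le_eqVlt; apply/orP; left; apply/eqP; ring.
rewrite ger0_norm// => cz.
have zc : 0 < z + c by lra.
have t01 : 0 <= 2 * c / (z + c) <= 1.
  by rewrite divr_ge0 ?ler_pdivrMr ?mulr_ge0//; lra.
have := expR_convex (a * z) (- (a * c)) t01.
rewrite (_ : _ / _ * _ + _ = a * c); last by field; rewrite gt_eqF.
set u := expR (a * c); set w := expR (- (a * c)); set v := expR (a * z) => H.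
have := ler_wpM2l (ltW (divr_gt0 zc (mulr_gt0 (ltr0n R 2) c0))) H.
rewrite (_ : _ * (_ + _) = v + (z - c) / (2 * c) * w); last first.
  by field; rewrite !gt_eqF.
move=> H2; rewrite -lerBlDr in H2; apply: le_trans H2.
rewrite le_eqVlt; apply/orP; left; apply/eqP.
by rewrite /exp_chord -/u -/w; field; rewrite gt_eqF.
Qed.

End chord.

(** A lower bound linear in [x] for the denominator of [np_coef1], whose blow-up as [kap] tends to 0
    has to be controlled. *)
Lemma normr_le_expR_diff {R : realType} (x : R) : `|x| <= `|expR x - expR (- x)|.
Proof.
wlog x0 : x / 0 <= x => [H|].
  have [|x0] := leP 0 x; first exact: H.
  by have := H (- x); rewrite normrN opprK distrC oppr_ge0 (ltW x0); apply.
rewrite ger0_norm// (le_trans _ (ler_norm _))// lerBrDr.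
rewrite -lerBrDr (le_trans _ (lerB (expR_ge1Dx x) (lexx _)))//.
have : expR (- x) <= 1 by rewrite -expR0 ler_expR oppr_le0.
by lra.
Qed.

Section neyman_pearson.
Context {R : realType}.
Variables (c a kap Ka K1 : R).
Hypotheses (c0 : 0 < c) (a0 : a != 0) (kap0 : 0 < kap).

(* The two constants are determined by np_gap c = np_gap (- c) = 0. *)
Definition np_coef1 : R := expR (K1 - Ka) *
  ((expR (a * c) - expR (- (a * c))) /
   (expR (kap * a * c) - expR (- (kap * a * c)))).

Definition np_coef0 : R :=
  expR (- Ka) * ((expR (a * c) + expR (- (a * c))) / 2) +
  np_coef1 * expR (- K1) * ((expR (kap * a * c) + expR (- (kap * a * c))) / 2).

Lemma expR_diff_neq0 (x : R) : x != 0 -> expR x - expR (- x) != 0.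
Proof.
move=> x0; rewrite subr_eq0; apply: contra_neq x0 => /expR_inj.
by lra.
Qed.

(** Numerator and denominator both have the sign of [a]. *)
Lemma np_coef1_ge0 : 0 <= np_coef1.
Proof.
rewrite mulr_ge0 ?expR_ge0//.
have [ap|an] := ltP 0 a.
  have kac : 0 <= kap * a * c by rewrite !mulr_ge0// ltW.
  have ac : 0 <= a * c by rewrite mulr_ge0// ltW.
  by rewrite divr_ge0// subr_ge0 ler_expR; lra.
have kac : kap * a * c <= 0 by rewrite -mulrA mulr_ge0_le0 ?(ltW kap0)// mulr_le0_ge0// ltW.
have ac : a * c <= 0 by rewrite mulr_le0_ge0// ltW.
rewrite -mulrNN -invrN mulr_ge0 ?invr_ge0// oppr_ge0 subr_le0 ler_expR; lra.
Qed.

(** The denominator of [np_coef1] is at least kap |a c| in absolute value, and [K1 <= Ka] bounds the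
    exponential prefactor by 1. The right-hand side does not depend on [kap]. *)
Lemma np_coef1_le : K1 <= Ka ->
  np_coef1 * kap <= `|expR (a * c) - expR (- (a * c))| / `|a * c|.
Proof.
move=> K1Ka; have ac : a * c != 0 by rewrite mulf_neq0// gt_eqF.
have kac : kap * a * c != 0 by rewrite -mulrA mulf_neq0// gt_eqF.
have scale (D E x : R) : 0 <= D -> 0 < x -> kap * x <= E -> D / E * kap <= D / x.
  move=> D0 x0 xE; have E0 : 0 < E by rewrite (lt_le_trans _ xE)// mulr_gt0.
  by rewrite -mulrA ler_wpM2l// mulrC ler_pdivrMr// mulrC ler_pdivlMr.
have exp_le1 : expR (K1 - Ka) <= 1 by rewrite -expR0 ler_expR subr_le0.
rewrite -[np_coef1]ger0_norm ?np_coef1_ge0// /np_coef1 normrM.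
rewrite [`|expR (_ - _)|]gtr0_norm ?expR_gt0// normf_div -[leLHS]mulrA.
apply: (@le_trans _ _ (`|expR (a * c) - expR (- (a * c))| /
    `|expR (kap * a * c) - expR (- (kap * a * c))| * kap)).
  by rewrite ler_piMl// mulr_ge0 ?(ltW kap0)// divr_ge0.
apply: scale; rewrite ?normr_ge0 ?normr_gt0//.
rewrite -{1}(gtr0_norm kap0) -normrM mulrA; exact: normr_le_expR_diff.
Qed.

Lemma np_coef0_ge0 : 0 <= np_coef0.
Proof.
apply: addr_ge0; apply: mulr_ge0; rewrite ?expR_ge0 ?divr_ge0 ?addr_ge0 ?expR_ge0//.
by apply: mulr_ge0; [exact: np_coef1_ge0|exact: expR_ge0].
Qed.

(** The weighted sum of the three densities divided by the density at the hypothesis, with [z] the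
    normalised sum of the direction of the shift and [Ka], [K1] the constants in the exponents. *)
Definition np_gap z : R :=
  expR (a * z - Ka) + np_coef1 * expR (- (kap * a) * z - K1) - np_coef0.

(** [np_coef1] makes the slopes of the two chords cancel and [np_coef0] then cancels their
    constants. What remains is a nonnegative combination of exponentials minus their chords, so its
    sign follows from convexity. *)
Let np_gapE z : np_gap z =
  expR (- Ka) * (expR (a * z) - exp_chord c a z) +
  np_coef1 * expR (- K1) * (expR (- (kap * a) * z) - exp_chord c (- (kap * a)) z).
Proof.
have cn : c != 0 by rewrite gt_eqF.
have kn : kap != 0 by rewrite gt_eqF.
have kac : kap * a * c != 0 by rewrite !mulf_neq0.
rewrite /np_gap /np_coef0 /exp_chord !expRD.
have h1 : np_coef1 * expR (- K1) * (expR (kap * a * c) - expR (- (kap * a * c))) =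
    expR (- Ka) * (expR (a * c) - expR (- (a * c))).
  rewrite /np_coef1 expRD [expR (- K1)]expRN.
  by field; rewrite expR_diff_neq0//= gt_eqF// expR_gt0.
rewrite !mulNr opprK.
apply/eqP; rewrite -subr_eq0; apply/eqP.
transitivity ((expR (- Ka) * (expR (a * c) - expR (- (a * c))) -
  np_coef1 * expR (- K1) * (expR (kap * a * c) - expR (- (kap * a * c)))) / (2 * c) * z).
  by field; rewrite gt_eqF.
by rewrite h1 subrr !mul0r.
Qed.

Let coef1_mul_ge0 : 0 <= np_coef1 * expR (- K1).
Proof. by apply: mulr_ge0; [exact: np_coef1_ge0|exact: expR_ge0]. Qed.

Lemma np_gap_le0 z : `|z| <= c -> np_gap z <= 0.
Proof.
move=> zc; rewrite np_gapE -[leRHS]addr0 lerD//.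
  by rewrite mulr_ge0_le0 ?expR_ge0// subr_le0 expR_le_chord.
by rewrite mulr_ge0_le0// subr_le0 expR_le_chord.
Qed.

Lemma np_gap_ge0 z : c < `|z| -> 0 <= np_gap z.
Proof.
move=> zc; rewrite np_gapE addr_ge0//.
  by rewrite mulr_ge0 ?expR_ge0// subr_ge0 expR_ge_chord.
by rewrite mulr_ge0// subr_ge0 expR_ge_chord.
Qed.

Lemma np_optimal z (p : R) : 0 <= p <= 1 ->
  (p - (if c < `|z| then 1 else 0)) * np_gap z <= 0.
Proof.
move=> /andP[p0 p1]; case: ltP => cz.
  by rewrite mulr_le0_ge0 ?np_gap_ge0// subr_le0.
by rewrite subr0 mulr_ge0_le0// np_gap_le0.
Qed.

End neyman_pearson.

Section two_sided_power.
Context {R : realType}.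
Implicit Types s c m : R.

(* The probability of [-c, c]^c under N(m, s^2). *)
Definition two_sided_power s c m : R := Phi ((m - c) / s) + Phi ((- m - c) / s).

(** By evenness m >= 0 may be assumed. There the derivative is the difference of [phi] at (m - c) /
    s and at (m + c) / s, divided by s, and it is nonnegative because |m - c| <= m + c. *)
Lemma two_sided_power_ge s c m : 0 < s -> 0 <= c ->
  two_sided_power s c 0 <= two_sided_power s c m.
Proof.
move=> s0 c0; wlog m0 : m / 0 <= m => [H|].
  have [m0|m0] := leP 0 m; first exact: H.
  have := H (- m); rewrite oppr_ge0 (ltW m0) => /(_ isT) /le_trans; apply.
  by rewrite /two_sided_power opprK addrC.
pose g z := Phi ((z - c) / s) + Phi ((- z - c) / s).
pose dg z := phi ((z - c) / s) / s - phi ((- z - c) / s) / s.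
have dPhi (e : R) z : is_derive z (1 : R) (fun z => Phi ((e * z - c) / s))
    (phi ((e * z - c) / s) * (e / s)).
  have dl : is_derive z (1 : R) (fun z => (e * z - c) / s) (e / s).
    by apply: is_derive_eq; rewrite /GRing.scale/=; field; rewrite gt_eqF.
  exact: (@is_derive1_comp _ Phi (fun z => (e * z - c) / s) z _ _ (is_derive_Phi _) dl).
have dgE z : is_derive z (1 : R) g (dg z).
  have h1 := dPhi 1 z; have h2 := dPhi (-1) z.
  have -> : g = fun z => Phi ((1 * z - c) / s) + Phi ((-1 * z - c) / s).
    by apply/funext => y; rewrite mul1r mulN1r.
  by apply: is_derive_eq; rewrite /dg mul1r mulN1r; field; rewrite gt_eqF.
have cg := is_derive_continuous dgE.
have [|z zm E] := @MVT_segment _ g dg 0 m m0 (fun z _ => dgE z).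
  exact: continuous_subspaceT.
rewrite -subr_ge0 -[X in X - _]/(g m) -[X in _ - X]/(two_sided_power s c 0).
have -> : two_sided_power s c 0 = g 0 by [].
rewrite E mulr_ge0 ?subr_ge0// ler_wpM2r ?invr_ge0 ?(ltW s0)//.
rewrite !phiE ler_wpM2l ?normal_peak_ge0// ler_expR lerN2.
rewrite ler_wpM2r// !expr_div_n ler_wpM2r ?invr_ge0 ?sqr_ge0//.
have z0 : 0 <= z by rewrite (itvP zm).
have zc := mulr_ge0 z0 c0.
by rewrite -subr_ge0 (_ : _ - _ = 4 * (z * c)); [rewrite mulr_ge0|ring].
Qed.

(** The linear terms of the two tails cancel by symmetry, and each tail contributes a quadratic
    error with constant 24. *)
Lemma two_sided_power_taylor s c m : 0 < s ->
  two_sided_power s c m <= two_sided_power s c 0 + 48 * (m / s) ^+ 2.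
Proof.
move=> s0; have H1 := Phi_taylor1 (- c / s) (m / s).
have H2 := Phi_taylor1 (- c / s) (- m / s).
rewrite (_ : - c / s + m / s = (m - c) / s) in H1; last by ring.
rewrite (_ : - c / s + - m / s = (- m - c) / s) in H2; last by ring.
have e2 : - m / s = - (m / s) by rewrite mulNr.
rewrite e2 sqrrN mulrN in H2.
rewrite /two_sided_power oppr0 sub0r.
have := le_trans (ler_norm _) H1; have := le_trans (ler_norm _) H2.
by set A := phi _ * _; set B := (m / s) ^+ 2; lra.
Qed.

Lemma two_sided_power_cvg (s c m : nat -> R) (s' c' m' : R) : s' != 0 ->
  s n @[n --> \oo] --> s' -> c n @[n --> \oo] --> c' ->
  m n @[n --> \oo] --> m' ->
  two_sided_power (s n) (c n) (m n) @[n --> \oo] --> two_sided_power s' c' m'.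
Proof.
move=> s0 ss cc mm; apply: cvgD; apply: continuous_cvg; try exact: continuous_Phi.
  by apply: cvgM; [exact: cvgB|exact: cvgV].
by apply: cvgM; [apply: cvgB => //; exact: cvgN|exact: cvgV].
Qed.

End two_sided_power.

Section two_sided_test.
Context d (T : measurableType d) (R : realType) (P : probability T R).
Local Notation rt n := (Num.sqrt n%:R)^-1.

Definition two_sided (f : T -> R) (c : R) n : n.-tuple T -> R :=
  \1_[set x | c < `|rt n * tuple_sum f x|].

Lemma measurable_two_sided f c n : measurable_fun setT f ->
  measurable_fun setT (@two_sided f c n).
Proof.
move=> mf; apply: measurable_indic; apply: measurable_superlevel.
apply: measurableT_comp => //; apply: measurable_funM => //.
exact: measurable_tuple_sum.
Qed.

Lemma two_sided01 f c n (x : n.-tuple T) : 0 <= two_sided f c x <= 1.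
Proof. by rewrite /two_sided indicE; case: (_ \in _); rewrite !lexx ler01. Qed.

Lemma two_sidedE f c n (x : n.-tuple T) :
  two_sided f c x = if c < `|rt n * tuple_sum f x| then 1 else 0.
Proof.
rewrite /two_sided indicE; case: ifP => cx; first by rewrite mem_set.
by rewrite memNset//= cx.
Qed.

Variables (f : T -> R) (c : R).
Hypotheses (sf : sqint P f) (f0 : \int[P]_x f x = 0) (c0 : 0 <= c)
  (f_gt0 : 0 < inner P f f).

(** For c >= 0 the rejection region is the disjoint union of two one-sided ones; the lower one is
    the upper one for -f. *)
Lemma two_sided_clt (h : T -> R) (H : R) : measurable_fun setT h ->
  (forall x, `|h x| <= H) -> \int[P]_x h x = 0 ->
  \int[power_probability P n]_x
    (two_sided f c x * tuple_prod (tilt P h (rt n)) x) @[n --> \oo] -->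
  two_sided_power (norm2 P f) c (inner P f h).
Proof.
move=> mh hH h0; have [C massC] := tilt_mass_bound mh hH h0.
pose fN x := -1 * f x.
have sfN : sqint P fN by exact: sqintZ.
have fN0 : \int[P]_x fN x = 0.
  by rewrite RintegralZl ?f0 ?mulr0//; exact: sqint_integrable.
have fNfN : inner P fN fN = inner P f f.
  by rewrite (innerZl _ sf sfN) (innerZr _ sf sf); ring.
have fNh : inner P fN h = - inner P f h.
  by rewrite (innerZl _ sf) ?mulN1r//; exact: (@sqint_bounded _ _ _ _ _ H).
have G := tilted_clt sf f0 mh hH h0 (c := c) f_gt0.
have := tilted_clt sfN fN0 mh hH h0 (c := c); rewrite fNfN fNh => /(_ f_gt0) GN.
rewrite -norm2E in G GN.
rewrite /two_sided_power; apply: cvg_trans (cvgD G GN).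
apply: near_eq_cvg; apply: nearW => n.
pose I (g : T -> R) : n.-tuple T -> R := \1_[set x | c < rt n * tuple_sum g x].
have mI g : measurable_fun setT g -> measurable_fun setT (I g).
  move=> mg; apply: measurable_indic; apply: measurable_superlevel.
  by apply: measurable_funM => //; exact: measurable_tuple_sum.
have I1 g x : `|I g x| <= 1.
  by rewrite /I indicE; case: (_ \in _); rewrite ?normr1 ?normr0.
have i1 := (massC n (I f) 1 (mI f sf.1) (I1 f)).1.
have i2 := (massC n (I fN) 1 (mI fN sfN.1) (I1 fN)).1.
rewrite fctE -RintegralD//; apply: eq_Rintegral => x _.
rewrite -mulrDl; congr (_ * _).
rewrite two_sidedE !indicE.
have sN : tuple_sum fN x = - tuple_sum f x.
  by rewrite /tuple_sum -sumrN; apply: eq_bigr => i _; rewrite /fN mulN1r.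
have mE g : (x \in [set x : n.-tuple T | c < rt n * tuple_sum g x]) = (c < rt n * tuple_sum g x).
  by apply/idP/idP; rewrite inE.
rewrite !mE sN mulrN ltrNr.
move: (rt n * tuple_sum f x) => z.
case: (ltP c z) => cz; case: (ltP z (- c)) => zc/=.
- by exfalso; have := c0; lra.
- by rewrite gtr0_norm ?cz ?addr0// (le_lt_trans c0).
- rewrite ltr0_norm; first by rewrite ltrNr zc add0r.
  by rewrite (lt_le_trans zc)// oppr_le0.
- by rewrite addr0 ltNge ler_norml zc cz.
Qed.

(** The tangent is approximated by bounded centered functions, the equivalence with their tilts
    costs [del j] uniformly in large [n], and the limiting power depends continuously on the inner
    product. *)
Lemma two_sided_local_power Q l h : local_density P Q l h -> sqint P h ->
  \int[power_probability (Q n) n]_x two_sided f c x @[n --> \oo] -->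
  two_sided_power (norm2 P f) c (inner P f h).
Proof.
move=> ldQ sh; have h0 := local_density_mean0 ldQ sh.
pose del (j : nat) : R := j.+1%:R^-1.
have del_gt0 j : 0 < del j by rewrite invr_gt0.
have del0 : del j @[j --> \oo] --> 0 by exact: cvg_harmonic.
have ex j := bounded_centered_approx sh h0 (del_gt0 j).
have [hb exb] := choice ex.
have [H {}exb] := choice exb.
have shb j : sqint P (hb j).
  by have [mb bH _ _] := exb j; exact: (@sqint_bounded _ _ _ _ _ (H j)).
pose I j n := \int[power_probability P n]_x
    (two_sided f c x * tuple_prod (tilt P (hb j) (rt n)) x).
have inn : inner P f (hb j) @[j --> \oo] --> inner P f h.
  apply/cvgrPdist_le => e e0.
  have n0 : 0 < norm2 P f by rewrite norm2E sqrtr_gt0.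
  have [N _ HN] := cvgr_lt _ del0 _ (divr_gt0 e0 n0).
  exists N => // j /= /HN /= jN.
  rewrite -(innerBr sh (shb j) sf).
  apply: (le_trans (cauchy_schwarz sf (sqintB sh (shb j)))).
  have [_ _ _ hj] := exb j.
  by rewrite mulrC -ler_pdivlMr// (le_trans (ltW hj))// ltW.
have n0 : norm2 P f != 0 by rewrite gt_eqF// norm2E sqrtr_gt0.
have bI j : I j n @[n --> \oo] --> two_sided_power (norm2 P f) c (inner P f (hb j)).
  by have [mb bH b0 _] := exb j; exact: two_sided_clt mb bH b0.
have bb : two_sided_power (norm2 P f) c (inner P f (hb j)) @[j --> \oo] -->
    two_sided_power (norm2 P f) c (inner P f h).
  by apply: (@two_sided_power_cvg _ (fun=> norm2 P f) (fun=> c)) => //; exact: cvg_cst.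
apply: (@cvg_squeeze_family _ _ _ (fun j n => I j n + del j) (fun j n => I j n - del j)
  (fun j => two_sided_power (norm2 P f) c (inner P f (hb j)) + del j)
  (fun j => two_sided_power (norm2 P f) c (inner P f (hb j)) - del j)).
- move=> j; have [mb bH b0 hj] := exb j.
  have [N _ HN] := local_asymptotic_equivalence ldQ sh mb bH b0 hj.
  exists N => // n /HN /(_ (@two_sided f c n) (@measurable_two_sided f c n sf.1)
    (@two_sided01 f c n)).
  by rewrite ler_norml -/(I j n) => /andP[h1 h2]; apply/andP; split; lra.
- by move=> j; apply: cvgD; [exact: bI|exact: cvg_cst].
- by rewrite -[X in _ --> X]addr0; apply: cvgD; [exact: bb|exact: del0].
- by move=> j; apply: cvgB; [exact: bI|exact: cvg_cst].
- by rewrite -[X in _ --> X]subr0; apply: cvgB; [exact: bb|exact: del0].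
Qed.

End two_sided_test.

Lemma ler_normr_distC (R : realDomainType) (x y : R) : y - x <= `|x - y|.
Proof. by rewrite distrC ler_norm. Qed.

(** The arithmetic of [optimality_step]. [A], [M1], [M0] stand for the powers of the test under the
    three local sequences, [Ia], [I1], [I0] for its means under the corresponding tilts, and [Fa],
    [F1], [F0] for the means of the two-sided test. *)
Lemma combine_bounds (R : realType) (k1 k0 D D0 D1 A Ia I1 I0 Fa F1 F0 M1 M0 X : R) :
  0 <= k1 -> 0 <= k0 -> A - Ia <= D -> I0 - M0 <= D0 -> M1 - I1 <= D1 ->
  Ia + k1 * I1 - k0 * I0 <= Fa + k1 * F1 - k0 * F0 ->
  Fa + k1 * F1 - k0 * F0 - k1 * M1 + k0 * M0 < X ->
  A <= X + (D + k1 * D1 + k0 * D0).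
Proof.
move=> k1_ge0 k0_ge0 hA /(ler_wpM2l k0_ge0) h0 /(ler_wpM2l k1_ge0) h1 hI hX.
by lra.
Qed.

(** * The weighted Neyman-Pearson inequality under tilts *)

Section optimality.
Context d (T : measurableType d) (R : realType) (P : probability T R).
Local Notation rt n := (Num.sqrt n%:R)^-1.

Definition bounded_centered (g : T -> R) : Prop :=
  [/\ measurable_fun setT g, exists H, forall x, `|g x| <= H &
      \int[P]_x g x = 0].

Lemma bounded_centered_sqint g : bounded_centered g -> sqint P g.
Proof. by move=> [mg [H gH] _]; exact: (@sqint_bounded _ _ _ _ _ H). Qed.

Lemma bounded_centeredD s (g b : T -> R) : bounded_centered g ->
  bounded_centered b -> bounded_centered (fun x => g x + s * b x).
Proof.
move=> bg bb; have sg := bounded_centered_sqint bg.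
have sb := bounded_centered_sqint bb.
move: bg bb => [mg [H gH] g0] [mb [B bB] b0]; split.
- by apply: measurable_funD => //; exact: measurable_funM.
- exists (H + `|s| * B) => x; rewrite (le_trans (ler_normD _ _))// lerD//.
  by rewrite normrM ler_wpM2l.
- rewrite RintegralD//; [|exact: sqint_integrable|].
    by rewrite g0 RintegralZl ?b0 ?mulr0 ?addr0//; exact: sqint_integrable.
  by apply: (sqint_integrable (sqintZ s sb)).
Qed.

Definition power_mean (psi : forall n, n.-tuple T -> R)
  (Q : nat -> probability T R) n : R :=
  \int[power_probability (Q n) n]_x psi n x.

Definition tilted_mean n (psi : n.-tuple T -> R) (g : T -> R) : R :=
  \int[power_probability P n]_x (psi x * tuple_prod (tilt P g (rt n)) x).

Lemma integrable_tilted_mean n (psi : n.-tuple T -> R) g : bounded_centered g ->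
  measurable_fun setT psi -> (forall x, 0 <= psi x <= 1) ->
  (power_probability P n).-integrable setT
    (EFin \o (fun x => psi x * tuple_prod (tilt P g (rt n)) x)).
Proof.
move=> [mg [H gH] g0] mpsi psi01; have [C massC] := tilt_mass_bound mg gH g0.
apply: (massC n psi 1 mpsi _).1 => x.
by have /andP[p0 p1] := psi01 x; rewrite ger0_norm.
Qed.

Section neyman_pearson.
Variables (b g : T -> R) (c a kap : R).
Hypotheses (bb : bounded_centered b) (bg : bounded_centered g)
  (c0 : 0 < c) (a0 : a != 0) (kap0 : 0 < kap).

Let sb := bounded_centered_sqint bb.
Let sg := bounded_centered_sqint bg.

(** Half the increase of the squared norm from [g] to [g + s b], which is the change of the constant
    in the exponent of the tilt. *)
Definition exp_const s : R := s * inner P g b + s ^+ 2 * inner P b b / 2.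

Let shift s := fun x => g x + s * b x.

Lemma tuple_prod_tilt_shift s n (x : n.-tuple T) : (0 < n)%N ->
  tuple_prod (tilt P (shift s) (rt n)) x =
  tuple_prod (tilt P g (rt n)) x *
  expR (s * (rt n * tuple_sum b x) - exp_const s).
Proof.
move=> n0; rewrite !tuple_prod_tilt// -expRD; congr expR.
have sh : sqint P (shift s) by apply: sqintD => //; exact: sqintZ.
have ssb : sqint P (fun x => s * b x) by exact: sqintZ.
have -> : inner P (shift s) (shift s) = inner P g g + 2 * exp_const s.
  rewrite /exp_const (innerDl sg ssb sh) (innerZl s sb sh).
  rewrite (innerDr sg ssb sg) (innerDr sg ssb sb) (innerZr s sb sg) (innerZr s sb sb).
  by rewrite (innerC P b g); field.
have -> : tuple_sum (shift s) x = tuple_sum g x + s * tuple_sum b x.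
  by rewrite /tuple_sum big_split mulr_sumr.
by field; rewrite gt_eqF// sqrtr_gt0 ltr0n.
Qed.

Let c1 := np_coef1 c a kap (exp_const a) (exp_const (- (kap * a))).
Let c_0 := np_coef0 c a kap (exp_const a) (exp_const (- (kap * a))).

(** All three tilts have a density with respect to the one at [g] that depends on the normalised sum
    of [b] only, so [np_optimal] can be integrated against the tilt at [g]. *)
Lemma np_weighted n (psi : n.-tuple T -> R) : (0 < n)%N ->
  measurable_fun setT psi -> (forall x, 0 <= psi x <= 1) ->
  tilted_mean psi (shift a) + c1 * tilted_mean psi (shift (- (kap * a)))
    - c_0 * tilted_mean psi g <=
  tilted_mean (@two_sided _ T R b c n) (shift a) +
    c1 * tilted_mean (@two_sided _ T R b c n) (shift (- (kap * a)))
    - c_0 * tilted_mean (@two_sided _ T R b c n) g.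
Proof.
move=> n0 mpsi psi01.
pose ph := @two_sided _ T R b c n.
have mph : measurable_fun setT ph by apply: measurable_two_sided; case: bb.
have ph01 x : 0 <= ph x <= 1 by exact: two_sided01.
have ba := bounded_centeredD a bg bb.
have b1 := bounded_centeredD (- (kap * a)) bg bb.
have i1 := integrable_tilted_mean ba mpsi psi01.
have i2 := integrable_tilted_mean b1 mpsi psi01.
have i3 := integrable_tilted_mean bg mpsi psi01.
have j1 := integrable_tilted_mean ba mph ph01.
have j2 := integrable_tilted_mean b1 mph ph01.
have j3 := integrable_tilted_mean bg mph ph01.
have iZ (k : R) (u : n.-tuple T -> R) :
    (power_probability P n).-integrable setT (EFin \o u) ->
    (power_probability P n).-integrable setT (EFin \o (fun x => k * u x)).
  by move=> iu; exact: (integrableZl measurableT k iu).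
have iD (u v : n.-tuple T -> R) :
    (power_probability P n).-integrable setT (EFin \o u) ->
    (power_probability P n).-integrable setT (EFin \o v) ->
    (power_probability P n).-integrable setT (EFin \o (fun x => u x + v x)).
  by move=> iu iv; exact: (integrableD measurableT iu iv).
rewrite lerBlDr addrAC -lerBlDr opprK /tilted_mean.
have lin (p q : n.-tuple T -> R) k1 k2 u v w :
    (power_probability P n).-integrable setT (EFin \o (fun x => p x * u x)) ->
    (power_probability P n).-integrable setT (EFin \o (fun x => p x * v x)) ->
    (power_probability P n).-integrable setT (EFin \o (fun x => q x * w x)) ->
    \int[power_probability P n]_x (p x * u x) +
    k1 * \int[power_probability P n]_x (p x * v x) +
    k2 * \int[power_probability P n]_x (q x * w x) =
    \int[power_probability P n]_x
      (p x * u x + (k1 * (p x * v x) + k2 * (q x * w x))).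
  move=> iu iv iw.
  rewrite (RintegralD measurableT iu (iD _ _ (iZ k1 _ iv) (iZ k2 _ iw))).
  rewrite (RintegralD measurableT (iZ k1 _ iv) (iZ k2 _ iw)).
  by rewrite (RintegralZl k1 measurableT iv) (RintegralZl k2 measurableT iw) addrA.
rewrite (lin _ _ c1 c_0 _ _ _ i1 i2 j3) (lin _ _ c1 c_0 _ _ _ j1 j2 i3).
apply: (le_Rintegral measurableT
  (iD _ _ i1 (iD _ _ (iZ c1 _ i2) (iZ c_0 _ j3)))
  (iD _ _ j1 (iD _ _ (iZ c1 _ j2) (iZ c_0 _ i3)))) => x _.
rewrite -/(shift a) -/(shift (- (kap * a))).
rewrite (tuple_prod_tilt_shift a x n0) (tuple_prod_tilt_shift (- (kap * a)) x n0).
set z := rt n * tuple_sum b x; set W := tuple_prod _ x.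
have W0 : 0 <= W by apply: tuple_prod_ge0 => y; exact: tilt_ge0.
have phE : ph x = if c < `|z| then 1 else 0 by rewrite /ph two_sidedE.
have := np_optimal (exp_const a) (exp_const (- (kap * a))) c0 a0 kap0 z (psi01 x).
rewrite -phE => /(ler_wpM2l W0); rewrite mulr0 /np_gap -/c1 -/c_0.
set A := expR (a * z - _); set B := expR (- (kap * a) * z - _).
move=> H; rewrite -subr_le0; apply: le_trans H; rewrite le_eqVlt.
by apply/orP; left; apply/eqP; ring.
Qed.

Hypothesis b_gt0 : 0 < inner P b b.

(** The unknown powers of [psi] at the two auxiliary sequences enter with signs for which
    [y0 <= alpha <= y1] suffices. Replacing each local sequence by a tilt costs its distance times
    the corresponding coefficient. *)
Lemma optimality_step (psi : forall n, n.-tuple T -> R) (Q Q0 Q1 : nat -> probability T R) l l0 l1 h h0 h1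
    (D D0 D1 y0 y1 alpha e : R) : is_test_sequence psi ->
  local_density P Q l h -> local_density P Q0 l0 h0 -> local_density P Q1 l1 h1 ->
  sqint P h -> sqint P h0 -> sqint P h1 ->
  norm2 P (fun x => h x - shift a x) < D ->
  norm2 P (fun x => h0 x - g x) < D0 ->
  norm2 P (fun x => h1 x - shift (- (kap * a)) x) < D1 ->
  power_mean psi Q0 n @[n --> \oo] --> y0 -> power_mean psi Q1 n @[n --> \oo] --> y1 ->
  y0 <= alpha -> alpha <= y1 -> 0 < e ->
  \forall n \near \oo, power_mean psi Q n <=
    two_sided_power (norm2 P b) c (inner P b (shift a))
    + c1 * (two_sided_power (norm2 P b) c (inner P b (shift (- (kap * a)))) - alpha)
    - c_0 * (two_sided_power (norm2 P b) c (inner P b g) - alpha)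
    + (D + c1 * D1 + c_0 * D0) + e.
Proof.
move=> test_psi ldQ ldQ0 ldQ1 sh sh0 sh1 hD hD0 hD1 my0 my1 y0a y1a e0.
have ba := bounded_centeredD a bg bb.
have b1 := bounded_centeredD (- (kap * a)) bg bb.
have b_mean : \int[P]_x b x = 0 by case: bb.
have clt u : bounded_centered u ->
    tilted_mean (@two_sided _ T R b c n) u @[n --> \oo] -->
    two_sided_power (norm2 P b) c (inner P b u).
  move=> [mu [H uH] u0].
  exact: (two_sided_clt sb b_mean (ltW c0) b_gt0 mu uH u0).
have eqv u Qu lu hu Du : bounded_centered u -> local_density P Qu lu hu ->
    sqint P hu -> norm2 P (fun x => hu x - u x) < Du ->
    \forall n \near \oo, `|power_mean psi Qu n - tilted_mean (psi n) u| <= Du.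
  move=> [mu [H uH] u0] ldu su Dlt.
  have [N _ HN] := local_asymptotic_equivalence ldu su mu uH u0 Dlt.
  by exists N => // n /HN; apply; case: (test_psi n).
have c1_ge0 : 0 <= c1 by exact: np_coef1_ge0.
have c0_ge0 : 0 <= c_0 by exact: np_coef0_ge0.
have [n1 _ E1] := eqv _ _ _ _ _ ba ldQ sh hD.
have [n2 _ E2] := eqv _ _ _ _ _ bg ldQ0 sh0 hD0.
have [n3 _ E3] := eqv _ _ _ _ _ b1 ldQ1 sh1 hD1.
set Pa := two_sided_power _ _ _.
set P1 := two_sided_power _ _ (inner P b (shift (- _))).
set P0 := two_sided_power _ _ (inner P b g).
(* All terms that converge are collected here; the power under [Q], which need not converge, is left
   out. *)
pose G n := tilted_mean (@two_sided _ T R b c n) (shift a) +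
    c1 * tilted_mean (@two_sided _ T R b c n) (shift (- (kap * a)))
    - c_0 * tilted_mean (@two_sided _ T R b c n) g
    - c1 * power_mean psi Q1 n + c_0 * power_mean psi Q0 n.
have GP : G n @[n --> \oo] --> Pa + c1 * P1 - c_0 * P0 - c1 * y1 + c_0 * y0.
  apply: cvgD; last by apply: cvgM; [exact: cvg_cst|exact: my0].
  apply: cvgB; last by apply: cvgM; [exact: cvg_cst|exact: my1].
  apply: cvgB; last by apply: cvgM; [exact: cvg_cst|exact: (clt _ bg)].
  apply: cvgD; first exact: (clt _ ba).
  by apply: cvgM; [exact: cvg_cst|exact: (clt _ b1)].
have Plt : Pa + c1 * P1 - c_0 * P0 - c1 * y1 + c_0 * y0 <
    Pa + c1 * (P1 - alpha) - c_0 * (P0 - alpha) + e.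
  have k0 := ler_wpM2l c0_ge0 y0a; have k1 := ler_wpM2l c1_ge0 y1a.
  by lra.
have [n4 _ E4] := cvgr_lt _ GP _ Plt.
exists (maxn (maxn n1 n2) (maxn n3 n4)).+1 => // n /=.
move=> nN; have n0 : (0 < n)%N by exact: leq_trans nN.
move: (ltnW nN); rewrite !geq_max => /andP[/andP[/E1 k1 /E2 k2] /andP[/E3 k3 /E4 k4]].
have [mpsi psi01] := test_psi n.
have K := np_weighted n0 mpsi psi01.
rewrite addrAC.
exact: (combine_bounds c1_ge0 c0_ge0 (le_trans (ler_norm _) k1)
  (le_trans (ler_normr_distC _ _) k2) (le_trans (ler_norm _) k3) K k4).
Qed.

End neyman_pearson.
End optimality.

Section inner_limits.
Context d (T : measurableType d) (R : realType) (P : probability T R).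

Lemma inner_cvg (f g : T -> R) (F G : nat -> T -> R) : sqint P f -> sqint P g ->
  (forall j, sqint P (F j)) -> (forall j, sqint P (G j)) ->
  norm2 P (fun x => f x - F j x) @[j --> \oo] --> 0 ->
  norm2 P (fun x => g x - G j x) @[j --> \oo] --> 0 ->
  inner P (F j) (G j) @[j --> \oo] --> inner P f g.
Proof.
move=> sf sg sF sG fF gG.
pose nf j := norm2 P (fun x => f x - F j x).
pose ng j := norm2 P (fun x => g x - G j x).
have B : nf j * norm2 P g + (norm2 P f + nf j) * ng j @[j --> \oo] -->
    0 * norm2 P g + (norm2 P f + 0) * 0.
  apply: cvgD; first by apply: cvgM; [exact: fF|exact: cvg_cst].
  by apply: cvgM; [apply: cvgD; [exact: cvg_cst|exact: fF]|exact: gG].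
rewrite mul0r mulr0 addr0 in B.
apply/cvgrPdist_le => e e0; have [N _ HN] := cvgr_lt _ B _ e0.
exists N => // j /HN /= jN; apply: le_trans (ltW jN).
have sfF := sqintB sf (sF j); have sgG := sqintB sg (sG j).
rewrite (_ : _ - _ = inner P (fun x => f x - F j x) g +
  inner P (F j) (fun x => g x - G j x)); last first.
  by rewrite (innerBl sf (sF j) sg) (innerBr sg (sG j) (sF j)); ring.
rewrite (le_trans (ler_normD _ _))// lerD//.
  exact: cauchy_schwarz.
rewrite (le_trans (cauchy_schwarz (sF j) sgG))// ler_wpM2r ?norm2_ge0//.
rewrite (@eq_norm2 _ _ _ _ _ (fun x => f x + (-1) * (f x - F j x))); last first.
  by move=> x; ring.
rewrite (le_trans (norm2D sf (sqintZ _ sfF)))// lerD2l norm2Z//.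
by rewrite normrN1 mul1r.
Qed.

Lemma norm2_cvg (f : T -> R) (F : nat -> T -> R) : sqint P f ->
  (forall j, sqint P (F j)) ->
  norm2 P (fun x => f x - F j x) @[j --> \oo] --> 0 ->
  norm2 P (F j) @[j --> \oo] --> norm2 P f.
Proof.
move=> sf sF fF; rewrite norm2E; under eq_fun do rewrite norm2E.
apply: continuous_cvg; first exact: sqrt_continuous.
exact: inner_cvg.
Qed.

End inner_limits.

(** * Removing the approximations and letting kap tend to 0 *)

Section optimality_limit.
Context d (T : measurableType d) (R : realType) (P : probability T R).
Variables (dk h : T -> R) (c : R).
Hypotheses (sdk : sqint P dk) (dk0 : \int[P]_x dk x = 0)
  (dk_gt0 : 0 < inner P dk dk) (c0 : 0 < c).
Variables (psi : forall n, n.-tuple T -> R) (Q : nat -> probability T R)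
  (l : nat -> T -> R).
Hypotheses (test_psi : is_test_sequence psi) (ldQ : local_density P Q l h)
  (sh : sqint P h) (theta_neq0 : inner P dk h != 0).

Let s2 := inner P dk dk.
Let theta := inner P dk h.
Let a := theta / s2.
Let alpha := two_sided_power (norm2 P dk) c 0.
Let hp x := h x - a * dk x.

(** Together with [alt_approx], this condenses what unbiasedness and the density of the tangents
    provide: [hp] and its shifts are only limits of tangents. *)
Hypothesis null_approx : forall delta, 0 < delta ->
  exists Q0 l0 g0 y0, [/\ local_density P Q0 l0 g0, sqint P g0,
    norm2 P (fun x => g0 x - hp x) < delta,
    power_mean psi Q0 n @[n --> \oo] --> y0 & y0 <= alpha].
Hypothesis alt_approx : forall kap delta, 0 < kap -> 0 < delta ->
  exists Q1 l1 g1 y1, [/\ local_density P Q1 l1 g1, sqint P g1,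
    norm2 P (fun x => g1 x - (hp x + - (kap * a) * dk x)) < delta,
    power_mean psi Q1 n @[n --> \oo] --> y1 & alpha <= y1].

Let a_neq0 : a != 0.
Proof. by rewrite mulf_neq0// invr_neq0// gt_eqF. Qed.

Let shp : sqint P hp. Proof. by apply: sqintB => //; exact: sqintZ. Qed.

Let hp0 : \int[P]_x hp x = 0.
Proof.
rewrite RintegralB//; [|exact: sqint_integrable|]; last first.
  exact: (sqint_integrable (sqintZ a sdk)).
rewrite RintegralZl ?dk0 ?mulr0 ?subr0//; last exact: sqint_integrable.
exact: local_density_mean0 ldQ sh.
Qed.

Let a_s2 : a * s2 = theta. Proof. by rewrite divfK// gt_eqF. Qed.

Let hp_dk : inner P hp dk = 0.
Proof.
rewrite (innerBl sh (sqintZ a sdk) sdk) (innerZl a sdk sdk) -/s2 a_s2.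
by rewrite (innerC P h) subrr.
Qed.

Let norm_dk_gt0 : 0 < norm2 P dk. Proof. by rewrite norm2E sqrtr_gt0. Qed.

(** The limit of [exp_const]: the mixed term disappears because [hp] is orthogonal to [dk]. *)
Let K_ s : R := s ^+ 2 * s2 / 2.

Let limit_bound kap : R := two_sided_power (norm2 P dk) c theta +
  np_coef1 c a kap (K_ a) (K_ (- (kap * a))) *
  (two_sided_power (norm2 P dk) c (- (kap * theta)) - alpha).

(** At fixed [kap] both coefficients converge along the bounded approximations, so the approximation
    errors vanish in the limit. The term of the hypothesis vanishes too, the limiting power there
    being exactly [alpha]. *)
Let optimality_fixed_kap kap e : 0 < kap -> 0 < e ->
  \forall n \near \oo, power_mean psi Q n <= limit_bound kap + e.
Proof.
move=> kap0 e0.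
(* The factor [norm2 P dk] keeps the approximations of [dk] away from zero: an error below the norm
   of [dk] leaves a function of positive norm. *)
pose del (j : nat) : R := norm2 P dk * j.+1%:R^-1.
have del_gt0 j : 0 < del j by rewrite mulr_gt0// invr_gt0.
have del_le j : del j <= norm2 P dk.
  by rewrite ler_piMr ?(ltW norm_dk_gt0)// invf_le1// ler1n.
have del0 : del j @[j --> \oo] --> 0.
  rewrite -[X in _ --> X](mulr0 (norm2 P dk)); apply: cvgM; first exact: cvg_cst.
  exact: cvg_harmonic.
have approx f : sqint P f -> \int[P]_x f x = 0 -> exists F : nat -> T -> R,
    forall j, bounded_centered P (F j) /\ norm2 P (fun x => f x - F j x) < del j.
  move=> sf f0; have ex j : exists F : T -> R, bounded_centered P F /\
      norm2 P (fun x => f x - F x) < del j.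
    have [F [M [mF FM F0 fF]]] := bounded_centered_approx sf f0 (del_gt0 j).
    by exists F; split => //; split => //; exists M.
  by have [F HF] := choice ex; exists F.
have [b Hb] := approx _ sdk dk0.
have [p Hp] := approx _ shp hp0.
have bb j : bounded_centered P (b j) by have [] := Hb j.
have bp j : bounded_centered P (p j) by have [] := Hp j.
have sb j := bounded_centered_sqint (bb j).
have sp j := bounded_centered_sqint (bp j).
have cb : norm2 P (fun x => dk x - b j x) @[j --> \oo] --> 0.
  apply: (@squeeze_cvgr _ _ _ _ (fun=> 0) del) => //; last exact: cvg_cst.
  by apply: nearW => j; rewrite norm2_ge0/=; apply: ltW; have [] := Hb j.
have cp : norm2 P (fun x => hp x - p j x) @[j --> \oo] --> 0.
  apply: (@squeeze_cvgr _ _ _ _ (fun=> 0) del) => //; last exact: cvg_cst.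
  by apply: nearW => j; rewrite norm2_ge0/=; apply: ltW; have [] := Hp j.
have b_gt0 j : 0 < inner P (b j) (b j).
  rewrite -norm2_sqr exprn_gt0//.
  have [_ hb] := Hb j; have := lt_le_trans hb (del_le j).
  have := norm2D (sqintB sdk (sb j)) (sb j).
  rewrite (@eq_norm2 _ _ _ _ (fun x => dk x - b j x + b j x) dk); last first.
    by move=> x; rewrite subrK.
  by lra.
pose m j := inner P (p j) (b j).
pose v j := inner P (b j) (b j).
have m_cvg : m j @[j --> \oo] --> 0 by rewrite -hp_dk; exact: inner_cvg.
have v_cvg : v j @[j --> \oo] --> s2 by exact: inner_cvg.
have nb_cvg : norm2 P (b j) @[j --> \oo] --> norm2 P dk by exact: norm2_cvg.
pose k1 j := np_coef1 c a kap (exp_const P (b j) (p j) a)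
  (exp_const P (b j) (p j) (- (kap * a))).
pose k0 j := np_coef0 c a kap (exp_const P (b j) (p j) a)
  (exp_const P (b j) (p j) (- (kap * a))).
have e_cvg s : exp_const P (b j) (p j) s @[j --> \oo] --> K_ s.
  rewrite /exp_const.
  have : s * m j + s ^+ 2 * v j / 2 @[j --> \oo] --> s * 0 + s ^+ 2 * s2 / 2.
    apply: cvgD; first by apply: cvgM => //; exact: cvg_cst.
    apply: cvgM; last exact: cvg_cst.
    by apply: cvgM => //; exact: cvg_cst.
  by rewrite mulr0 add0r.
have expR_cvg (u : nat -> R) (w : R) : u j @[j --> \oo] --> w ->
    expR (u j) @[j --> \oo] --> expR w.
  by move=> uw; apply: (@cvg_comp _ _ _ u expR _ _ _ uw); exact: continuous_expR.
have k1_cvg : k1 j @[j --> \oo] --> np_coef1 c a kap (K_ a) (K_ (- (kap * a))).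
  apply: cvgM; last exact: cvg_cst.
  by apply: expR_cvg; apply: cvgB; exact: e_cvg.
have k0_cvg : k0 j @[j --> \oo] --> np_coef0 c a kap (K_ a) (K_ (- (kap * a))).
  apply: cvgD; apply: cvgM; try exact: cvg_cst.
    by apply: expR_cvg; apply: cvgN; exact: e_cvg.
  apply: cvgM; first exact: k1_cvg.
  by apply: expR_cvg; apply: cvgN; exact: e_cvg.
have inn s j : inner P (b j) (fun x => p j x + s * b j x) = m j + s * v j.
  by rewrite (innerDr (sp j) (sqintZ s (sb j)) (sb j)) (innerZr s (sb j) (sb j)) innerC.
have pow_cvg (mm : nat -> R) (mm' : R) : mm j @[j --> \oo] --> mm' ->
    two_sided_power (norm2 P (b j)) c (mm j) @[j --> \oo] -->
    two_sided_power (norm2 P dk) c mm'.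
  move=> mmc; apply: (@two_sided_power_cvg _ _ (fun=> c)) => //.
    by rewrite gt_eqF.
  exact: cvg_cst.
(* The factors of [del j] come from the triangle inequality: one [del j] for approximating [hp], the
   absolute value of the shift for approximating [dk], and one more where the tangent of the
   auxiliary sequence is itself an approximation. *)
pose Y j := two_sided_power (norm2 P (b j)) c (inner P (b j) (fun x => p j x + a * b j x))
    + k1 j * (two_sided_power (norm2 P (b j)) c
        (inner P (b j) (fun x => p j x + - (kap * a) * b j x)) - alpha)
    - k0 j * (two_sided_power (norm2 P (b j)) c (inner P (b j) (p j)) - alpha)
    + ((1 + `|a|) * del j + k1 j * ((2 + `|kap * a|) * del j) + k0 j * (2 * del j)).
have Y_cvg : Y j @[j --> \oo] --> limit_bound kap.
  have -> : limit_bound kap = two_sided_power (norm2 P dk) c theta +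
     np_coef1 c a kap (K_ a) (K_ (- (kap * a))) *
       (two_sided_power (norm2 P dk) c (- (kap * theta)) - alpha)
     - np_coef0 c a kap (K_ a) (K_ (- (kap * a))) *
       (two_sided_power (norm2 P dk) c 0 - alpha)
     + ((1 + `|a|) * 0 + np_coef1 c a kap (K_ a) (K_ (- (kap * a))) *
         ((2 + `|kap * a|) * 0) + np_coef0 c a kap (K_ a) (K_ (- (kap * a))) * (2 * 0)).
    by rewrite /limit_bound -/alpha subrr !mulr0 subr0 !addr0.
  have dcst k : k * del j @[j --> \oo] --> k * 0.
    by apply: cvgM => //; exact: cvg_cst.
  have mshift s : inner P (b j) (fun x => p j x + s * b j x) @[j --> \oo] --> s * s2.
    under eq_fun do rewrite inn; rewrite -[s * s2]add0r.
    by apply: cvgD => //; apply: cvgM => //; exact: cvg_cst.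
  apply: cvgD; last first.
    apply: cvgD; last by apply: cvgM; [exact: k0_cvg|exact: dcst].
    by apply: cvgD; [exact: dcst|apply: cvgM; [exact: k1_cvg|exact: dcst]].
  apply: cvgB.
    apply: cvgD; first by apply: pow_cvg; rewrite -a_s2; exact: mshift.
    apply: cvgM; first exact: k1_cvg.
    apply: cvgB; last exact: cvg_cst.
    apply: pow_cvg; rewrite (_ : - (kap * theta) = - (kap * a) * s2); last first.
      by rewrite mulNr -mulrA a_s2.
    exact: mshift.
  apply: cvgM; first exact: k0_cvg.
  apply: cvgB; last exact: cvg_cst.
  by apply: pow_cvg; under eq_fun do rewrite innerC; exact: m_cvg.
have e2 : 0 < e / 2 by rewrite divr_gt0.
have Xlt : limit_bound kap < limit_bound kap + e / 2 by rewrite ltrDl.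
have [N _ HN] := cvgr_lt _ Y_cvg _ Xlt.
pose j := N; have {HN} YX : Y j < limit_bound kap + e / 2 by exact: (HN N (leqnn N)).
have [_ hbj] := Hb j; have [_ hpj] := Hp j.
have sdb := sqintB sdk (sb j); have shpp := sqintB shp (sp j).
have [Q0 [l0 [g0 [y0 [ld0 sg0 g0d my0 y0a]]]]] := null_approx (del_gt0 j).
have [Q1 [l1 [g1 [y1 [ld1 sg1 g1d my1 y1a]]]]] := alt_approx kap0 (del_gt0 j).
have dZ k : norm2 P (fun x => k * (dk x - b j x)) <= `|k| * del j.
  by rewrite norm2Z// ler_wpM2l// ltW.
have D1 : norm2 P (fun x => h x - (p j x + a * b j x)) < (1 + `|a|) * del j.
  rewrite (@eq_norm2 _ _ _ _ _ (fun x => (hp x - p j x) + a * (dk x - b j x))); last first.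
    by move=> x; rewrite /hp; ring.
  apply: (le_lt_trans (norm2D shpp (sqintZ a sdb))).
  by rewrite mulrDl mul1r ltr_leD.
have D2 : norm2 P (fun x => g0 x - p j x) < 2 * del j.
  apply: (le_lt_trans (norm2_triangle sg0 (sp j) shp)).
  by rewrite mulr_natl mulr2n ltrD.
have D3 : norm2 P (fun x => g1 x - (p j x + - (kap * a) * b j x)) <
    (2 + `|kap * a|) * del j.
  have sx : sqint P (fun x => hp x + - (kap * a) * dk x).
    by apply: sqintD => //; exact: sqintZ.
  have sy : sqint P (fun x => p j x + - (kap * a) * b j x).
    by apply: sqintD => //; exact: sqintZ.
  apply: (le_lt_trans (norm2_triangle sg1 sy sx)).
  rewrite [in ltLHS](@eq_norm2 _ _ _ _ (fun x => hp x + - (kap * a) * dk x - _)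
    (fun x => (hp x - p j x) + - (kap * a) * (dk x - b j x))); last first.
    by move=> x; ring.
  have k2 := dZ (- (kap * a)); rewrite normrN in k2.
  have := norm2D shpp (sqintZ (- (kap * a)) sdb).
  by rewrite mulrDl; lra.
have step := optimality_step (bb j) (bp j) c0 a_neq0 kap0 (b_gt0 j) test_psi
  ldQ ld0 ld1 sh sg0 sg1 D1 D2 D3 my0 my1 y0a y1a e2.
apply: filterS step => n hn; apply: (le_trans hn).
rewrite -/(k1 j) -/(k0 j) -/(Y j).
by rewrite [e in leRHS]splitr addrA lerD2r ltW.
Qed.

Lemma two_sided_optimal e : 0 < e ->
  \forall n \near \oo, power_mean psi Q n <=
    two_sided_power (norm2 P dk) c theta + e.
Proof.
move=> e0.
pose z := a * c.
have z0 : z != 0 by rewrite mulf_neq0// gt_eqF.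
(* [M] bounds [kap] times the first coefficient for all [kap <= 1], and 48 is the constant of
   [two_sided_power_taylor]; the excess in [limit_bound] is then at most [B * kap]. *)
pose M := `|expR z - expR (- z)| / `|z|.
have M0 : 0 <= M by rewrite divr_ge0.
pose B := M * (48 * (theta / norm2 P dk) ^+ 2).
have B0 : 0 <= B by rewrite mulr_ge0// mulr_ge0// sqr_ge0.
suff bound kap : 0 < kap -> kap <= 1 ->
    limit_bound kap <= two_sided_power (norm2 P dk) c theta + B * kap.
  pose kap := Num.min 1 (e / 2 / (B + 1)).
  have B1 : 0 < B + 1 by lra.
  have kap0 : 0 < kap by rewrite lt_min ltr01 !divr_gt0.
  have kap1 : kap <= 1 by rewrite ge_min lexx.
  have kapB : B * kap <= e / 2.
    apply: (@le_trans _ _ ((B + 1) * kap)); first by rewrite ler_wpM2r ?(ltW kap0)//; lra.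
    by rewrite mulrC -ler_pdivlMr// ge_min lexx orbT.
  have e2 : 0 < e / 2 by rewrite divr_gt0.
  apply: filterS (optimality_fixed_kap kap0 e2) => n hn.
  apply: (le_trans hn); have := bound kap kap0 kap1.
  by lra.
move=> kap0 kap1; rewrite /limit_bound lerD2l.
have T1 := two_sided_power_taylor c (- (kap * theta)) norm_dk_gt0.
rewrite -/alpha in T1.
have k1_ge0 : 0 <= np_coef1 c a kap (K_ a) (K_ (- (kap * a))).
  exact: np_coef1_ge0.
have k1_le : np_coef1 c a kap (K_ a) (K_ (- (kap * a))) * kap <= M.
  (* The exponent constant at the shift by -kap a is kap^2 times the one at a, hence not larger when
     kap <= 1. *)
  apply: np_coef1_le => //; rewrite /K_ ler_pM2r ?invr_gt0// ler_pM2r//.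
  by rewrite sqrrN exprMn ler_piMl ?sqr_ge0// expr_le1// ltW.
have T2 : two_sided_power (norm2 P dk) c (- (kap * theta)) - alpha <=
    48 * (kap * theta / norm2 P dk) ^+ 2.
  by rewrite lerBlDl (le_trans T1)// mulNr sqrrN.
apply: (le_trans (ler_wpM2l k1_ge0 T2)).
set k1 := np_coef1 _ _ _ _ _ in k1_ge0 k1_le *.
rewrite (_ : _ * _ = k1 * kap * (48 * (theta / norm2 P dk) ^+ 2) * kap); last first.
  by rewrite -!mulrA exprMn; ring.
by rewrite ler_wpM2r ?(ltW kap0)// ler_wpM2r// mulr_ge0// sqr_ge0.
Qed.

End optimality_limit.

Section expectations.
Context d (T : measurableType d) (R : realType).
Variables (psi : forall n, n.-tuple T -> R) (Q : nat -> probability T R).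
Hypothesis test_psi : is_test_sequence psi.

Lemma power_mean_EFin n : expectation_seq psi Q n = (power_mean psi Q n)%:E.
Proof.
rewrite /power_mean /Rintegral fineK//; apply: integrable_fin_num => //.
have [mpsi psi01] := test_psi n.
apply: (@bounded_integrable _ _ _ _ _ 1) => // x.
by have /andP[p0 p1] := psi01 x; rewrite ger0_norm.
Qed.

Lemma expectation_cvg y : power_mean psi Q n @[n --> \oo] --> y ->
  expectation_seq psi Q n @[n --> \oo] --> y%:E.
Proof.
move=> my; under eq_fun do rewrite power_mean_EFin.
by apply: cvg_EFin => //; exact: nearW.
Qed.

Lemma power_mean01 n : 0 <= power_mean psi Q n <= 1.
Proof.
have [mpsi psi01] := test_psi n; rewrite -!lee_fin -power_mean_EFin.
apply/andP; split.
  by apply: integral_ge0 => x _; rewrite lee_fin; case/andP: (psi01 x).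
rewrite -(probability_setT (power_probability (Q n) n)) -[leRHS]mul1e -integral_cst//.
apply: ge0_le_integral => //; first 2 last.
- by move=> x _; rewrite lee_fin; case/andP: (psi01 x).
- by move=> x _; rewrite lee_fin; case/andP: (psi01 x).
- exact/measurable_EFinP.
Qed.

Lemma power_mean_cvg : cvgn (expectation_seq psi Q) -> exists y,
  power_mean psi Q n @[n --> \oo] --> y /\ limn (expectation_seq psi Q) = y%:E.
Proof.
move=> cvQ; pose y := limn (expectation_seq psi Q).
have y0 : (0 <= y)%E.
  apply: lime_ge => //; apply: nearW => n; rewrite power_mean_EFin lee_fin.
  by case/andP: (power_mean01 n).
have y1 : (y <= 1)%E.
  apply: lime_le => //; apply: nearW => n; rewrite power_mean_EFin lee_fin.
  by case/andP: (power_mean01 n).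
have yfin : y \is a fin_num by rewrite ge0_fin_numE// (le_lt_trans y1)// ltry.
exists (fine y); rewrite fineK//; split => //.
rewrite (_ : power_mean psi Q = fine \o expectation_seq psi Q); last first.
  by apply/funext => n; rewrite /= power_mean_EFin.
by apply: fine_cvg; rewrite fineK.
Qed.

Lemma expectation_limn_esup y :
  (forall e : R, 0 < e -> \forall n \near \oo, power_mean psi Q n <= y + e) ->
  (limn_esup (expectation_seq psi Q) <= y%:E)%E.
Proof.
move=> H; apply/lee_addgt0Pr => e e0; have [N _ HN] := H e e0.
rewrite limn_esup_lim -EFinD.
apply: (@le_trans _ _ (esups (expectation_seq psi Q) N)).
  apply: lime_le; first exact: is_cvg_esups.
  exists N => // n Nn; exact: nonincreasing_esups.
apply: ge_ereal_sup => _ [n /= Nn <-].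
by rewrite power_mean_EFin lee_fin; exact: HN.
Qed.

End expectations.

(** * From curve sequences to unbiasedness and maximal power *)

Section unbiased_tests.
Context d (T : measurableType d) (R : realType).
Variables (PP : set (probability T R)) (P0 : probability T R).
Variables (k : probability T R -> R) (dk : T -> R).
Hypothesis gradk : is_gradient PP P0 k dk.

Let sdk : sqint P0 dk. Proof. by have [/sqintP] := gradk. Qed.

Let dk0 : \int[P0]_x dk x = 0. Proof. by have [] := gradk. Qed.

Lemma tangents_sqint g : tangents PP P0 g -> sqint P0 g.
Proof. by move=> [eps [c [_ _ _ /sqintP]]]. Qed.

Lemma tangent_space_sqint g : tangent_space PP P0 g -> sqint P0 g.
Proof. by move=> [/sqintP]. Qed.

Lemma local_sequence_hypothesis Q h : local_sequence PP P0 Q h ->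
  inner P0 dk h = 0 -> implicit_hypotheses PP P0 k Q.
Proof. by move=> [cQ _ kQ] dkh; split => //; rewrite -dkh; exact: kQ. Qed.

Lemma local_sequence_alternative Q h : local_sequence PP P0 Q h ->
  inner P0 dk h != 0 -> implicit_alternatives PP P0 k Q.
Proof.
by move=> [cQ _ kQ] dkh; split => //; exists (inner P0 dk h) => //; exact: kQ.
Qed.

(** By uniqueness of limits the rescaled difference of the functional converges to the inner product
    of [dk] with the local tangent, so being an alternative means not being orthogonal to [dk]. *)
Lemma alternative_local Q : implicit_alternatives PP P0 k Q ->
  exists b g, [/\ 0 < b, tangents PP P0 g,
    local_sequence PP P0 Q (fun x => b * g x) & inner P0 dk (fun x => b * g x) != 0].
Proof.
move=> [/curve_sequences_local[b [g [b0 tg lQ]]] [l l0 kl]].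
exists b, g; split => //; have [_ _ /(_ _ _ gradk) kQ] := lQ.
by rewrite -(cvg_unique _ kl kQ).
Qed.

Lemma hypothesis_local Q : implicit_hypotheses PP P0 k Q ->
  exists b g, [/\ 0 < b, tangents PP P0 g,
    local_sequence PP P0 Q (fun x => b * g x) & inner P0 dk (fun x => b * g x) = 0].
Proof.
move=> [/curve_sequences_local[b [g [b0 tg lQ]]] kl].
exists b, g; split => //; have [_ _ /(_ _ _ gradk) kQ] := lQ.
by rewrite -(cvg_unique _ kl kQ).
Qed.

Hypothesis dk_gt0 : 0 < inner P0 dk dk.
Variable c : R.
Hypothesis c0 : 0 < c.

Let test_ts : is_test_sequence (fun n => @two_sided _ T R dk c n).
Proof.
move=> n; split; last by move=> x; exact: two_sided01.
by apply: measurable_two_sided; case: sdk.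
Qed.

Let local_power Q h : local_sequence PP P0 Q h -> sqint P0 h ->
  expectation_seq (fun n => @two_sided _ T R dk c n) Q n @[n --> \oo] -->
  (two_sided_power (norm2 P0 dk) c (inner P0 dk h))%:E.
Proof.
move=> [_ [l ldQ] _] sh; apply: expectation_cvg => //.
exact: (two_sided_local_power sdk dk0 (ltW c0) dk_gt0 ldQ sh).
Qed.

Let norm_dk_gt0 : 0 < norm2 P0 dk. Proof. by rewrite norm2E sqrtr_gt0. Qed.

Let alpha := two_sided_power (norm2 P0 dk) c 0.

Lemma two_sided_unbiased : asymptotically_unbiased alpha
  (implicit_hypotheses PP P0 k) (implicit_alternatives PP P0 k)
  (fun n => @two_sided _ T R dk c n).
Proof.
split => // Q => [/alternative_local|/hypothesis_local] [b [g [b0 tg lQ thQ]]].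
  have pQ := local_power lQ (sqintZ b (tangents_sqint tg)).
  split; first by apply/cvg_ex; eexists; exact: pQ.
  rewrite (cvg_lim _ pQ)//= lee_fin; apply: two_sided_power_ge => //; exact: ltW.
have pQ := local_power lQ (sqintZ b (tangents_sqint tg)).
split; first by apply/cvg_ex; eexists; exact: pQ.
by rewrite (cvg_lim _ pQ)//= thQ.
Qed.

Hypothesis linT : GRing.submod_closed (mem (tangent_space PP P0)).
Hypothesis dkT : tangent_space PP P0 dk.
Hypothesis denseN : orthogonal_tangents PP P0 dk `<=`
  L2_closure P0 (tangents PP P0 `&` orthogonal_tangents PP P0 dk).
Hypothesis tangents_sub : tangents PP P0 `<=` tangent_space PP P0.

Let tangent_spaceD a u v : tangent_space PP P0 u -> tangent_space PP P0 v ->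
  tangent_space PP P0 (fun x => v x + a * u x).
Proof.
move=> tu tv; have [_ /(_ a u v)] := linT.
rewrite !inE => /(_ tu tv); congr (tangent_space _ _ _).
by apply/funext => x; rewrite addrC.
Qed.

Let tangent_spaceZ a u : tangent_space PP P0 u ->
  tangent_space PP P0 (fun x => a * u x).
Proof.
move=> tu; have [t0 _] := linT; rewrite inE in t0.
have := tangent_spaceD a tu t0; congr (tangent_space _ _ _).
by apply/funext => x; rewrite add0r.
Qed.

Let closure_norm2 (A : set (T -> R)) h e : L2_closure P0 A h ->
  (forall g, A g -> sqint P0 g) -> 0 < e ->
  exists2 g, A g & norm2 P0 (fun x => g x - h x) < e.
Proof.
move=> [/sqintP sh hA] sA e0; have [g Ag] := hA e e0.
rewrite (@Lnorm_norm2 _ _ _ P0 (fun x => g x - h x)); last exact: sqintB (sA _ Ag) sh.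
by rewrite lte_fin; exists g.
Qed.

(** Linearity of the tangent space places [hp] and its shifts along [dk] in it. It remains to
    approximate them by tangents whose local sequences lie in the hypothesis or in the alternative,
    where the unbiasedness of [psi] applies. *)
Lemma two_sided_most_powerful psi : asymptotically_unbiased alpha
    (implicit_hypotheses PP P0 k) (implicit_alternatives PP P0 k) psi ->
  forall Q, implicit_alternatives PP P0 k Q ->
    (limn_esup (expectation_seq psi Q) <=
     limn (expectation_seq (fun n => @two_sided _ T R dk c n) Q))%E.
Proof.
move=> [test_psi altpsi hyppsi] Q /alternative_local[b [g [b0 tg lQ thQ]]].
set h := (fun x => b * g x) in lQ thQ.
have sh : sqint P0 h by exact: sqintZ (tangents_sqint tg).
have th : tangent_space PP P0 h by apply: tangent_spaceZ; exact: tangents_sub.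
rewrite (cvg_lim _ (local_power lQ sh))//=.
have [_ [l ldQ] _] := lQ.
apply: expectation_limn_esup => // e e0.
apply: (two_sided_optimal sdk dk0 dk_gt0 c0 test_psi ldQ sh thQ) => //.
- move=> delta delta0; set a := _ / _.
  have thp : tangent_space PP P0 (fun x => h x + - a * dk x) by exact: tangent_spaceD.
  have hp0 : inner P0 dk (fun x => h x + - a * dk x) = 0.
    rewrite (innerDr sh (sqintZ (- a) sdk) sdk) (innerZr (- a) sdk sdk).
    by rewrite mulNr divfK ?subrr// gt_eqF.
  have ohp : orthogonal_tangents PP P0 dk (fun x => h x + - a * dk x).
    by split => //; rewrite -/(inner P0 _ dk) innerC.
  (* Approximation by arbitrary tangents would not do: orthogonality to [dk] is needed exactly, for
     the sequence to belong to the hypothesis. *)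
  have [g0 [tg0 [_ og0]] hg0] := closure_norm2 (denseN ohp)
    (fun g gT => tangents_sqint gT.1) delta0.
  have sg0 := tangents_sqint tg0.
  have [Q0 lQ0] := tangents_local tg0.
  have H0 : implicit_hypotheses PP P0 k Q0.
    by apply: (local_sequence_hypothesis lQ0); rewrite innerC.
  have [cvQ0 limQ0] := hyppsi _ H0.
  have [y0 [my0 ly0]] := power_mean_cvg test_psi cvQ0.
  have [_ [l0 ldQ0] _] := lQ0.
  exists Q0, l0, g0, y0; split => //.
    rewrite (le_lt_trans _ hg0)// le_eqVlt; apply/orP; left; apply/eqP.
    by apply: eq_norm2 => x; rewrite mulNr.
  by rewrite -lee_fin -ly0.
move=> kap delta kap0 delta0; set th0 := inner P0 dk h; set a := _ / _.
pose w x := h x + - (a + kap * a) * dk x.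
have tw : tangent_space PP P0 w by exact: tangent_spaceD.
have sw := tangent_space_sqint tw.
have dkw : inner P0 dk w = - (kap * th0).
  rewrite (innerDr sh (sqintZ _ sdk) sdk) (innerZr _ sdk sdk).
  have as2 : a * inner P0 dk dk = th0 by rewrite divfK// gt_eqF.
  by rewrite mulNr mulrDl -[kap * a * _]mulrA as2 opprD addrA subrr add0r.
have kth : 0 < `|kap * th0| by rewrite normr_gt0 mulf_neq0// gt_eqF.
(* The second bound guarantees, by Cauchy-Schwarz, that the approximating tangent changes the inner
   product with [dk] by less than |kap th0|, so it cannot be orthogonal to [dk]. *)
pose e1 := Num.min delta (`|kap * th0| / norm2 P0 dk).
have e1_gt0 : 0 < e1 by rewrite lt_min delta0 divr_gt0.
have [g1 tg1 hg1] := closure_norm2 tw tangents_sqint e1_gt0.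
have sg1 := tangents_sqint tg1.
move: hg1; rewrite lt_min => /andP[hg1 hg1'].
have [Q1 lQ1] := tangents_local tg1.
have dkg1 : inner P0 dk g1 != 0.
  apply/eqP => dkg1; have := cauchy_schwarz sdk (sqintB sg1 sw).
  rewrite (innerBr sg1 sw sdk) dkg1 dkw sub0r opprK leNgt => /negP; apply.
  by rewrite mulrC -ltr_pdivlMr.
have K1 : implicit_alternatives PP P0 k Q1.
  exact: (local_sequence_alternative lQ1).
have [cvQ1 limQ1] := altpsi _ K1.
have [y1 [my1 ly1]] := power_mean_cvg test_psi cvQ1.
have [_ [l1 ldQ1] _] := lQ1.
exists Q1, l1, g1, y1; split => //.
  rewrite (le_lt_trans _ hg1)// le_eqVlt; apply/orP; left; apply/eqP.
  by apply: eq_norm2 => x; rewrite /w; ring.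
by rewrite -lee_fin -ly1.
Qed.

End unbiased_tests.

Theorem theorem13 (d : measure_display) (Omega : measurableType d)
  (R : realType) (PP : set (probability Omega R)) (P0 : probability Omega R)
  (PP0 : PP P0) (alpha : R) (alpha01 : 0 < alpha < 1)
  (linT : GRing.submod_closed (mem (tangent_space PP P0)))
  (k : probability Omega R -> R) (dk : Omega -> R)
  (diffk : differentiable_functional PP P0 k)
  (gradk : is_canonical_gradient PP P0 k dk)
  (dk_neq0 : \int[P0]_x (dk x ^+ 2) != 0)
  (denseN : L2_dense_in P0
     (tangents PP P0 `&` orthogonal_tangents PP P0 dk)
     (orthogonal_tangents PP P0 dk))
  (denseT : L2_dense_in P0 (tangents PP P0) (tangent_space PP P0)) :
  asymptotically_most_powerful_unbiased alpha
    (implicit_hypotheses PP P0 k) (implicit_alternatives PP P0 k)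
    (two_sided_test P0 dk alpha).
Proof.
have [gk dkT _] := gradk; have [_ denseN'] := denseN; have [subT _] := denseT.
have sdk : sqint P0 dk by have [/sqintP] := gk.
have dk_gt0 : 0 < inner P0 dk dk.
  by rewrite lt_neqAle eq_sym inner_ge0 andbT.
have norm_gt0 : 0 < norm2 P0 dk by rewrite norm2E sqrtr_gt0.
case/andP: alpha01 => alpha0 alpha1.
have u01 : 0 < 1 - alpha / 2 < 1 by lra.
pose c := std_normal_quantile (1 - alpha / 2) * norm2 P0 dk.
have c0 : 0 < c by rewrite mulr_gt0// quantile_gt0//; lra.
(* At mean 0 both tails equal [Phi] at minus the quantile, that is, alpha / 2 each. *)
have level : alpha = two_sided_power (norm2 P0 dk) c 0.
  rewrite /two_sided_power oppr0 sub0r mulNr mulfK ?gt_eqF// PhiN Phi_quantile//.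
  by field.
rewrite (_ : two_sided_test P0 dk alpha = fun n => @two_sided _ Omega R dk c n)//.
rewrite level; split; first exact: two_sided_unbiased.
exact: two_sided_most_powerful.
Qed.
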